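(* Let $1<p<N$, $m>0$, $0\le\mu<\bar\mu=\left(\frac{N-p}{p}\right)^p$, and let $f\in C(\mathbb{R})$ satisfy $$\limsup_{t\to0}\frac{|f(t)|}{|t|^{q-1}}\le A<\infty$$ for some $q>p$ and some constant $A>0$. Let $u\in W^{1,p}(\mathbb{R}^N)$ be a positive radial weak solution of $$-\Delta_p u-\frac{\mu}{|x|^p}|u|^{p-2}u+m|u|^{p-2}u=f(u)\quad\text{in }\mathbb{R}^N,$$ write $u(x)=u(r)$ with $r=|x|$, and let $k$ be the integer such that $k\le p<k+1$. Then $u'(r)<0$ for $r$ large enough, and $$\left(-\frac{u'(r)}{u(r)}\right)^{p-1}=\sum_{i=0}^{k}\frac{c_i}{r^i}-\frac{\left((p-1)/m\right)^{1/p}\mu}{p\,r^p}+O\left(\frac{1}{r^{k+1}}\right)\quad\text{as }r\to\infty,$$ where $$c_0=\left(\frac{m}{p-1}\right)^{\frac{p-1}{p}},\qquad c_1=\frac{N-1}{p}\left(\frac{m}{p-1}\right)^{\frac{p-2}{p}},$$ and $\{c_i\}_{i=2}^k$ are determined uniquely by $$(N-i)c_{i-1}-p\left(\frac{m}{p-1}\right)^{\frac1p}c_i=\sum_{n=2}^{i}\frac{F^{(n)}(0)}{n!}\sum_{\substack{j_1+\cdots+j_n=i\\ j_1,\dots,j_n>0}}c_{j_1}c_{j_2}\cdots c_{j_n},$$ where $F^{(n)}(0)$ is the $n$-th derivative at $t=0$ of the function $F(t)=(p-1)(c_0+t)^{\frac{p}{p-1}}$.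
   Context: $N$ is the (integer) dimension and $\Delta_p u=\sum_{i=1}^N\partial_{x_i}(|\nabla u|^{p-2}\partial_{x_i}u)$ is the $p$-Laplacian. Weak solution: $u\in W^{1,p}(\mathbb{R}^N)$ is a weak subsolution (resp. supersolution) of the equation if for every nonnegative $\varphi\in C_0^\infty(\mathbb{R}^N)$ one has (all integrals being understood to be well defined) $$\int_{\mathbb{R}^N}\left(|\nabla u|^{p-2}\nabla u\cdot\nabla\varphi-\frac{\mu}{|x|^p}|u|^{p-2}u\varphi+m|u|^{p-2}u\varphi\right)\le\ (\text{resp. }\ge)\ \int_{\mathbb{R}^N}f(u)\varphi;$$ it is a weak solution if it is both a weak subsolution and a weak supersolution. A radial function in $W^{1,p}(\mathbb{R}^N)$ is identified with its representative that is continuous on $\mathbb{R}^N\setminus\{0\}$; for a positive radial weak solution, $u$ is then $C^1$ as a function of $r\in(0,\infty)$. The indices $j_1,\dots,j_n$ are positive integers. *)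

(* Defs.v *)
From HB Require Import structures.
From mathcomp Require Import all_boot all_order all_algebra.
From mathcomp Require Import all_classical all_reals all_analysis.

Set Implicit Arguments.
Unset Strict Implicit.
Unset Printing Implicit Defensive.

Import Order.TTheory GRing.Theory Num.Theory.
Import numFieldNormedType.Exports.

Local Open Scope classical_set_scope.
Local Open Scope ring_scope.

(* The sigma-algebra on R^n generated by the coordinates, as for n.-tuple. *)
Section measurable_rowvector.
Context {d} {T : sigmaRingType d} (n : nat).

Let coor : 'I_n -> 'rV[T]_n -> T := fun i x => x ord0 i.

Let rV_set0 : g_sigma_preimage coor set0.
Proof. exact: sigma_algebra0. Qed.

Let rV_setC A : g_sigma_preimage coor A -> g_sigma_preimage coor (~` A).
Proof. exact: sigma_algebraC. Qed.

Let rV_bigcup (F : _^nat) : (forall i, g_sigma_preimage coor (F i)) ->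
  g_sigma_preimage coor (\bigcup_i (F i)).
Proof. exact: sigma_algebra_bigcup. Qed.

HB.instance Definition _ := @isMeasurable.Build (measure_tuple_display d)
  'rV[T]_n (g_sigma_preimage coor) rV_set0 rV_setC rV_bigcup.

End measurable_rowvector.

Lemma measurable_coord_rV d (T : measurableType d) n (i : 'I_n) :
  measurable_fun [set: 'rV[T]_n] (fun x : 'rV[T]_n => x ord0 i).
Proof.
move=> _ Y mY; rewrite setTI; apply: sub_sigma_algebra => /=.
rewrite -bigcup_seq/=; exists i => /=; first by rewrite mem_index_enum.
by exists Y => //; rewrite setTI.
Qed.

Lemma measurable_fun_rV d d' (S : measurableType d) (T : measurableType d') n
    (f : S -> 'rV[T]_n) :
  (forall i, measurable_fun [set: S] (fun x => f x ord0 i)) ->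
  measurable_fun [set: S] f.
Proof.
move=> mf _ Y mY; rewrite setTI.
suff : <<s \big[setU/set0]_(i < n)
    preimage_set_system setT (fun x : 'rV[T]_n => x ord0 i) measurable >>
    `<=` [set B | measurable (f @^-1` B)] by move/(_ Y mY).
apply: smallest_sub.
  split => [|A mA|F mF] /=.
  - by rewrite preimage_set0.
  - by rewrite setTD preimage_setC; exact: measurableC.
  - by rewrite preimage_bigcup; apply: bigcup_measurable => k _; exact: mF.
move=> A; rewrite -bigcup_seq => -[i _ [B mB <-]] /=; rewrite setTI.
rewrite -comp_preimage -[X in measurable X]setTI.
exact: mf.
Qed.

Section lebesgue_step.
Context {R : realType} (n : nat).

Definition cons_rV (z : R * 'rV[R]_n) : 'rV[R]_n.+1 :=
  \row_i oapp (z.2 ord0) z.1 (unlift ord0 i).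

Definition uncons_rV (x : 'rV[R]_n.+1) : R * 'rV[R]_n :=
  (x ord0 ord0, \row_i x ord0 (lift ord0 i)).

Lemma cons_rVK : cancel cons_rV uncons_rV.
Proof.
move=> [x y]; rewrite /uncons_rV mxE unlift_none /=; congr pair.
by apply/rowP => i; rewrite !mxE liftK.
Qed.

Lemma measurable_cons_rV : measurable_fun [set: R * 'rV[R]_n] cons_rV.
Proof.
apply: measurable_fun_rV => i.
have [j ->|->] := unliftP ord0 i.
  have -> : (fun z => cons_rV z ord0 (lift ord0 j)) =
      (fun x : 'rV[R]_n => x ord0 j) \o snd.
    by apply/funext => z /=; rewrite mxE liftK.
  exact: (measurableT_comp (measurable_coord_rV j) measurable_snd).
have -> : (fun z => cons_rV z ord0 ord0) = fst.
  by apply/funext => z; rewrite mxE unlift_none.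
exact: measurable_fst.
Qed.

Lemma measurable_uncons_rV : measurable_fun [set: 'rV[R]_n.+1] uncons_rV.
Proof.
apply: measurable_fun_pair; first exact: measurable_coord_rV.
apply: measurable_fun_rV => i.
have -> : (fun x : 'rV[R]_n.+1 => (\row_j x ord0 (lift ord0 j)) ord0 i) =
    (fun x => x ord0 (lift ord0 i)) by apply/funext => x; rewrite mxE.
exact: measurable_coord_rV.
Qed.

Variable m : {sigma_finite_measure set 'rV[R]_n -> \bar R}.

Definition lebesgue_step : set 'rV[R]_n.+1 -> \bar R :=
  pushforward (lebesgue_measure \x m)%E cons_rV.

Let step_measure : {measure set 'rV[R]_n.+1 -> \bar R} :=
  measure_function_pushforward__canonical__measure_function_Measure
    (lebesgue_measure \x m)%E measurable_cons_rV.

HB.instance Definition _ := Measure.copy lebesgue_step step_measure.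

Let lebesgue_step_sigma_finite : sigma_finite setT lebesgue_step.
Proof.
have /sigma_finiteP[F [TF ndF Foo]] := sigma_finiteT (@lebesgue_measure R).
have /sigma_finiteP[G [TG ndG Goo]] := sigma_finiteT m.
exists (fun k => uncons_rV @^-1` (F k `*` G k)).
  rewrite -preimage_bigcup (_ : \bigcup_k _ = setT) ?preimage_setT//.
  apply/seteqP; split => // -[x y] _.
  have [i _ Fx] : (\bigcup_k F k) x by rewrite -TF.
  have [j _ Gy] : (\bigcup_k G k) y by rewrite -TG.
  exists (maxn i j) => //; split => /=.
    by move: Fx; exact/subsetPset/ndF/leq_maxl.
  by move: Gy; exact/subsetPset/ndG/leq_maxr.
move=> k; have [mFk Fk_oo] := Foo k; have [mGk Gk_oo] := Goo k; split.
  rewrite -[X in measurable X]setTI.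
  by apply: measurable_uncons_rV => //; exact: measurableX.
rewrite /lebesgue_step /pushforward -comp_preimage.
rewrite (_ : _ \o _ = id); last by apply/funext => z /=; rewrite cons_rVK.
by rewrite preimage_id product_measure1E// lte_mul_pinfty// ge0_fin_numE.
Qed.

HB.instance Definition _ :=
  Measure_isSigmaFinite.Build _ _ _ lebesgue_step lebesgue_step_sigma_finite.

End lebesgue_step.

Fixpoint lebesgue_rV {R : realType} (n : nat) :
    {sigma_finite_measure set 'rV[R]_n -> \bar R} :=
  match n with
  | 0 => \d_(0 : 'rV[R]_0)
  | n'.+1 => lebesgue_step (lebesgue_rV n')
  end.

Lemma measurable_box (R : realType) n (a b : 'rV[R]_n) :
  measurable [set x : 'rV[R]_n | forall i, a ord0 i <= x ord0 i <= b ord0 i].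
Proof.
rewrite (_ : [set _ | _] = \big[setI/setT]_(i < n)
    ((fun x : 'rV[R]_n => x ord0 i) @^-1` `[a ord0 i, b ord0 i])).
  apply: bigsetI_measurable => i _; rewrite -[X in measurable X]setTI.
  by apply: measurable_coord_rV => //; exact: measurable_itv.
apply/seteqP; split => x /=.
  by move=> h; rewrite -bigcap_seq => i _ /=; rewrite in_itv/=; exact: h.
rewrite -bigcap_seq => h i; have := h i; rewrite /= in_itv/=; apply.
exact: mem_index_enum.
Qed.

Lemma lebesgue_rV_box (R : realType) n (a b : 'rV[R]_n) :
  (forall i, a ord0 i <= b ord0 i) ->
  lebesgue_rV n [set x : 'rV[R]_n | forall i, a ord0 i <= x ord0 i <= b ord0 i] =
  (\prod_i (b ord0 i - a ord0 i))%:E.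
Proof.
elim: n a b => [|n IH] a b ab /=.
  by rewrite big_ord0 diracE mem_set // => -[].
rewrite /lebesgue_step /pushforward.
pose tl (x : 'rV[R]_n.+1) : 'rV[R]_n := \row_i x ord0 (lift ord0 i).
rewrite (_ : _ @^-1` _ = `[a ord0 ord0, b ord0 ord0] `*`
    [set x : 'rV[R]_n | forall i, tl a ord0 i <= x ord0 i <= tl b ord0 i]).
  rewrite product_measure1E//; last exact: measurable_box.
  transitivity ((b ord0 ord0 - a ord0 ord0)%:E *
      (\prod_i (tl b ord0 i - tl a ord0 i))%:E)%E.
    congr (_ * _)%E; last by apply: IH => i; rewrite !mxE.
    apply: (etrans (lebesgue_measure_itv `[a ord0 ord0, b ord0 ord0])).
    rewrite /= lte_fin lt_neqAle ab andbT.
    by case: eqVneq => [->|_]; rewrite ?subrr.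
  rewrite -EFinM big_ord_recl; congr (_ * _)%:E.
  by apply: eq_bigr => i _; rewrite !mxE.
apply/seteqP; split => -[x y] /=; rewrite in_itv/=.
  move=> h; split; first by have := h ord0; rewrite mxE unlift_none.
  by move=> i; have := h (lift ord0 i); rewrite !mxE liftK.
move=> [h1 h2] i; rewrite mxE.
have [j ->|->] := unliftP ord0 i; last exact: h1.
by have := h2 j; rewrite !mxE.
Qed.

Section sobolev.
Context {R : realType} {N : nat}.
Implicit Types (u phi : 'rV[R]_N -> R) (g : 'rV[R]_N -> 'rV[R]_N).

Definition dot (x y : 'rV[R]_N) : R := \sum_i x ord0 i * y ord0 i.

(* The library's norm `|x| on 'rV[R]_N is the sup norm; this is |x|_2. *)
Definition enorm (x : 'rV[R]_N) : R := Num.sqrt (dot x x).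

Definition partial (i : 'I_N) phi : 'rV[R]_N -> R :=
  'D_(delta_mx ord0 i) phi.

Definition grad phi (x : 'rV[R]_N) : 'rV[R]_N := \row_i partial i phi x.

Fixpoint Cn (n : nat) phi : Prop :=
  continuous phi /\
  if n is n'.+1 then
    forall i : 'I_N, (forall x, derivable phi x (delta_mx ord0 i)) /\
                     Cn n' (partial i phi)
  else True.

Definition test_function phi :=
  (forall n, Cn n phi) /\ compact (closure [set x | phi x != 0]).

Definition weak_gradient u g := forall (i : 'I_N) phi, test_function phi ->
  \int[lebesgue_rV N]_x (u x * partial i phi x) =
  - \int[lebesgue_rV N]_x (g x ord0 i * phi x).

(* u belongs to W^{1,p}(R^N) and g is (a representative of) its gradient. *)
Definition sobolev_with_gradient (p : R) u g :=
  [/\ u \in Lfun (lebesgue_rV N) p%:E,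
      forall i, (fun x => g x ord0 i) \in Lfun (lebesgue_rV N) p%:E &
      weak_gradient u g].

(* Where |g x| = 0 and p < 2, the factor |g x|^{p-2} is the junk value 0 of
   powR, so that |g|^{p-2} g = 0 there, as it should; likewise for u. *)
Definition weak_lhs (p mu m : R) u g phi (x : 'rV[R]_N) : R :=
  enorm (g x) `^ (p - 2) * dot (g x) (grad phi x)
  - mu / enorm x `^ p * (`|u x| `^ (p - 2) * u x * phi x)
  + m * (`|u x| `^ (p - 2) * u x * phi x).

Definition weak_ineq (ord : rel R) (p mu m : R) (f : R -> R) u :=
  exists2 g, sobolev_with_gradient p u g &
  forall phi, test_function phi -> (forall x, 0 <= phi x) ->
    [/\ (lebesgue_rV N).-integrable setT (EFin \o weak_lhs p mu m u g phi),
        (lebesgue_rV N).-integrable setT (EFin \o (fun x => f (u x) * phi x)) &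
        ord (\int[lebesgue_rV N]_x weak_lhs p mu m u g phi x)
            (\int[lebesgue_rV N]_x (f (u x) * phi x))].

Definition weak_subsolution := weak_ineq <=%R.
Definition weak_supersolution := weak_ineq >=%R.

Definition weak_solution (p mu m : R) (f : R -> R) u :=
  weak_subsolution p mu m f u /\ weak_supersolution p mu m f u.

(* u is radial, u(x) = U(|x|), and is the representative that is continuous
   off the origin; the value at the origin is immaterial. *)
Definition radial_profile u (U : R -> R) :=
  (forall x, x != 0 -> u x = U (enorm x)) /\
  (forall r, 0 < r -> {for r, continuous U}).

End sobolev.

Section coefficients.
Context {R : realType}.
Implicit Types (p m : R) (c : nat -> R).

Definition Ffun p (c0 t : R) : R := (p - 1) * (c0 + t) `^ (p / (p - 1)).

(* The sum of c_{j_1} ... c_{j_n} over j_1 + ... + j_n = i with all j_l > 0;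
   each j_l is then at most i. *)
Definition composition_sum c (n i : nat) : R :=
  \sum_(j : {ffun 'I_n -> 'I_i.+1} |
      (\sum_l j l == i)%N && [forall l, (0 < j l)%N]) \prod_l c (j l).

Definition is_coeffs (N : nat) p m (k : nat) c :=
  [/\ c 0%N = (m / (p - 1)) `^ ((p - 1) / p),
      c 1%N = (N%:R - 1) / p * (m / (p - 1)) `^ ((p - 2) / p) &
      forall i, (2 <= i <= k)%N ->
        (N%:R - i%:R) * c i.-1 - p * (m / (p - 1)) `^ p^-1 * c i =
        \sum_(2 <= n < i.+1)
          derive1n n (Ffun p (c 0%N)) 0 / n`!%:R * composition_sum c n i].

End coefficients.

(* The library registers no filter_on structure for +oo, which =O_ +oo needs. *)
Canonical pinfty_nbhs_filter_on (R : numFieldType) :=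
  FilterType (pinfty_nbhs R) _.

(* Main.v *)
Require Import Defs.
From mathcomp Require Import all_boot all_order all_algebra.
From mathcomp Require Import all_classical all_reals all_analysis.
From mathcomp Require Import measurable_realfun ring lra.
Import Order.TTheory GRing.Theory Num.Theory.
Import numFieldNormedType.Exports.
Local Open Scope classical_set_scope.
Local Open Scope ring_scope.
Set Implicit Arguments.
Unset Strict Implicit.
Unset Printing Implicit Defensive.

(** Why the expansion holds.

    _Reduction to one variable._ The radius is measured by the volume s = C |x|^N
    of the ball of radius |x|, where C is the volume of the unit ball. The map vol
    transports Lebesgue measure to Lebesgue measure on the half-line
    (lebesgue_vol), so integrals of radial functions become integrals in s.
    Write u = V(vol x). The field x / |x|^N is divergence free, and testing the
    weak gradient g against cut-offs of it shows that the increments of V are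
    fluxes of g through shells (flux_identity). Such fluxes are absolutely
    continuous with respect to volume, so V is the primitive of an integrable
    density e (flux_density), and g = e(vol x) grad vol almost everywhere
    (gradient_radial). Radial test functions turn the two weak inequalities into
    one integral identity in s (flux_balance); as the test functions approach
    the indicator of an interval, that identity computes the increments of the
    nonlinear flux (flux_increment). Hence this flux is C^1 up to a null set, and as
    |z|^(p-2) z can be inverted continuously, the profile is C^1
    (profile_regular). Back in the radius r, with U(r) = u,
      (r^(N-1) |U'|^(p-2) U')' = r^(N-1) ((m - mu / r^p) U^(p-1) - f(U)).

    _Behaviour at infinity._ Since u and g are in L^p, the derivative of V^p is
    integrable, and so is V^p; therefore U tends to 0 (energy_bound,
    radial_vanish). Then f(U) is small compared with U^(p-1), the flux on the
    left-hand side increases eventually, and U' < 0, because otherwise U would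
    increase (derivative_lt0). The quantity w = (-U'/U)^(p-1) satisfies
      w' = (p-1) w^(p/(p-1)) - (N-1) w / r - m + mu / r^p + f(U) / U^(p-1).
    The equilibrium c_0 of the limiting equation is repelling: a solution above
    it blows up in finite time and a solution below it becomes negative, which
    w cannot do, so w tends to c_0 (riccati_upper, riccati_lower). In particular
    U decays faster than every power of r, and f(U) / U^(p-1) is negligible
    (profile_decays_fast, rest_decays).

    _The expansion._ The truncated expansion S solves the same equation up to
    O(r^-(k+1)): expanding (p-1) S^(p/(p-1)) = F(S - c_0) by Taylor's formula
    (taylor_powR), the sums over compositions are the coefficients of the powers
    of c_1 x + ... + c_k x^k at x = 1/r (composition_sumE), and comparing
    coefficients gives exactly the recursion for the c_i (formal_residual). The
    difference z = w - S is bounded and solves z' = a z + O(r^-(k+1)) with a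
    bounded below by a positive constant. If |z| exceeded a large multiple of
    r^-(k+1) once, it would grow without bound (unstable_bound); hence z is
    O(r^-(k+1)). *)

(** * Integration lemmas *)

Section dominated.
Context d (T : measurableType d) (R : realType) (mu : {measure set T -> \bar R}).

Lemma dominated_cvg (f_ : nat -> T -> R) (f g : T -> R) :
  (forall k, measurable_fun setT (f_ k)) ->
  (forall x, f_ k x @[k --> \oo] --> f x) ->
  mu.-integrable setT (EFin \o g) -> (forall k x, `|f_ k x| <= g x) ->
  mu.-integrable setT (EFin \o f) /\
  ((\int[mu]_x (f_ k x)%:E) @[k --> \oo] --> \int[mu]_x (f x)%:E)%E.
Proof.
move=> mf cf ig fg.
have mlim : measurable_fun setT f.
  by apply: (measurable_fun_cvg mf) => x _; exact: cf.
have [] := @dominated_convergence _ _ _ mu setT measurableT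
  (fun k x => (f_ k x)%:E) (EFin \o f) (EFin \o g).
- by move=> k; apply/measurable_EFinP.
- exact/measurable_EFinP.
- by apply/aeW => x _; apply: cvg_EFin; [near=> k|exact: cf].
- by [].
- by apply/aeW => x k _; rewrite lee_fin.
- by [].
Unshelve. all: by end_near. Qed.

Lemma dominated_cvgR (f_ : nat -> T -> R) (f g : T -> R) :
  (forall k, measurable_fun setT (f_ k)) ->
  (forall x, f_ k x @[k --> \oo] --> f x) ->
  mu.-integrable setT (EFin \o g) -> (forall k x, `|f_ k x| <= g x) ->
  (\int[mu]_x f_ k x) @[k --> \oo] --> \int[mu]_x f x.
Proof.
move=> mf cf ig fg; have [fi lim] := dominated_cvg mf cf ig fg.
rewrite /Rintegral; apply: fine_cvg; rewrite fineK//.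
exact: integrable_fin_num.
Qed.

Lemma integrable_mul_bounded (f g : T -> R) (M : R) :
  mu.-integrable setT (EFin \o f) -> measurable_fun setT g -> (forall x, `|g x| <= M) ->
  mu.-integrable setT (EFin \o (fun x => f x * g x)).
Proof.
move=> fi mg gM.
have mf : measurable_fun setT f by apply/measurable_EFinP; exact: (measurable_int mu fi).
apply: (@le_integrable _ _ _ mu setT measurableT _ (fun x => M%:E * (EFin \o (Num.norm \o f)) x)%E).
- by apply/measurable_EFinP; exact: measurable_funM.
- move=> x _ /=; rewrite lee_fin normrM mulrC [leRHS]ger0_norm.
    by rewrite ler_wpM2r.
  by rewrite mulr_ge0// (le_trans _ (gM x)).
- by apply: integrableZl => //; exact: integrable_norm.
Qed.

Lemma Rintegral_sum n (f : 'I_n -> T -> R) :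
  (forall i, mu.-integrable setT (EFin \o f i)) ->
  mu.-integrable setT (EFin \o (fun x => \sum_i f i x)) /\
  \int[mu]_x (\sum_i f i x) = \sum_i \int[mu]_x f i x.
Proof.
move=> fi; elim: (index_enum _) => [|i r [IH1 IH2]].
  rewrite big_nil; split; last by under eq_Rintegral do rewrite big_nil; rewrite /Rintegral integral0.
  apply: eq_integrable (integrable0 _ _) => // x _ /=; by rewrite big_nil.
split.
  apply: eq_integrable (integrableD measurableT (fi i) IH1) => // x _ /=.
  by rewrite big_cons EFinD.
by rewrite big_cons -IH2 -RintegralD//; apply: eq_Rintegral => x _; rewrite big_cons.
Qed.

End dominated.

(** * Lebesgue measure and boxes *)

Section boxes.
Context {R : realType} (N : nat).
Implicit Types a b : 'rV[R]_N.

Definition box a b := [set x : 'rV[R]_N | forall i, a ord0 i <= x ord0 i <= b ord0 i].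

Lemma box_setI_closed : setI_closed [set box a b | a in setT & b in setT].
Proof.
move=> _ _ [a _ [b _ <-]] [a' _ [b' _ <-]].
exists (\row_i Num.max (a ord0 i) (a' ord0 i)) => //.
exists (\row_i Num.min (b ord0 i) (b' ord0 i)) => //.
apply/seteqP; split => x /=.
  move=> h; split => i; have := h i; rewrite !mxE ge_max le_min.
    by case/andP => /andP[-> _] /andP[-> _].
  by case/andP => /andP[_ ->] /andP[_ ->].
by case=> h h' i; rewrite !mxE ge_max le_min; case/andP: (h i) => -> ->; case/andP: (h' i) => -> ->.
Qed.

Let cube (k : nat) := box (const_mx (- k%:R)) (const_mx k%:R).

Lemma ex_bound_coord (x : 'rV[R]_N) : exists k : nat, forall i, `|x ord0 i| <= k%:R.
Proof.
exists (Num.truncn (\sum_i `|x ord0 i|)).+1 => i.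
apply/ltW; apply: (le_lt_trans _ (truncnS_gt _)).
by rewrite (bigD1 i)//= lerDl sumr_ge0.
Qed.

Lemma cube_cover : \bigcup_k cube k = setT.
Proof.
apply/seteqP; split => // x _; have [k hk] := ex_bound_coord x.
by exists k => // i; rewrite !mxE -ler_norml hk.
Qed.

(** A half-space x_i >= c is the union of a sequence of growing boxes. *)
Lemma measurable_rV_box :
  (measurable : set (set 'rV[R]_N)) = <<s [set box a b | a in setT & b in setT] >>.
Proof.
apply/seteqP; split; last first.
  apply: smallest_sub; first exact: sigma_algebra_measurable.
  by move=> _ [a _ [b _ <-]]; exact: measurable_box.
set S := <<s _ >>; apply: smallest_sub; first exact: smallest_sigma_algebra.
move=> A; rewrite -bigcup_seq => -[i _ [Y mY <-]] /=; rewrite setTI.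
have [S0 SC SU] : sigma_algebra setT S by exact: smallest_sigma_algebra.
pose co : 'rV[R]_N -> R := fun x => x ord0 i.
suff : <<s @RGenCInfty.G R >> `<=` [set B | S (co @^-1` B)].
  by apply; move: mY; rewrite -[X in X -> _]/((@ocitv R).-sigma.-measurable Y)
    RGenCInfty.measurableE.
apply: smallest_sub.
  split => [|B SB|F SF] /=.
  - by rewrite preimage_set0.
  - by rewrite setTD preimage_setC -setTD; exact: SC.
  - by rewrite preimage_bigcup; exact: SU.
move=> _ [c ->] /=.
have -> : co @^-1` `[c, +oo[ = \bigcup_k box (\row_j if j == i then c else - k%:R) (const_mx k%:R).
  apply/seteqP; split => x /=; rewrite in_itv/= andbT.
    have [k hk] := ex_bound_coord x.
    move=> cx; exists k => // j; rewrite !mxE; have := hk j; rewrite ler_norml => /andP[h1 h2].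
    by rewrite h2 andbT; case: eqVneq => // ->.
  by case=> k _ /(_ i); rewrite !mxE eqxx => /andP[].
by apply: SU => k; apply: sub_sigma_algebra; do 2 eexists => //.
Qed.

(** Boxes are stable under intersection, generate the sigma-algebra and
    exhaust the space by cubes of finite measure. *)
Lemma measure_rV_unique (m1 m2 : {measure set 'rV[R]_N -> \bar R}) :
  (forall a b, (forall i, a ord0 i <= b ord0 i) -> m1 (box a b) = m2 (box a b)) ->
  (forall a b, (m1 (box a b) < +oo)%E) ->
  forall A, measurable A -> m1 A = m2 A.
Proof.
move=> m12 m1oo; apply: (measure_unique [set box a b | a in setT & b in setT] cube).
- exact: measurable_rV_box.
- exact: box_setI_closed.
- by move=> k; do 2 eexists => //.
- exact: cube_cover.
- move=> _ [a _ [b _ <-]].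
  have [h|/existsNP[i /negP]] := pselect (forall i, a ord0 i <= b ord0 i); first exact: m12.
  rewrite -ltNge => ba; suff -> : box a b = set0 by rewrite !measure0.
  rewrite -subset0 => x /(_ i) /andP[h1 h2].
  by have := lt_le_trans ba (le_trans h1 h2); rewrite ltxx.
- by move=> k; exact: m1oo.
Qed.

Lemma lebesgue_box_fin a b : (lebesgue_rV N (box a b) < +oo)%E.
Proof.
have [h|/existsNP[i /negP]] := pselect (forall i, a ord0 i <= b ord0 i).
  by rewrite lebesgue_rV_box// ltry.
rewrite -ltNge => ba; suff -> : box a b = set0 by rewrite measure0.
rewrite -subset0 => x /(_ i) /andP[h1 h2].
by have := lt_le_trans ba (le_trans h1 h2); rewrite ltxx.
Qed.

Lemma measurable_scale (s : R) : measurable_fun setT (fun x : 'rV[R]_N => s *: x).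
Proof.
apply: measurable_fun_rV => i.
have -> : (fun x : 'rV[R]_N => (s *: x) ord0 i) = (fun x => s * x ord0 i).
  by apply/funext => x; rewrite mxE.
by apply: measurable_funM => //; exact: measurable_coord_rV.
Qed.

(** Both sides are measures in A, and they agree on boxes. *)
Lemma lebesgue_scale (s : R) (A : set 'rV[R]_N) : 0 < s -> measurable A ->
  lebesgue_rV N A = ((s ^+ N)%:E * lebesgue_rV N ((fun x => s *: x) @^-1` A))%E.
Proof.
move=> s0 mA.
have sN0 : 0 <= s ^+ N by rewrite exprn_ge0// ltW.
pose m2 := mscale (NngNum sN0) (pushforward (lebesgue_rV N) (fun x : 'rV[R]_N => s *: x)).
have mpf := measurable_scale s.
pose pf : {measure set 'rV[R]_N -> \bar R} :=
  measure_function_pushforward__canonical__measure_function_Measure (lebesgue_rV N) mpf.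
pose m3 : {measure set 'rV[R]_N -> \bar R} := mscale (NngNum sN0) pf.
change (lebesgue_rV N A = m3 A).
apply: measure_rV_unique => //; last exact: lebesgue_box_fin.
move=> a b ab; transitivity ((\prod_i (b ord0 i - a ord0 i))%:E); first exact: lebesgue_rV_box.
have E : (fun x : 'rV[R]_N => s *: x) @^-1` box a b = box (s^-1 *: a) (s^-1 *: b).
  apply/seteqP; split => x /= h i; have := h i; rewrite !mxE ![s^-1 * _]mulrC;
  by rewrite ler_pdivrMr// ler_pdivlMr// [_ * s]mulrC.
transitivity ((s ^+ N)%:E * lebesgue_rV N (box (s^-1 *: a) (s^-1 *: b)))%E; last by rewrite -E.
have -> : lebesgue_rV N (box (s^-1 *: a) (s^-1 *: b)) = (\prod_i (s^-1 * (b ord0 i - a ord0 i)))%:E.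
  rewrite lebesgue_rV_box => [|i]; last by rewrite !mxE ler_pM2l ?invr_gt0.
  by congr EFin; apply: eq_bigr => i _; rewrite !mxE mulrBr.
rewrite -EFinM; congr EFin.
by rewrite big_split/= prodr_const card_ord mulrA exprVn divff ?mul1r// expf_neq0// gt_eqF.
Qed.

End boxes.

(** * The volume function *)

Section volume.
Context {R : realType}.

Lemma dot_ge0 N (x : 'rV[R]_N) : 0 <= dot x x.
Proof. by rewrite /dot sumr_ge0// => i _; rewrite -expr2 sqr_ge0. Qed.

Lemma enorm_ge0 N (x : 'rV[R]_N) : 0 <= enorm x.
Proof. exact: sqrtr_ge0. Qed.

Lemma enorm_sqr N (x : 'rV[R]_N) : enorm x ^+ 2 = dot x x.
Proof. by rewrite sqr_sqrtr// dot_ge0. Qed.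

Lemma coord_le_enorm N (x : 'rV[R]_N) i : `|x ord0 i| <= enorm x.
Proof.
rewrite -(@ler_pXn2r _ 2)// ?nnegrE ?enorm_ge0// enorm_sqr real_normK ?num_real//.
by rewrite /dot (bigD1 i)//= -expr2 lerDl sumr_ge0// => j _; rewrite -expr2 sqr_ge0.
Qed.

Lemma enorm0_eq0 N (x : 'rV[R]_N) : enorm x = 0 -> x = 0.
Proof.
move=> x0; apply/rowP => i; rewrite mxE; apply/eqP.
by rewrite -normr_eq0 eq_le normr_ge0 andbT -x0 coord_le_enorm.
Qed.

Lemma enorm_0 N : enorm (0 : 'rV[R]_N) = 0.
Proof. by rewrite /enorm /dot big1 ?sqrtr0// => i _; rewrite mxE mul0r. Qed.

Lemma enorm_gt0 N (x : 'rV[R]_N) : x != 0 -> 0 < enorm x.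
Proof.
move=> x0; rewrite lt_neqAle enorm_ge0 andbT eq_sym.
by apply: contraNneq x0 => /enorm0_eq0 ->.
Qed.

Lemma enormZ N (s : R) (x : 'rV[R]_N) : 0 <= s -> enorm (s *: x) = s * enorm x.
Proof.
move=> s0; apply/eqP; rewrite -(@eqrXn2 _ 2)// ?mulr_ge0 ?enorm_ge0//.
rewrite exprMn !enorm_sqr /dot mulr_sumr; apply/eqP/eq_bigr => i _.
by rewrite !mxE; ring.
Qed.

Lemma measurable_enorm N : measurable_fun setT (@enorm R N).
Proof.
apply: (measurableT_comp (@continuous_measurable_fun R _ _)).
  exact: sqrt_continuous.
rewrite /dot; apply: measurable_sum => i.
by apply: measurable_funM; exact: measurable_coord_rV.
Qed.

(** No closed form is needed: the constant cancels when the volume of a ball,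
    rather than its radius, is taken as the radial variable. *)
Definition ball_volume N : R := fine (lebesgue_rV N [set x : 'rV[R]_N | enorm x < 1]).

Lemma measurable_enorm_ball N (r : R) : measurable [set x : 'rV[R]_N | enorm x < r].
Proof.
have -> : [set x : 'rV[R]_N | enorm x < r] = setT `&` (@enorm R N) @^-1` `]-oo, r[.
  by rewrite setTI; apply/seteqP; split => x /=; rewrite in_itv.
exact: measurable_enorm.
Qed.

Lemma ball_volumeE N : lebesgue_rV N [set x : 'rV[R]_N | enorm x < 1] = (ball_volume N)%:E.
Proof.
rewrite fineK// ge0_fin_numE//.
apply: (le_lt_trans _ (@lebesgue_box_fin R N (const_mx (-1)) (const_mx 1))).
apply: le_measure; rewrite ?inE; [exact: measurable_enorm_ball|exact: measurable_box|].
move=> x /= x1 i; rewrite !mxE -ler_norml.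
by rewrite (le_trans (coord_le_enorm x i))// ltW.
Qed.

Lemma ball_volume_gt0 N : (0 < N)%N -> 0 < ball_volume N.
Proof.
move=> N0; rewrite -lte_fin -ball_volumeE.
pose e : R := N.+1%:R^-1.
have e0 : 0 < e by rewrite invr_gt0.
have e1 : N%:R * e < 1 by rewrite ltr_pdivrMr// mul1r ltr_nat.
apply: (@lt_le_trans _ _ (lebesgue_rV N (box (const_mx (- e)) (const_mx e : 'rV[R]_N)))).
  rewrite [ltRHS]lebesgue_rV_box; last first.
    by move=> i; rewrite !mxE ge0_cp// ltW.
  by rewrite lte_fin prodr_gt0// => i _; rewrite !mxE opprK addr_gt0.
apply: le_measure; rewrite ?inE; [exact: measurable_box|exact: measurable_enorm_ball|].
move=> x /= xe; rewrite -(@ltr_pXn2r _ 2)// ?nnegrE ?enorm_ge0// enorm_sqr expr1n.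
apply: (@le_lt_trans _ _ (\sum_(i < N) e ^+ 2)).
  apply: ler_sum => i _; rewrite -expr2 -[leLHS]real_normK ?num_real//.
  rewrite ler_pXn2r ?nnegrE ?(ltW e0)// ler_norml.
  by have := xe i; rewrite !mxE.
rewrite sumr_const card_ord -mulr_natl expr2 mulrA.
apply: (le_lt_trans _ e1); rewrite ler_piMr//.
  by rewrite mulr_ge0// ltW.
by rewrite /e invf_le1// ler1n.
Qed.

Definition vol N (x : 'rV[R]_N) : R := ball_volume N * enorm x ^+ N.

Lemma measurable_vol N : measurable_fun setT (@vol N).
Proof. by apply: measurable_funM => //; apply: measurable_funX; exact: measurable_enorm. Qed.

Lemma vol_ge0 N (x : 'rV[R]_N) : (0 < N)%N -> 0 <= vol x.
Proof. by move=> N0; rewrite mulr_ge0 ?exprn_ge0 ?enorm_ge0 ?(ltW (ball_volume_gt0 N0)). Qed.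

(** Balls are dilates of the unit ball. *)
Lemma lebesgue_vol_lt N (s : R) : (0 < N)%N ->
  lebesgue_rV N [set x : 'rV[R]_N | vol x < s] = (Num.max s 0)%:E.
Proof.
move=> N0; have C0 := ball_volume_gt0 N0.
have [s0|s0] := leP s 0.
  rewrite (_ : [set _ | _] = set0) ?measure0// -subset0 => x /= /lt_le_trans /(_ s0).
  by rewrite ltNge vol_ge0.
pose r := (s / ball_volume N) `^ N%:R^-1.
have r0 : 0 < r by rewrite powR_gt0// divr_gt0.
have rN : r ^+ N = s / ball_volume N.
  rewrite -powR_mulrn ?(ltW r0)// /r -powRrM mulVf ?powRr1 ?ltW ?divr_gt0//.
  by rewrite pnatr_eq0 -lt0n.
rewrite (lebesgue_scale r0); last first.
  have -> : [set x : 'rV[R]_N | vol x < s] = setT `&` (@vol N) @^-1` `]-oo, s[.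
    by rewrite setTI; apply/seteqP; split => x /=; rewrite in_itv.
  by apply: measurable_vol => //; exact: measurable_itv.
rewrite (_ : _ @^-1` _ = [set x : 'rV[R]_N | enorm x < 1]); last first.
  apply/seteqP; split => x /=; rewrite /vol enormZ ?(ltW r0)// exprMn rN mulrA.
    rewrite [X in X * _]mulrC divfK ?gt_eqF// gtr_pMr// => h.
    by rewrite -(@ltr_pXn2r _ N)// ?nnegrE ?enorm_ge0// expr1n.
  move=> h; rewrite [X in X * _]mulrC divfK ?gt_eqF// gtr_pMr//.
  by rewrite exprn_ilt1 ?enorm_ge0// -lt0n.
by rewrite ball_volumeE -EFinM rN divfK// gt_eqF.
Qed.

(** The function vol transports Lebesgue measure on the space to Lebesgue
    measure on the half-line; this replaces polar coordinates throughout. *)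
Lemma lebesgue_vol N (A : set R) : (0 < N)%N -> measurable A ->
  lebesgue_rV N (@vol N @^-1` A) = lebesgue_measure (A `&` `[0, +oo[).
Proof.
move=> N0 mA.
have mv : measurable_fun setT (@vol N : 'rV[R]_N -> measurableTypeR R) := @measurable_vol N.
pose m1 : {measure set (measurableTypeR R) -> \bar R} :=
  measure_function_pushforward__canonical__measure_function_Measure (lebesgue_rV N) mv.
pose lm : {measure set (measurableTypeR R) -> \bar R} := lebesgue_measure.
pose m2 : {measure set (measurableTypeR R) -> \bar R} := mrestr lm (@measurable_itv R `[0, +oo[).
have m1E (s : R) : m1 (`]-oo, s[%classic : set R) = (Num.max s 0)%:E.
  have E : @vol N @^-1` `]-oo, s[ = [set x : 'rV[R]_N | vol x < s].
    by apply/seteqP; split => x /=; rewrite in_itv.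
  by move: (@lebesgue_vol_lt N s N0); rewrite -E.
change (m1 A = m2 A).
refine (@measure_unique _ R (measurableTypeR R) (@RGenInftyO.G R) (fun k => `]-oo, (k%:R : R)[%classic) _ _ _ _ m1 m2 _ _ A mA).
- exact: RGenInftyO.measurableE.
- move=> _ _ [x ->] [y ->]; exists (Num.min x y); apply/seteqP; split => z /=;
  by rewrite !in_itv/= lt_min => /andP.
- by move=> i; exists i%:R.
- apply/seteqP; split => // x _; exists (Num.truncn `|x|).+1 => //=; rewrite in_itv/=.
  by rewrite (le_lt_trans (ler_norm x))// truncnS_gt.
- move=> _ [s ->]; transitivity (Num.max s 0)%:E; first exact: m1E.
  rewrite /m2/= /mrestr (_ : _ `&` _ = `[0, s[%classic); last first.
    by apply/seteqP; split => x /=; rewrite !in_itv/= andbT andbC// => /andP[->].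
  rewrite [RHS]lebesgue_measure_itv/= lte_fin; case: leP => // s0.
  by rewrite oppr0 adde0.
- move=> k; suff -> : m1 `]-oo, k%:R[%classic = k%:R%:E by rewrite ltry.
  by transitivity (Num.max k%:R 0 : R)%:E; [exact: m1E|rewrite max_l].
Qed.
End volume.

(** * Integrals of functions of the volume, and slices *)

Section integral_vol.
Context {R : realType} (N : nat) (N0 : (0 < N)%N).
Notation lam := (lebesgue_rV (R := R) N).
Notation leb := (@lebesgue_measure R).

Lemma ge0_integral_vol (D : set R) (F : R -> \bar R) : measurable D ->
  D `<=` `[0, +oo[ -> measurable_fun D F -> (forall s, D s -> (0 <= F s)%E) ->
  (\int[lam]_(x in @vol R N @^-1` D) F (vol x) = \int[leb]_(s in D) F s)%E.
Proof.
move=> mD D0 mF F0.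
have mv : measurable_fun setT (@vol R N : 'rV[R]_N -> measurableTypeR R) := @measurable_vol R N.
pose m1 : {measure set (measurableTypeR R) -> \bar R} :=
  measure_function_pushforward__canonical__measure_function_Measure lam mv.
transitivity (\int[m1]_(s in D) F s)%E.
  by rewrite (@ge0_integral_pushforward _ _ _ _ R _ mv lam D F)// => y; rewrite inE; exact: F0.
apply: (@eq_measure_integral _ (measurableTypeR R)) => A mA AD.
have := @lebesgue_vol R N A N0 mA; rewrite setIidl//.
exact: subset_trans AD D0.
Qed.

Lemma integral_vol (D : set R) (F : R -> \bar R) : measurable D ->
  D `<=` `[0, +oo[ -> measurable_fun D F ->
  (\int[lam]_(x in @vol R N @^-1` D) F (vol x) = \int[leb]_(s in D) F s)%E.
Proof.
move=> mD D0 mF; rewrite integralE [RHS]integralE; congr (_ - _)%E.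
  rewrite -(@ge0_integral_vol D (F^\+)%E mD D0).
  - by apply: eq_integral => x _; rewrite !unlock.
  - exact: measurable_funepos.
  - by move=> s _; exact: funepos_ge0.
rewrite -(@ge0_integral_vol D (F^\-)%E mD D0).
- by apply: eq_integral => x _; rewrite !unlock.
- exact: measurable_funeneg.
- by move=> s _; exact: funeneg_ge0.
Qed.

Lemma measurable_preimage_vol (D : set R) : measurable D -> measurable (@vol R N @^-1` D).
Proof. by move=> mD; rewrite -[X in measurable X]setTI; exact: measurable_vol. Qed.

Lemma integrable_vol (D : set R) (F : R -> \bar R) : measurable D ->
  D `<=` `[0, +oo[ -> leb.-integrable D F ->
  lam.-integrable (@vol R N @^-1` D) (fun x => F (vol x)).
Proof.
move=> mD D0 iF0; have /integrableP[mF iF] := iF0; apply/integrableP; split.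
  apply: (@measurable_comp _ _ _ _ _ _ D F _ (@vol R N)) => //.
    by move=> _ [x /= Dx <-].
  by apply: measurable_funTS; exact: measurable_vol.
rewrite (_ : (fun x : 'rV[R]_N => _) = (fun x : 'rV[R]_N => (abse \o F) (vol x)))//.
rewrite ge0_integral_vol//; last by move=> s _; exact: abse_ge0.
exact: (measurable_int _ (integrable_abse iF0)).
Qed.

Lemma vol_null (Z : set R) : measurable Z -> leb Z = 0 -> lam (@vol R N @^-1` Z) = 0.
Proof.
move=> mZ Z0; rewrite lebesgue_vol//; apply/eqP; rewrite eq_le measure_ge0 andbT -Z0.
by rewrite le_measure ?inE//; apply: measurableI.
Qed.

End integral_vol.

Lemma bounded_support_integrable d (X : measurableType d) (R : realType)
    (mu : {measure set X -> \bar R}) (f : X -> R) (S : set X) (M : R) :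
  measurable S -> (mu S < +oo)%E -> measurable_fun setT f ->
  (forall x, S x -> `|f x| <= M) -> (forall x, ~ S x -> f x = 0) ->
  mu.-integrable setT (EFin \o f).
Proof.
move=> mS Soo mf fM f0.
have -> : EFin \o f = (EFin \o f) \_ S.
  apply/funext => x; rewrite patchE /=; case: ifPn => // xS.
  by rewrite f0// => Sx; rewrite mem_set in xS.
apply: (integrable_mkcond (EFin \o f) mS).1; apply: measurable_bounded_integrable => //.
  exact: measurable_funTS.
exists M; split; first exact: num_real.
by move=> x Mx y Sy; rewrite /= (le_trans (fM y Sy))// ltW.
Qed.

Lemma integral_pushforwardE d1 d2 (X : measurableType d1) (Y : measurableType d2)
    (R : realType) (phi : X -> Y) (mu : {measure set X -> \bar R})
    (m2 : {measure set Y -> \bar R}) (f : Y -> \bar R) :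
  measurable_fun setT phi -> m2 = pushforward mu phi :> (set Y -> \bar R) ->
  m2.-integrable setT f ->
  mu.-integrable setT (f \o phi) /\
  (\int[m2]_y f y = \int[mu]_x f (phi x))%E.
Proof.
move=> mphi m2E if2.
pose pf : {measure set Y -> \bar R} :=
  measure_function_pushforward__canonical__measure_function_Measure mu mphi.
have E (h : Y -> \bar R) : (\int[m2]_y h y = \int[pf]_y h y)%E.
  by apply: eq_measure_integral => A mA _; rewrite m2E.
have mf := measurable_int _ if2.
have iphi : mu.-integrable setT (f \o phi).
  apply/integrableP; split; first exact: measurableT_comp.
  have /integrableP[_] := if2; rewrite E.
  rewrite (@ge0_integral_pushforward _ _ _ _ R phi mphi mu setT (fun x => `|f x|)%E)//.
  exact: measurableT_comp.
by split => //; rewrite E (@integral_pushforward _ _ _ _ R phi mphi mu setT f).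
Qed.

Section slices.
Context {R : realType}.
Notation leb := (@lebesgue_measure R).

Definition set_coord N (i : 'I_N) (x : 'rV[R]_N) (t : R) : 'rV[R]_N :=
  \row_j if j == i then t else x ord0 j.

Definition box_bounded N (D : 'rV[R]_N -> R) (B M : R) :=
  [/\ measurable_fun setT D, forall x, `|D x| <= M &
      forall x, ~ box (const_mx (- B)) (const_mx B) x -> D x = 0].

Lemma box_bounded_integrable N (D : 'rV[R]_N -> R) B M : box_bounded D B M ->
  (lebesgue_rV N).-integrable setT (EFin \o D).
Proof.
move=> [mD DM DB]; apply: (bounded_support_integrable _ _ mD) DB.
- exact: measurable_box.
- exact: lebesgue_box_fin.
- by move=> x _; exact: DM.
Qed.

Lemma box_bounded_cons N (D : 'rV[R]_N.+1 -> R) B M t : 0 <= M -> box_bounded D B M ->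
  box_bounded (fun y => D (cons_rV (t, y))) B M.
Proof.
move=> M0 [mD DM DB]; split => //.
  apply: (measurableT_comp mD).
  apply: (measurableT_comp (@measurable_cons_rV R N)).
  exact: measurable_pair1.
move=> y yB; apply: DB; apply: contra_not yB => h i.
by have := h (lift ord0 i); rewrite !mxE liftK.
Qed.

(** Fubini's theorem, by induction on the dimension: the first coordinate is
    either the slicing variable or a parameter of a lower-dimensional instance. *)
Lemma integral_slices0 N (i : 'I_N) (D : 'rV[R]_N -> R) B M : 0 <= M ->
  box_bounded D B M ->
  (forall x, \int[leb]_t (D (set_coord i x t))%:E = 0)%E ->
  (\int[lebesgue_rV N]_x (D x)%:E = 0)%E.
Proof.
elim: N i D => [[]//|N IH] i D M0 bD D0.
have iD := box_bounded_integrable bD.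
have mc : measurable_fun setT (@cons_rV R N : measurableTypeR R * 'rV[R]_N -> _) :=
  @measurable_cons_rV R N.
have [iDc ->] := integral_pushforwardE (mu := (leb \x lebesgue_rV N)%E) mc erefl iD.
have [j ij|i0] := unliftP ord0 i.
  rewrite -integral12_prod_meas1// /fubini_F/=.
  rewrite integral0_eq// => t _.
  apply: (IH j) => //; first exact: box_bounded_cons.
  move=> y; rewrite -[RHS](D0 (cons_rV (t, y))); apply: eq_integral => s _.
  congr (D _)%:E; apply/rowP => l; rewrite !mxE ij.
  have [m ->|->] := unliftP ord0 l; last by rewrite -val_eqE.
  by rewrite /= (inj_eq (@lift_inj _ _)) !mxE.
rewrite -integral21_prod_meas1// /fubini_G/=.
rewrite integral0_eq// => y _.
rewrite -[RHS](D0 (cons_rV (0, y))); apply: eq_integral => s _.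
congr (D _)%:E; apply/rowP => l; rewrite !mxE i0.
have [m ->|->] := unliftP ord0 l; last by rewrite eqxx.
by [].
Qed.

End slices.

(** * Smooth functions of one variable *)

Section smooth1.
Context {R : realType}.
Implicit Types f g : R -> R.

(** The one-variable counterpart of Cn. *)
Fixpoint C1n (n : nat) f : Prop :=
  continuous f /\
  if n is n'.+1 then (forall x, derivable f x 1) /\ C1n n' (derive1 f) else True.

Definition smooth1 f := forall n, C1n n f.

Lemma is_derive1_eq f (x d : R) : is_derive x 1 f d -> derivable f x 1 /\ derive1 f x = d.
Proof. by case=> df dE; split => //; rewrite derive1E. Qed.

Lemma C1nS_is_derive n f f' : (forall x : R, is_derive x 1 f (f' x)) -> C1n n f' -> C1n n.+1 f.
Proof.
move=> df Cf'; have dfE x := is_derive1_eq (df x).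
split; last by split => [x|]; [exact: (dfE x).1|rewrite (_ : derive1 f = f')//; apply/funext => x; exact: (dfE x).2].
by move=> x; apply/differentiable_continuous/derivable1_diffP; exact: (dfE x).1.
Qed.

Lemma C1n_continuous n f : C1n n f -> continuous f.
Proof. by case: n => [|n] []. Qed.

Lemma C1n_is_derive n f (x : R) : C1n n.+1 f -> is_derive x 1 f (derive1 f x).
Proof. by move=> [_ [df _]]; rewrite derive1E; exact: derivableP. Qed.

Lemma C1nW n f : C1n n.+1 f -> C1n n f.
Proof.
elim: n f => [|n IH] f [cf [df Cf]]; first by split.
by split => //; split => //; exact: IH.
Qed.

Lemma C1n_cst n (c : R) : C1n n (cst c).
Proof.
elim: n c => [|n IH] c; first by split => //; exact: cst_continuous.
by apply: (@C1nS_is_derive _ _ (cst 0)).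
Qed.

Lemma C1n_id n : C1n n id.
Proof.
case: n => [|n]; first by split => // x; exact: cvg_id.
by apply: (@C1nS_is_derive _ _ (cst 1)); exact: C1n_cst.
Qed.

Lemma C1nD n f g : C1n n f -> C1n n g -> C1n n (f \+ g).
Proof.
elim: n f g => [|n IH] f g Cf Cg.
  by split => // x; apply: cvgD; [exact: (C1n_continuous Cf)|exact: (C1n_continuous Cg)].
apply: (@C1nS_is_derive _ _ (derive1 f \+ derive1 g)).
  by move=> x; apply: is_deriveD; [exact: (C1n_is_derive x Cf)|exact: (C1n_is_derive x Cg)].
by apply: IH; [case: Cf => _ []|case: Cg => _ []].
Qed.

Lemma C1nM n f g : C1n n f -> C1n n g -> C1n n (f \* g).
Proof.
elim: n f g => [|n IH] f g Cf Cg.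
  by split => // x; apply: cvgM; [exact: (C1n_continuous Cf)|exact: (C1n_continuous Cg)].
have [_ [df Cf']] := Cf; have [_ [dg Cg']] := Cg.
apply: (@C1nS_is_derive _ _ ((f \* derive1 g) \+ (g \* derive1 f))).
  by move=> x; apply: is_deriveM; [exact: (C1n_is_derive x Cf)|exact: (C1n_is_derive x Cg)].
by apply: C1nD; apply: IH => //; exact: C1nW.
Qed.

Lemma C1nN n f : C1n n f -> C1n n (fun x => - f x).
Proof.
move=> Cf; rewrite (_ : (fun x => - f x) = cst (- 1) \* f).
  by apply: C1nM => //; exact: C1n_cst.
by apply/funext => x /=; rewrite mulN1r.
Qed.

Lemma C1nX n k f : C1n n f -> C1n n (fun x => f x ^+ k).
Proof.
move=> Cf; elim: k => [|k IH]; first exact: C1n_cst.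
rewrite (_ : (fun x => _) = f \* (fun x => f x ^+ k)); first exact: C1nM.
by apply/funext => x; rewrite exprS.
Qed.

Lemma C1n_comp n f g : C1n n f -> C1n n g -> C1n n (f \o g).
Proof.
elim: n f g => [|n IH] f g Cf Cg.
  by split => // x; apply: continuous_comp; [exact: (C1n_continuous Cg)|exact: (C1n_continuous Cf)].
have [_ [df Cf']] := Cf; have [_ [dg Cg']] := Cg.
apply: (@C1nS_is_derive _ _ ((derive1 f \o g) \* derive1 g)).
  by move=> x; apply: is_derive1_comp; [exact: (C1n_is_derive _ Cf)|exact: (C1n_is_derive x Cg)].
by apply: C1nM => //; apply: IH => //; exact: C1nW.
Qed.

Lemma C1nV n f : (forall x, f x != 0) -> C1n n f -> C1n n (fun x => (f x)^-1).
Proof.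
move=> f0; elim: n => [|n IH] Cf.
  by split => // x; apply: cvgV => //; exact: (C1n_continuous Cf).
have [_ [df Cf']] := Cf; have CV := IH (C1nW Cf).
apply: (@C1nS_is_derive _ _ (fun x => - ((f x)^-1 * (f x)^-1) * derive1 f x)).
  move=> x; apply: is_derive_eq; first exact: (is_deriveV (f0 x) (C1n_is_derive x Cf)).
  by rewrite /GRing.scale/= -exprVn expr2.
apply: (C1nM (C1nN (C1nM CV CV)) Cf').
Qed.

Lemma near_norm_lt (x a : R) : `|x| < a -> \forall y \near x, `|y| < a.
Proof.
have cx : (fun y : R => `|y|) @ x --> `|x| by exact: (@norm_continuous _ R^o).
by move=> xa; exact: cvgr_lt cx _ xa.
Qed.

Lemma derive1_vanish f (a x : R) : (forall y, `|y| < a -> f y = 0) -> `|x| < a -> derive1 f x = 0.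
Proof.
move=> f0 xa; apply: (proj2 (is_derive1_eq (d := 0) _)).
apply: (near_eq_is_derive (f := cst 0)).
by apply: filterS (near_norm_lt xa) => y ya; rewrite f0.
Qed.

(** Dividing by the variable is harmless for functions vanishing near 0. *)
Lemma C1n_div_id n f (a : R) : 0 < a -> (forall x, `|x| < a -> f x = 0) -> C1n n f ->
  C1n n (fun x => f x / x).
Proof.
move=> a0; elim: n f => [|n IH] f f0 Cf.
  split => // x; have [xa|ax] := ltP `|x| a.
    rewrite /continuous_at f0// mul0r; apply: cvg_near_cst.
    by apply: filterS (near_norm_lt xa) => y ya; rewrite f0 ?mul0r.
  apply: cvgM; first exact: (C1n_continuous Cf).
  by apply: cvgV; [rewrite -normr_eq0 gt_eqF// (lt_le_trans a0)|exact: cvg_id].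
have [_ [df Cf']] := Cf.
have f'0 x : `|x| < a -> derive1 f x = 0 by exact: derive1_vanish.
apply: (@C1nS_is_derive _ _ (fun x => derive1 f x / x - (f x / x) / x)); last first.
  apply: C1nD; first exact: IH.
  apply/C1nN/IH; first by move=> x xa; rewrite f0// mul0r.
  by apply: IH => //; exact: C1nW.
move=> x; have [xa|ax] := ltP `|x| a.
  rewrite f'0// f0// !mul0r subr0.
  apply: (near_eq_is_derive (f := cst 0)).
  by apply: filterS (near_norm_lt xa) => y ya; rewrite f0// mul0r.
have x0 : x != 0 by rewrite -normr_eq0 gt_eqF ?(lt_le_trans a0).
apply: is_derive_eq.
  apply: is_deriveM; first exact: (C1n_is_derive x Cf).
  exact: (is_deriveV x0 (is_derive_id x 1)).
by rewrite /GRing.scale/=; field.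
Qed.

End smooth1.

(** * A smooth step *)

Section bump.
Context {R : realType}.

Lemma is_derive_quad (f : R -> R) (x K : R) :
  (\forall y \near x, `|f y - f x| <= K * (y - x) ^+ 2) -> is_derive x 1 f 0.
Proof.
move=> fK; suff h : (fun h => h^-1 *: ((f \o shift x) (h *: (1 : R)) - f x)) @ 0^' --> (0 : R).
  by split; [apply/cvg_ex; exists 0|apply/cvg_lim].
have hx : (fun h : R => h + x) @ (0 : R) --> x.
  have := @cvgD _ _ _ (nbhs (0 : R)) _ id (cst x) (0 : R) x cvg_id (cvg_cst x).
  by rewrite add0r => /(_ (nbhs_filter _) (nbhs_filter _)).
have hK : \forall h \near (0 : R), `|f (h + x) - f x| <= K * h ^+ 2.
  apply: (@filterS _ (nbhs (0 : R)) _ _ _ _ (hx _ fK)) => h /=. by rewrite addrK.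
have K1 : 0 < `|K| + 1 by rewrite ltr_wpDl.
apply/cvgr0Pnorm_le => e e0; near=> h.
have h0 : h != 0 by near: h; exact: nbhs_dnbhs_neq.
rewrite /= /GRing.scale/= mulr1 normrM normfV.
rewrite ler_pdivrMl ?normr_gt0//.
apply: (@le_trans _ _ (K * h ^+ 2)); first by near: h; exact: nbhs_dnbhs.
rewrite (le_trans (ler_norm _))// normrM normrX expr2 mulrCA ler_wpM2l//.
apply: (@le_trans _ _ ((`|K| + 1) * `|h|)); first by rewrite ler_wpM2r// lerDl.
rewrite -ler_pdivlMl//; near: h; apply: nbhs_dnbhs.
by apply: (@nbhs0_le _ R^o); rewrite mulr_gt0// invr_gt0.
Unshelve. all: by end_near. Qed.

(** All derivatives of exp(-1/x) are of this form. The family is closed under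
    differentiation, so smoothness of one member and of all is the same induction. *)
Definition flat (P : {poly R}) (x : R) : R :=
  if 0 < x then P.[x^-1] * expR (- x^-1) else 0.

Lemma flat_quad (P : {poly R}) : exists K, forall x, `|x| <= 1 -> `|flat P x| <= K * x ^+ 2.
Proof.
pose S := \sum_(i < size P) `|P`_i|; pose d := size P.
have S0 : 0 <= S by exact: sumr_ge0.
exists (S * (d.+2)`!%:R) => x x1; rewrite /flat; case: ifPn => x0; last first.
  by rewrite normr0; apply: mulr_ge0; rewrite ?sqr_ge0 ?mulr_ge0.
set y := x^-1; have y1 : 1 <= y.
  by rewrite /y invf_ge1//; move: x1; rewrite ger0_norm// ltW.
have y0 : 0 < y by rewrite (lt_le_trans ltr01).
rewrite normrM (ger0_norm (expR_ge0 _)).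
have PS : `|P.[y]| <= S * y ^+ d.
  rewrite horner_coef (le_trans (ler_norm_sum _ _ _))// mulr_suml ler_sum// => i _.
  rewrite normrM ler_wpM2l// normrX gtr0_norm// ler_weXn2l//.
  by rewrite ltnW.
apply: (@le_trans _ _ (S * y ^+ d * expR (- y))); first by rewrite ler_wpM2r ?expR_ge0.
rewrite -!mulrA ler_wpM2l//.
rewrite expRN ler_pdivrMr ?expR_gt0//.
have := expR_ge1Dxn d.+1 (ltW y0) => /(le_trans (ltW (ltr_pwDl ltr01 (lexx _)))).
rewrite ler_pdivrMr ?ltr0n ?fact_gt0// => h.
have -> : y ^+ d = y ^+ d.+2 * x ^+ 2.
  by rewrite -addn2 exprD -mulrA -exprMn mulVf ?gt_eqF// expr1n mulr1.
have {}h : y ^+ d.+2 <= d.+2`!%:R * expR y by rewrite mulrC.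
rewrite (le_trans (ler_wpM2r (sqr_ge0 x) h))//.
by rewrite le_eqVlt; apply/orP; left; apply/eqP; ring.
Qed.

Lemma is_derive_flat (P : {poly R}) (x : R) :
  is_derive x 1 (flat P) (flat ('X^2 * (P - P^`())) x).
Proof.
have [x0|x0|x0] := ltgtP x 0.
- rewrite /flat ltNge (ltW x0)/=.
  apply: (near_eq_is_derive (f := cst 0)).
  near=> y; rewrite ltNge ltW//.
  by near: y; exact: lt_nbhsl.
- have nx0 : x != 0 by rewrite gt_eqF.
  apply: (near_eq_is_derive (f := (horner P \o @GRing.inv R) * (expR \o (- @GRing.inv R)))).
    near=> y; rewrite /flat ifT//.
    by near: y; exact: lt_nbhsr.
  have dV : is_derive x 1 (@GRing.inv R) (- x ^- 2).
    apply: is_derive_eq; first exact: (is_deriveV nx0 (is_derive_id x 1)).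
    by rewrite /GRing.scale/= mulr1.
  have dP : is_derive (x^-1) 1 (horner P) (P^`()).[x^-1].
    by apply: DeriveDef; [exact: derivable_horner|rewrite -derive1E derivE].
  have dE : is_derive (- x^-1) 1 expR (expR (- x^-1)).
    exact: is_derive_expR.
  have D := is_deriveM (is_derive1_comp dP dV)
    (@is_derive1_comp _ expR (- @GRing.inv R) x _ _ dE (is_deriveN dV)).
  apply: (is_derive_eq D).
  rewrite /flat x0 hornerM hornerXn hornerD hornerN /GRing.scale/= exprVn; ring.
- have [K PK] := flat_quad P.
  have flat0 Q : flat Q 0 = 0 by rewrite /flat ltxx.
  rewrite x0 flat0; apply: (@is_derive_quad _ _ K).
  near=> y; rewrite flat0 !subr0; apply: PK.
  by near: y; exact: (@nbhs0_le _ R^o).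
Unshelve. all: by end_near. Qed.

Lemma flat_smooth (P : {poly R}) : smooth1 (flat P).
Proof.
move=> n; elim: n P => [|n IH] P.
  split => // x; apply/differentiable_continuous/derivable1_diffP.
  exact: (is_derive1_eq (is_derive_flat P x)).1.
by apply: (C1nS_is_derive (is_derive_flat P)); exact: IH.
Qed.

Definition flat1 := flat 1%:P.

Lemma flat1_gt0 x : (0 < flat1 x) = (0 < x).
Proof.
rewrite /flat1 /flat; case: ifPn => [_|_]; last by rewrite ltxx.
by rewrite hornerC mul1r expR_gt0.
Qed.

Lemma flat1_ge0 x : 0 <= flat1 x.
Proof. by rewrite /flat1 /flat; case: ifPn => // _; rewrite hornerC mul1r expR_ge0. Qed.

Lemma flat1_le0 x : x <= 0 -> flat1 x = 0.
Proof. by rewrite leNgt /flat1 /flat => /negbTE ->. Qed.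

(** The quotient is safe: flat1 is positive on the positive half-line, which
    contains x or 1 - x for every x. *)
Definition step (x : R) : R := flat1 x * (flat1 x + flat1 (1 - x))^-1.

Let den_gt0 x : 0 < flat1 x + flat1 (1 - x).
Proof.
have [x0|x0] := ltP 0 x; first by rewrite ltr_wpDr ?flat1_ge0// flat1_gt0.
by rewrite ltr_wpDl ?flat1_ge0// flat1_gt0 subr_gt0 (le_lt_trans x0).
Qed.

Lemma step_smooth : smooth1 step.
Proof.
move=> n.
have C1 : C1n n (fun x : R => 1 - x).
  by apply: (C1nD (C1n_cst n 1)); apply: C1nN; exact: C1n_id.
apply: C1nM; first exact: flat_smooth.
apply: C1nV => [x|]; first by rewrite gt_eqF.
by apply: C1nD; [exact: flat_smooth|exact: (C1n_comp (flat_smooth _ n) C1)].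
Qed.

Lemma step0 x : x <= 0 -> step x = 0.
Proof. by move=> x0; rewrite /step flat1_le0// mul0r. Qed.

Lemma step1 x : 1 <= x -> step x = 1.
Proof.
move=> x1; rewrite /step [flat1 (1 - x)]flat1_le0 ?subr_le0// addr0 divff//.
by rewrite gt_eqF// flat1_gt0 (lt_le_trans ltr01).
Qed.

Lemma flat1_homo : {homo flat1 : x y / x <= y}.
Proof.
move=> x y xy; have [x0|x0] := leP x 0; first by rewrite flat1_le0// flat1_ge0.
have y0 := lt_le_trans x0 xy.
rewrite /flat1 /flat x0 y0 !hornerC !mul1r ler_expR lerN2.
by rewrite lef_pV2.
Qed.

Lemma step_homo : {homo step : x y / x <= y}.
Proof.
move=> x y xy; rewrite /step ler_pdivrMr// mulrAC ler_pdivlMr//.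
have h1 := flat1_homo xy.
have h2 : flat1 (1 - y) <= flat1 (1 - x) by apply: flat1_homo; rewrite lerD2l lerN2.
have := flat1_ge0 x; have := flat1_ge0 y.
have := flat1_ge0 (1 - x); have := flat1_ge0 (1 - y); nra.
Qed.

Lemma step_ge0 x : 0 <= step x.
Proof. by rewrite /step mulr_ge0// ?flat1_ge0// invr_ge0 ltW. Qed.

Lemma step_le1 x : step x <= 1.
Proof. by rewrite /step ler_pdivrMr// mul1r lerDl flat1_ge0. Qed.

End bump.

(** * Smooth functions of several variables *)

Section Cn_calculus.
Context {R : realType} {N : nat}.
Implicit Types (phi psi : 'rV[R]_N -> R) (x : 'rV[R]_N) (i : 'I_N).
Notation ei i := (delta_mx ord0 i : 'rV[R]_N).

Lemma set_coord_id i x : set_coord i x (x ord0 i) = x.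
Proof. by apply/rowP => j; rewrite mxE; case: eqVneq => [->|]. Qed.

Lemma set_coordK i x t s : set_coord i (set_coord i x t) s = set_coord i x s.
Proof. by apply/rowP => j; rewrite !mxE; case: eqVneq. Qed.

Lemma set_coord_i i x t : set_coord i x t ord0 i = t.
Proof. by rewrite mxE eqxx. Qed.

Lemma set_coordE i x t : set_coord i x (t + x ord0 i) = t *: ei i + x.
Proof. by apply/rowP => j; rewrite !mxE eqxx/=; case: eqVneq => [->|_]; rewrite ?mulr1 ?mulr0 ?add0r. Qed.

(** A partial derivative is an ordinary derivative along a coordinate line;
    the chain rule reduces to its one-variable version this way. *)
Lemma is_derive_line i x phi (d : R) :
  is_derive x (ei i) phi d <->
  is_derive (x ord0 i) 1 (fun t => phi (set_coord i x t)) d.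
Proof.
have E : (fun h : R => h^-1 *: ((phi \o shift x) (h *: ei i) - phi x)) =
  (fun h : R => h^-1 *: (((fun t => phi (set_coord i x t)) \o shift (x ord0 i)) (h *: (1 : R))
     - phi (set_coord i x (x ord0 i)))).
  by apply/funext => h /=; rewrite set_coord_id [h *: 1]mulr1 set_coordE.
by split => -[dphi dE]; split; rewrite /derivable /derive ?E// -?E.
Qed.

Lemma is_derive_lineT i x phi (D : 'rV[R]_N -> R) : (forall y, is_derive y (ei i) phi (D y)) ->
  forall t : R, is_derive t 1 (fun t => phi (set_coord i x t)) (D (set_coord i x t)).
Proof.
move=> dphi t; have /is_derive_line := dphi (set_coord i x t).
by rewrite set_coord_i; under eq_fun do rewrite set_coordK.
Qed.

Lemma continuous_set_coord i x : continuous (set_coord i x : R -> 'rV[R]_N).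
Proof.
have -> : set_coord i x = (fun t : R => (t - x ord0 i) *: ei i + x).
  by apply/funext => t; rewrite -set_coordE subrK.
move=> t; apply: cvgD; last exact: cvg_cst.
by apply: cvgZr_tmp; apply: cvgB; [exact: cvg_id|exact: cvg_cst].
Qed.

Lemma partial_eq i x phi d : is_derive x (ei i) phi d -> partial i phi x = d.
Proof. by case. Qed.

Lemma CnS_is_derive n phi (phi' : 'I_N -> 'rV[R]_N -> R) : continuous phi ->
  (forall i x, is_derive x (ei i) phi (phi' i x)) -> (forall i, Cn n (phi' i)) -> Cn n.+1 phi.
Proof.
move=> cphi dphi Cphi; split => // i; split => [x|]; first by case: (dphi i x).
rewrite (_ : partial i phi = phi' i)//.
by apply/funext => x; exact: partial_eq.
Qed.

Lemma Cn_continuous n phi : Cn n phi -> continuous phi.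
Proof. by case: n => [|n] []. Qed.
Arguments Cn_continuous [n phi] _ x : rename.

Lemma Cn_is_derive n phi i x : Cn n.+1 phi -> is_derive x (ei i) phi (partial i phi x).
Proof. by move=> [_ /(_ i)[df _]]; exact: derivableP. Qed.

Lemma Cn_partial n phi i : Cn n.+1 phi -> Cn n (partial i phi).
Proof. by move=> [_ /(_ i)[]]. Qed.

Lemma CnW n phi : Cn n.+1 phi -> Cn n phi.
Proof.
elim: n phi => [|n IH] phi [cf Cf]; first by split.
by split => // i; have [df Cd] := Cf i; split => //; exact: IH.
Qed.

Lemma Cn_cst n (c : R) : Cn n (fun _ : 'rV[R]_N => c).
Proof.
elim: n c => [|n IH] c; first by split => //; exact: cst_continuous.
by apply: (@CnS_is_derive _ _ (fun _ _ => 0)) => //; exact: cst_continuous.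
Qed.

Lemma is_derive_coord (j i : 'I_N) x :
  is_derive x (ei i) (fun y : 'rV[R]_N => y ord0 j) (j == i)%:R.
Proof.
apply/is_derive_line; case: (eqVneq j i) => [->|ji].
  rewrite (_ : (fun t => _) = id); first exact: is_derive_id.
  by apply/funext => t; rewrite set_coord_i.
rewrite (_ : (fun t => _) = cst (x ord0 j)); first exact: is_derive_cst.
by apply/funext => t; rewrite mxE (negbTE ji).
Qed.

Lemma Cn_coord n (j : 'I_N) : Cn n (fun y : 'rV[R]_N => y ord0 j).
Proof.
case: n => [|n]; first by split => //; exact: coord_continuous.
apply: (@CnS_is_derive _ _ (fun i _ => (j == i)%:R)).
- exact: coord_continuous.
- by move=> i x; exact: is_derive_coord.
- by move=> i; exact: Cn_cst.
Qed.

Lemma CnD n phi psi : Cn n phi -> Cn n psi -> Cn n (phi \+ psi).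
Proof.
elim: n phi psi => [|n IH] f g Cf Cg.
  by split => // x; apply: continuousD; [exact (Cn_continuous Cf x)|exact (Cn_continuous Cg x)].
apply: (@CnS_is_derive _ _ (fun i => partial i f \+ partial i g)).
- by move=> x; apply: continuousD; [exact: (Cn_continuous Cf x)|exact: (Cn_continuous Cg x)].
- by move=> i x; apply: is_deriveD; [exact: (Cn_is_derive i x Cf)|exact: (Cn_is_derive i x Cg)].
- by move=> i; apply: IH; exact: Cn_partial.
Qed.

Lemma CnM n phi psi : Cn n phi -> Cn n psi -> Cn n (phi \* psi).
Proof.
elim: n phi psi => [|n IH] f g Cf Cg.
  by split => // x; apply: continuousM; [exact: (Cn_continuous Cf x)|exact: (Cn_continuous Cg x)].
apply: (@CnS_is_derive _ _ (fun i => (f \* partial i g) \+ (g \* partial i f))).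
- by move=> x; apply: continuousM; [exact: (Cn_continuous Cf x)|exact: (Cn_continuous Cg x)].
- by move=> i x; apply: is_deriveM; [exact: (Cn_is_derive i x Cf)|exact: (Cn_is_derive i x Cg)].
- by move=> i; apply: CnD; apply: IH; [exact: CnW|exact: Cn_partial|exact: CnW|exact: Cn_partial].
Qed.

Lemma is_derive_comp1 (f : R -> R) phi i x (df d : R) :
  is_derive (phi x) 1 f df -> is_derive x (ei i) phi d ->
  is_derive x (ei i) (fun y => f (phi y)) (df * d).
Proof.
move=> hf /is_derive_line hd; apply/is_derive_line.
apply: (@is_derive1_comp _ f (fun t => phi (set_coord i x t))) => //.
by rewrite set_coord_id.
Qed.

Lemma Cn_comp1 n (f : R -> R) phi : C1n n f -> Cn n phi -> Cn n (fun x => f (phi x)).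
Proof.
elim: n f phi => [|n IH] f phi Cf Cphi.
  split => // x; apply: (@continuous_comp _ _ _ phi f); first exact: (Cn_continuous Cphi).
  exact: (C1n_continuous Cf).
apply: (@CnS_is_derive _ _ (fun i => (fun x => derive1 f (phi x)) \* partial i phi)).
- move=> x; apply: (@continuous_comp _ _ _ phi f); first exact: (Cn_continuous Cphi).
  exact: (C1n_continuous Cf).
- by move=> i x; apply: is_derive_comp1; [exact: (C1n_is_derive _ Cf)|exact: (Cn_is_derive i x Cphi)].
- move=> i; apply: CnM; last exact: Cn_partial.
  by apply: IH; [case: Cf => _ []|exact: CnW].
Qed.

Lemma Cn_prod n (I : Type) (r : seq I) (F : I -> 'rV[R]_N -> R) :
  (forall j, Cn n (F j)) -> Cn n (fun x => \prod_(j <- r) F j x).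
Proof.
move=> CF; elim: r => [|j r IH].
  by under eq_fun do rewrite big_nil; exact: Cn_cst.
by under eq_fun do rewrite big_cons; exact: CnM.
Qed.

Lemma continuous_dot : continuous (fun x : 'rV[R]_N => dot x x).
Proof.
rewrite /dot; elim: (index_enum _) => [|j r IH].
  by under eq_fun do rewrite big_nil; exact: cst_continuous.
under eq_fun do rewrite big_cons.
move=> x; apply: (@continuousD _ _ _ (fun y : 'rV[R]_N => y ord0 j * y ord0 j) _ x _ (IH x)).
by apply: continuousM; exact: coord_continuous.
Qed.

Lemma continuous_enorm : continuous (@enorm R N).
Proof.
move=> x; apply: (@continuous_comp _ _ _ (fun x : 'rV[R]_N => dot x x) (@Num.sqrt R)).
  exact: continuous_dot.
exact: sqrt_continuous.
Qed.

Lemma is_derive_dot i x : is_derive x (ei i) (fun x : 'rV[R]_N => dot x x) (2 * x ord0 i).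
Proof.
apply/is_derive_line.
rewrite (_ : (fun t => _) = (id \* id) \+ cst (\sum_(j | j != i) x ord0 j * x ord0 j)).
  rewrite -[2 * _]addr0; apply: is_deriveD.
  apply: (is_derive_eq (is_deriveM (is_derive_id (x ord0 i) 1) (is_derive_id (x ord0 i) 1))).
  by rewrite /GRing.scale/= mulr1 mulr_natl.
apply/funext => t /=; rewrite /dot (bigD1 i)//= set_coord_i; congr (_ + _).
by apply: eq_bigr => j ji; rewrite mxE (negbTE ji).
Qed.

Lemma is_derive_enorm i x : x != 0 -> is_derive x (ei i) (@enorm R N) (x ord0 i / enorm x).
Proof.
move=> x0; have dx : 0 < dot x x by rewrite -enorm_sqr exprn_gt0// enorm_gt0.
have dS : is_derive (dot x x) 1 Num.sqrt (2 * Num.sqrt (dot x x))^-1 by exact: is_derive1_sqrt.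
have D := @is_derive_comp1 Num.sqrt (fun y : 'rV[R]_N => dot y y) i x _ _ dS (is_derive_dot i x).
apply: (@is_derive_eq _ _ _ (@enorm R N) x (ei i) _ _ D).
have : enorm x != 0 by rewrite gt_eqF// enorm_gt0.
by rewrite -[Num.sqrt _]/(enorm x) => ?; field.
Qed.

Lemma is_derive_radial (th : R -> R) (a : R) i x : 0 < a -> (forall r, `|r| < a -> th r = 0) ->
  C1n 1 th -> is_derive x (ei i) (fun y => th (enorm y)) (derive1 th (enorm x) / enorm x * x ord0 i).
Proof.
move=> a0 th0 C.
have [xa|ax] := ltP (enorm x) a.
  have near0 : \forall y \near x, th (enorm y) = 0.
    have := @continuous_enorm x => /cvgr_lt/(_ _ xa); apply: filterS => y ya.
    by rewrite th0// ger0_norm ?enorm_ge0.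
  have -> : derive1 th (enorm x) = 0.
    by apply: (derive1_vanish th0); rewrite ger0_norm ?enorm_ge0.
  rewrite !mul0r; apply: (near_eq_is_derive (f := cst 0)).
  by apply: filterS near0 => y ->.
have x0 : x != 0.
  by apply: contraTneq ax => ->; rewrite -ltNge enorm_0.
have D := @is_derive_comp1 th (@enorm R N) i x _ _ (C1n_is_derive _ C) (is_derive_enorm i x0).
apply: (is_derive_eq D).
by rewrite -mulrA; congr (_ * _); rewrite mulrC.
Qed.

(** The norm is singular only at the origin, where the profile vanishes, and
    th'(r)/r is a profile of the same kind, which makes the induction work. *)
Lemma Cn_radial n (th : R -> R) (a : R) : 0 < a -> (forall r, `|r| < a -> th r = 0) ->
  smooth1 th -> Cn n (fun x : 'rV[R]_N => th (enorm x)).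
Proof.
move=> a0; elim: n th => [|n IH] th th0 C.
  split => // x; apply: continuous_comp; first exact: continuous_enorm.
  exact: (C1n_continuous (C 0%N)).
apply: (@CnS_is_derive _ _ (fun i x => derive1 th (enorm x) / enorm x * x ord0 i)).
- move=> x; apply: continuous_comp; first exact: continuous_enorm.
  exact: (C1n_continuous (C 0%N)).
- by move=> i x; exact: (is_derive_radial i x a0 th0 (C 1%N)).
move=> i; apply: CnM; last exact: Cn_coord.
have th'0 r : `|r| < a -> derive1 th r = 0 by exact: derive1_vanish.
apply: (IH (fun r => derive1 th r / r)).
  by move=> r ra; rewrite th'0// mul0r.
move=> m; apply: (C1n_div_id a0 th'0).
by case: (C m.+1) => _ [].
Qed.

Lemma test_functionP phi (B : R) : (forall n, Cn n phi) ->
  (forall x, ~ box (const_mx (- B)) (const_mx B) x -> phi x = 0) -> test_function phi.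
Proof.
move=> C phi0; split => //.
pose K := [set v : 'rV[R]_N | forall i, `[- B, B]%classic (v ord0 i)].
have cK : compact K := @rV_compact R N (fun=> `[- B, B]%classic) (fun=> segment_compact (a := - B) (b := B)).
apply: (subclosed_compact _ cK); first exact: closed_closure.
have clK : closed K by apply: compact_closed => //; exact: norm_hausdorff.
rewrite [X in _ `<=` X]((closure_id K).1 clK); apply: closure_subset => x /= px i.
rewrite /= in_itv/=; have [h|h] := pselect (box (const_mx (- B)) (const_mx B) x).
  by have := h i; rewrite !mxE.
by rewrite phi0// eqxx in px.
Qed.

End Cn_calculus.

(** * Plateaus and the fundamental lemma of the calculus of variations *)

Section measurable_continuous.
Context {R : realType} {N : nat}.

(** Every point of an open set lies in a box with rational corners contained
    in the set, and there are countably many of those. *)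
Lemma open_measurable_rV (O : set 'rV[R]_N) : open O -> measurable O.
Proof.
move=> oO.
pose bx (q : 'rV[rat]_N * 'rV[rat]_N) : set 'rV[R]_N := box (map_mx ratr q.1) (map_mx ratr q.2).
pose F (k : nat) : set 'rV[R]_N :=
  if unpickle k is Some q then if pselect (bx q `<=` O) then bx q else set0 else set0.
have -> : O = \bigcup_k F k.
  apply/seteqP; split => x; last first.
    move=> [k _]; rewrite /F; case: unpickle => // q; case: pselect => // qO; exact: qO.
  move=> Ox; have /nbhs_ballP[e /= e0 xeO] : nbhs x O by exact: open_nbhs_nbhs.
  have ex1 i : exists q : rat, x ord0 i - e / 2 < ratr q < x ord0 i.
    have : x ord0 i - e / 2 < x ord0 i by rewrite gtrBl divr_gt0.
    by move=> /rat_in_itvoo[q Hq]; exists q; rewrite in_itv/= in Hq.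
  have ex2 i : exists q : rat, x ord0 i < ratr q < x ord0 i + e / 2.
    have : x ord0 i < x ord0 i + e / 2 by rewrite ltrDl divr_gt0.
    by move=> /rat_in_itvoo[q Hq]; exists q; rewrite in_itv/= in Hq.
  have [q1 hq1] := choice ex1; have [q2 hq2] := choice ex2.
  pose q : 'rV[rat]_N * 'rV[rat]_N := (\row_i q1 i, \row_i q2 i).
  exists (pickle q) => //; rewrite /F pickleK.
  case: pselect => [_ i|[]]/=.
    rewrite !mxE; have /andP[_ h1] := hq1 i; have /andP[h2 _] := hq2 i.
    by rewrite !ltW.
  move=> y yq; apply: xeO; split => // i j; rewrite {i}(ord1 i) /ball/=.
  have := yq j; rewrite !mxE => /andP[h1 h2].
  have /andP[h3 h4] := hq1 j; have /andP[h5 h6] := hq2 j.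
  rewrite ltr_norml; apply/andP; split; lra.
apply: bigcupT_measurable => k; rewrite /F; case: unpickle => // q.
by case: pselect => //= ?; exact: measurable_box.
Qed.

Lemma continuous_measurable_rV (f : 'rV[R]_N -> R) : continuous f -> measurable_fun setT f.
Proof.
move=> cf; apply: (measurability (@RGenInftyO.G R)); first exact: RGenInftyO.measurableE.
move=> _ [_ [c ->] <-]; rewrite setTI; apply: open_measurable_rV.
by apply: open_comp => [x _|]; [exact: cf|exact: interval_open].
Qed.

End measurable_continuous.

Section plateau.
Context {R : realType}.

(** A smooth trapezoid equal to 1 on [a, b], with ramps of width 1/(k+1) lying
    outside [a, b]. *)
Definition plateau (k : nat) (a b s : R) : R :=
  step (k.+1%:R * (s - a) + 1) - step (k.+1%:R * (s - b)).

Let C1n_affine n (c d : R) e : C1n n (fun s : R => c * (s - d) + e).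
Proof.
apply: C1nD; last exact: C1n_cst.
apply: C1nM; first exact: C1n_cst.
by apply: C1nD; [exact: C1n_id|exact: C1n_cst].
Qed.

Lemma plateau_smooth k a b : smooth1 (plateau k a b).
Proof.
move=> n; apply: C1nD; first exact: (C1n_comp (step_smooth n) (C1n_affine _ _ _ _)).
apply: C1nN; rewrite (_ : (fun x => _) = step \o (fun s => k.+1%:R * (s - b) + 0)).
  exact: (C1n_comp (step_smooth n) (C1n_affine _ _ _ _)).
by apply/funext => s /=; rewrite addr0.
Qed.

Lemma is_derive_plateau k a b (s : R) :
  is_derive s 1 (plateau k a b)
    (k.+1%:R * derive1 step (k.+1%:R * (s - a) + 1) - k.+1%:R * derive1 step (k.+1%:R * (s - b))).
Proof.
have daff (c d e t : R) : is_derive t 1 (fun s : R => c * (s - d) + e) c.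
  have D := is_deriveD (is_deriveZ c (is_deriveB (is_derive_id t 1) (is_derive_cst d t 1)))
    (is_derive_cst e t 1).
  by apply: (is_derive_eq D); rewrite /GRing.scale/=; ring.
have dstep (t : R) : is_derive t 1 step (derive1 step t).
  exact: (C1n_is_derive t (step_smooth 1)).
have D1 := @is_derive1_comp _ step (fun s : R => k.+1%:R * (s - a) + 1) s _ _ (dstep _) (daff _ _ _ s).
have D2 := @is_derive1_comp _ step (fun s : R => k.+1%:R * (s - b) + 0) s _ _ (dstep _) (daff _ _ _ s).
have D := is_deriveB D1 D2.
have -> : plateau k a b = (step \o (fun s : R => k.+1%:R * (s - a) + 1)) -
   (step \o (fun s : R => k.+1%:R * (s - b) + 0)).
  by apply/funext => t; rewrite [RHS](_ : _ = step (k.+1%:R * (t - a) + 1) - step (k.+1%:R * (t - b) + 0))// addr0.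
by apply: (is_derive_eq D); rewrite /= !addr0; congr (_ - _); rewrite mulrC.
Qed.

Lemma plateau_ge0 k a b s : a <= b -> 0 <= plateau k a b s.
Proof.
move=> ab; rewrite subr_ge0; apply: step_homo.
rewrite -[leLHS]addr0 lerD// ler_wpM2l// lerD2l lerN2//.
Qed.

Lemma plateau_le1 k a b s : plateau k a b s <= 1.
Proof. by rewrite lerBlDr (le_trans (step_le1 _))// lerDl step_ge0. Qed.

Lemma plateau_in k a b s : a <= s <= b -> plateau k a b s = 1.
Proof.
move=> /andP[sa sb]; rewrite /plateau step1 ?step0 ?subr0//.
  by rewrite pmulr_rle0// subr_le0.
by rewrite lerDr mulr_ge0// subr_ge0.
Qed.

Lemma plateau_left k a b s : a <= b -> s <= a - k.+1%:R^-1 -> plateau k a b s = 0.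
Proof.
move=> ab sa; rewrite /plateau !step0 ?subrr//.
  rewrite pmulr_rle0// subr_le0 (le_trans sa)// (le_trans _ ab)// gerBl//.
rewrite -lerBrDr sub0r -ler_pdivlMl// mulrN1 lerBlDr addrC//.
Qed.

Lemma plateau_right k a b s : a <= b -> b + k.+1%:R^-1 <= s -> plateau k a b s = 0.
Proof.
move=> ab sb; have h : 1 <= k.+1%:R * (s - b).
  by rewrite -ler_pdivrMl// mulr1 lerBrDl.
rewrite /plateau !step1 ?subrr//.
rewrite lerDr mulr_ge0// subr_ge0 (le_trans ab)// (le_trans _ sb)// lerDl//.
Qed.

Lemma plateau_cvg a b s : a <= b ->
  \forall k \near \oo, plateau k a b s = \1_`[a, b]%classic s.
Proof.
move=> ab; rewrite indicE.
have inv_lt (e : R) : 0 < e -> \forall k \near \oo, k.+1%:R^-1 < e.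
  move=> e0; exists (Num.truncn e^-1) => // k /= hk.
  rewrite invf_plt ?posrE//; apply: (lt_le_trans (truncnS_gt _)).
  by rewrite ler_nat ltnS.
have [sa|as_] := ltP s a.
  rewrite memNset; last by rewrite /= in_itv/= leNgt sa.
  have h : 0 < a - s by rewrite subr_gt0.
  by apply: filterS (inv_lt _ h) => k hk; rewrite plateau_left// lerBrDr -lerBrDl ltW.
have [bs|sb] := ltP b s.
  rewrite memNset; last by rewrite /= in_itv/= as_ leNgt bs.
  have h : 0 < s - b by rewrite subr_gt0.
  by apply: filterS (inv_lt _ h) => k hk; rewrite plateau_right// -lerBrDl ltW.
by near=> k; rewrite plateau_in ?as_// mem_set//= in_itv/= as_.
Unshelve. all: by end_near. Qed.

End plateau.

Section fundamental_lemma.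
Context {R : realType} {N : nat}.
Notation lam := (lebesgue_rV (R := R) N).

Definition box_plateau k (a b x : 'rV[R]_N) : R :=
  \prod_j plateau k (a ord0 j) (b ord0 j) (x ord0 j).

Lemma Cn_box_plateau n k a b : Cn n (box_plateau k a b).
Proof.
apply: Cn_prod => j; apply: Cn_comp1; [exact: plateau_smooth|exact: Cn_coord].
Qed.

Lemma integral_box_eq0 (h : 'rV[R]_N -> R) : lam.-integrable setT (EFin \o h) ->
  (forall k (a b : 'rV[R]_N), (forall i, a ord0 i <= b ord0 i) ->
    (\int[lam]_x (h x * box_plateau k a b x)%:E = 0)%E) ->
  forall a b : 'rV[R]_N, (forall i, a ord0 i <= b ord0 i) -> (\int[lam]_(x in box a b) (h x)%:E = 0)%E.
Proof.
move=> ih h0 a b ab.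
have mh : measurable_fun setT h by apply/measurable_EFinP; exact: (measurable_int lam ih).
have mbox := @measurable_box R N a b.
have -> : (\int[lam]_(x in box a b) (h x)%:E = \int[lam]_x (h x * \1_(box a b) x)%:E)%E.
  rewrite integral_mkcond; apply: eq_integral => x _; rewrite patchE indicE.
  by case: ifPn => _; rewrite ?mulr1 ?mulr0.
have mbp k : measurable_fun setT (box_plateau k a b).
  by apply: continuous_measurable_rV => x; exact: (Cn_continuous (Cn_box_plateau 0 k a b)).
have pl01 k (j : 'I_N) (x : 'rV[R]_N) : 0 <= plateau k (a ord0 j) (b ord0 j) (x ord0 j) <= 1.
  by rewrite plateau_ge0//= plateau_le1.
have [] := @dominated_cvg _ _ _ lam (fun k x => h x * box_plateau k a b x)
  (fun x => h x * \1_(box a b) x) (fun x => `|h x|) _ _ _ _.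
- by move=> k; exact: measurable_funM.
- move=> x; apply: cvg_near_cst.
  apply: filterS (_ : \forall k \near \oo, box_plateau k a b x = \1_(box a b) x).
    by move=> k /= ->.
  rewrite indicE; have [xb|xb] := pselect (box a b x).
    near=> k; rewrite mem_set// /box_plateau big1// => j _.
    by rewrite plateau_in//; exact: xb.
  have [j xj] : exists j, ~ (a ord0 j <= x ord0 j <= b ord0 j) by exact/existsNP.
  have := plateau_cvg (x ord0 j) (ab j); apply: filterS => k hk.
  by rewrite memNset// /box_plateau (bigD1 j)//= hk indicE memNset ?mul0r//= in_itv.
- exact: integrable_norm.
- move=> k x; rewrite normrM ler_piMr//.
  rewrite ger0_norm; first by apply: num_theory.numdomain.Num.Theory.prodr_ile1 => j _; exact: pl01.
  by apply: prodr_ge0 => j _; have /andP[] := pl01 k j x.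
move=> _; rewrite (_ : (fun k => _) = cst 0%E); last by apply/funext => k /=; exact: h0.
by move=> H; apply/esym; apply: (cvg_unique _ _ H) => //; exact: cvg_cst.
Unshelve. all: by end_near. Qed.

(** Letting the plateaus converge to indicators, the integral of h over every
    box vanishes. The measures with densities the positive and negative parts of
    h then agree on boxes, hence on all measurable sets, so that h integrates to 0
    over each of them. *)
Lemma fundamental_lemma (h : 'rV[R]_N -> R) : lam.-integrable setT (EFin \o h) ->
  (forall k (a b : 'rV[R]_N), (forall i, a ord0 i <= b ord0 i) ->
    (\int[lam]_x (h x * box_plateau k a b x)%:E = 0)%E) ->
  {ae lam, forall x, h x = 0}.
Proof.
move=> ih /(integral_box_eq0 ih) h0.
have ihp := integrable_funepos measurableT ih.
have ihn := integrable_funeneg measurableT ih.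
have pos_ge0 A : (0 <= induced_charge ihp A)%E by exact: integral_ge0.
have neg_ge0 A : (0 <= induced_charge ihn A)%E by exact: integral_ge0.
pose mp : {measure set 'rV[R]_N -> \bar R} := measure_of_charge (induced_charge ihp) pos_ge0.
pose mn : {measure set 'rV[R]_N -> \bar R} := measure_of_charge (induced_charge ihn) neg_ge0.
have fin A : measurable A -> (\int[lam]_(x in A) (EFin \o h)^\- x \is a fin_num)%E.
  by move=> mA; apply: integrable_fin_num => //; exact: (integrableS measurableT mA (@subsetT _ A) ihn).
have mpn : forall A, measurable A -> mp A = mn A.
  have finp a b : (\int[lam]_(x in box a b) (EFin \o h)^\+ x \is a fin_num)%E.
    apply: integrable_fin_num; first exact: measurable_box.
    exact: (integrableS measurableT (measurable_box a b) (@subsetT _ _) ihp).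
  apply: measure_rV_unique => a b; last first.
    by have := finp a b; rewrite ge0_fin_numE//; exact: pos_ge0.
  move=> /h0; rewrite integralE => H.
  change (\int[lam]_(x in box a b) (EFin \o h)^\+ x = \int[lam]_(x in box a b) (EFin \o h)^\- x)%E.
  move: H; rewrite -(fineK (finp a b)) -(fineK (fin _ (measurable_box a b))) -EFinB.
  by move=> -[/eqP]; rewrite subr_eq0 => /eqP ->.
have : ae_eq lam setT (EFin \o h) (cst 0%E).
  apply: integral_ae_eq => // A AT mA.
  rewrite integral0 integralE.
  by rewrite (mpn A mA : (\int[lam]_(x in A) (EFin \o h)^\+ x)%E = _) subee// fin.
by apply: filterS => x /(_ I) [].
Qed.

End fundamental_lemma.

(** * Primitives and approximate identities *)

Section real_line.
Context {R : realType}.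
Notation leb := (@lebesgue_measure R).
Implicit Types f F V : R -> R.

Lemma is_derive_continuous F f (x : R) : is_derive x 1 F (f x) -> {for x, continuous F}.
Proof.
by move=> dF; apply/differentiable_continuous/derivable1_diffP; case: dF.
Qed.

Lemma continuous_measurable_R f : continuous f -> measurable_fun (setT : set (measurableTypeR R)) f.
Proof. exact: continuous_measurable_fun. Qed.

Lemma integrable_cut f (a b : R) : leb.-integrable `[a, b] (EFin \o f) ->
  leb.-integrable setT (EFin \o (fun s => f s * \1_`[a, b]%classic s)).
Proof.
have mI : measurable (`[a, b]%classic : set (measurableTypeR R)) by exact: measurable_itv.
move=> fi; have := (@integrable_mkcond _ (measurableTypeR R) R leb _ (EFin \o f) mI).1 fi.
apply: eq_integrable => // z _; rewrite patchE /= indicE.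
by case: ifPn => _; rewrite ?mulr1// mulr0.
Qed.

Lemma integral_cut f (a b : R) :
  (\int[leb]_(s in `[a, b]) (f s)%:E = \int[leb]_s (f s * \1_`[a, b]%classic s)%:E)%E.
Proof.
rewrite [LHS]integral_mkcond; apply: eq_integral => z _; rewrite patchE indicE.
by case: ifPn => _; rewrite ?mulr1// mulr0.
Qed.

Lemma FTC2 F f (a b : R) : a <= b -> (forall x, a <= x <= b -> is_derive x 1 F (f x)) ->
  {within `[a, b], continuous f} ->
  (\int[leb]_(x in `[a, b]) (f x)%:E = (F b - F a)%:E)%E.
Proof.
rewrite le_eqVlt => /predU1P[<-|ab] dF cf.
  by rewrite set_itv1 integral_set1 subrr.
have cF x : a <= x <= b -> {for x, continuous F} by move=> /dF /is_derive_continuous.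
rewrite (@continuous_FTC2 _ f F a b ab cf)//.
- split.
  + move=> x; rewrite in_itv/= => /andP[ax xb].
    by have := dF x; rewrite !ltW// => /(_ isT) [].
  + by apply: cvg_at_right_filter; apply: cF; rewrite lexx ltW.
  + by apply: cvg_at_left_filter; apply: cF; rewrite lexx ltW.
- move=> x; rewrite in_itv/= => /andP[ax xb].
  have := dF x; rewrite !ltW// => /(_ isT) dFx.
  exact: (is_derive1_eq dFx).2.
Qed.

Lemma integral_compact_derivative F f (a b : R) : a <= b ->
  (forall x : R, is_derive x 1 F (f x)) -> continuous f ->
  (forall x, ~~ (a <= x <= b) -> f x = 0) ->
  (\int[leb]_x (f x)%:E = (F b - F a)%:E)%E.
Proof.
move=> ab dF cf f0; rewrite -(@FTC2 F f a b)//; last first.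
  exact: continuous_subspaceT.
rewrite [RHS]integral_mkcond; apply: eq_integral => x _; rewrite patchE.
case: ifPn => // xab; rewrite f0//; apply: contraNN xab => h.
by rewrite inE/= in_itv.
Qed.

(** An approximate identity concentrating at a point where the averages of V
    converge. *)
Lemma kernel_cvg V (b M : R) (K : nat -> R -> R) :
  leb.-integrable setT (EFin \o V) -> lebesgue_pt V b ->
  (forall n, continuous (K n)) ->
  (forall n s, 0 <= K n s <= M * n.+1%:R) ->
  (forall n s, 2 / n.+1%:R <= `|s - b| -> K n s = 0) ->
  (forall n, \int[leb]_s (K n s)%:E = 1%E)%E ->
  \int[leb]_s (V s * K n s) @[n --> \oo] --> V b.
Proof.
move=> iV Vb cK KM K0 K1.
have M0 : 0 <= M.
  have /andP[h1 h2] := KM 0%N b; have := le_trans h1 h2.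
  by rewrite mulr1.
pose r n : R := 2 / n.+1%:R.
have r0 n : 0 < r n by rewrite divr_gt0.
have mK n : measurable_fun (setT : set (measurableTypeR R)) (K n).
  exact: continuous_measurable_R.
have KB n s : `|K n s| <= M * n.+1%:R.
  by have /andP[h1 h2] := KM n s; rewrite ger0_norm.
have iK n : leb.-integrable setT (EFin \o K n).
  apply/integrableP; split; first exact/measurable_EFinP.
  under eq_integral => s _ do rewrite /= ger0_norm ?(andP (KM n s)).1//.
  by rewrite K1 ltry.
have iVK n : leb.-integrable setT (EFin \o (fun s => V s * K n s)).
  exact: (integrable_mul_bounded iV (mK n) (KB n)).
have r_to0 : r n @[n --> \oo] --> (0 : R).
  rewrite /r -[X in _ --> X](mulr0 2); apply: (@cvgMr _ _ _ _ (fun n => n.+1%:R^-1)).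
  exact: cvg_harmonic.
have lim0 : ((4 * M)%:E * davg V b (r n))%E @[n --> \oo] --> 0%E.
  rewrite -[X in _ --> X](mule0 (4 * M)%:E); apply: cvgeZl => //.
  exact: (cvge_at_rightP _ _ _).1 Vb r (conj r0 r_to0).
have bound n : (`|(\int[leb]_s (V s * K n s) - V b)%:E| <= (4 * M)%:E * davg V b (r n))%E.
  have iVb : leb.-integrable setT (EFin \o (fun s => V b * K n s)).
    exact: (integrableZl measurableT (V b) (iK n)).
  have -> : \int[leb]_s (V s * K n s) - V b = \int[leb]_s ((V s - V b) * K n s).
    under [RHS]eq_Rintegral => s _ do rewrite mulrBl.
    rewrite RintegralB// RintegralZl//; congr (_ - _).
    by rewrite /Rintegral K1/= mulr1.
  have iD : leb.-integrable setT (EFin \o (fun s => (V s - V b) * K n s)).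
    apply: eq_integrable (integrableB measurableT (iVK n) iVb) => // s _ /=.
    by rewrite mulrBl EFinB.
  pose B := ball b (r n).
  have mB : measurable B by exact: measurable_ball.
  have mV : measurable_fun setT V by apply/measurable_EFinP; exact: (measurable_int leb iV).
  rewrite /Rintegral fineK; last exact: integrable_fin_num.
  apply: (le_trans (le_abse_integral _ _ _)) => //.
    exact: (measurable_int leb iD).
  apply: (@le_trans _ _ (\int[leb]_(s in B) ((M * n.+1%:R)%:E * `|(V s - V b)%:E|))%E).
    rewrite (_ : (\int[leb]_s `|((V s - V b) * K n s)%:E| =
        \int[leb]_(s in B) `|((V s - V b) * K n s)%:E|)%E); last first.
      rewrite [RHS]integral_mkcond; apply: eq_integral => s _; rewrite patchE.
      case: ifPn => // sB; rewrite K0; first by rewrite mulr0; exact: abse0.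
      by move: sB; rewrite notin_setE /B -ball_normE /ball_/= => /negP; rewrite -leNgt distrC.
    apply: ge0_le_integral => //.
    - by apply: measurable_funTS; exact: (measurable_int leb (integrable_abse iD)).
    - by apply: measurable_funTS; apply: measurable_funeM; apply: measurableT_comp => //;
        apply/measurable_EFinP; exact: measurable_funB.
    - move=> s _; rewrite -EFinM lee_fin normrM mulrC ler_wpM2r//.
  rewrite ge0_integralZl//; last 2 first.
    apply: measurable_funTS; apply: measurableT_comp => //.
    by apply/measurable_EFinP; exact: measurable_funB.
    by rewrite lee_fin mulr_ge0.
  rewrite /davg /iavg lebesgue_measure_ball ?(ltW (r0 n))// inver.
  have rn0 := r0 n; rewrite gt_eqF ?mulrn_wgt0// muleA -EFinM.
  rewrite le_eqVlt; apply/orP; left; apply/eqP; congr (_ * _)%E.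
  by congr EFin; rewrite /r -mulr_natr; field; rewrite nat1r pnatr_eq0.
apply/cvgrPdist_le => e e0.
have := lim0; move/fine_cvgP => [fin /cvgrPdist_le/(_ e e0)].
apply: filterS2 fin => n fn; rewrite sub0r normrN distrC => h.
rewrite -lee_fin; apply: (le_trans (bound n)).
rewrite -(fineK fn) lee_fin; apply: le_trans h; exact: ler_norm.
Qed.

End real_line.

(** * Derivatives of plateaus as approximate point masses *)

Section plateau_kernel.
Context {R : realType}.
Notation leb := (@lebesgue_measure R).
Notation eta := (derive1 (@step R)).

Lemma dstep_continuous : continuous eta.
Proof. by have [_ [_ []]] := @step_smooth R 1. Qed.

Lemma is_derive_step (t : R) : is_derive t 1 step (eta t).
Proof. exact: (C1n_is_derive t (step_smooth 1)). Qed.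

Lemma dstep0 (x : R) : x < 0 -> eta x = 0.
Proof.
move=> x0; apply: (proj2 (is_derive1_eq (d := 0) _)).
apply: (near_eq_is_derive (f := cst 0)).
by near=> y; rewrite step0// ltW//; near: y; exact: lt_nbhsl.
Unshelve. all: by end_near. Qed.

Lemma dstep1 (x : R) : 1 < x -> eta x = 0.
Proof.
move=> x1; apply: (proj2 (is_derive1_eq (d := 0) _)).
apply: (near_eq_is_derive (f := cst (1 : R))).
by near=> y; rewrite step1// ltW//; near: y; exact: lt_nbhsr.
Unshelve. all: by end_near. Qed.

Lemma dstep_ge0 (x : R) : 0 <= eta x.
Proof.
have [_ dE] := is_derive_step x; rewrite -dE.
have dx : derivable step x 1 by case: (is_derive_step x).
apply: limr_ge; first exact: dx.
near=> h; have h0 : h != 0 by near: h; exact: nbhs_dnbhs_neq.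
rewrite /= /GRing.scale/= mulr1.
have [hp|hn|he] := ltgtP 0 h; last by rewrite -he eqxx in h0.
  by apply: mulr_ge0; rewrite ?invr_ge0 ?(ltW hp)// subr_ge0 step_homo// lerDr ltW.
by apply: mulr_le0; rewrite ?invr_le0 ?(ltW hn)// subr_le0 step_homo// gerDr ltW.
Unshelve. all: by end_near. Qed.

Lemma dstep_bounded : exists M, forall x, eta x <= M.
Proof.
have [|c _ hc] := @EVT_max R eta 0 1 ler01.
  by apply: continuous_subspaceT; exact: dstep_continuous.
exists (eta c) => x; have [x0|x0] := ltP x 0; first by rewrite dstep0// dstep_ge0.
have [x1|x1] := ltP 1 x; first by rewrite dstep1// dstep_ge0.
by apply: hc; rewrite in_itv/= x0.
Qed.

Let aff (n : nat) (b e s : R) : R := n.+1%:R * (s - b) + e.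

Let is_derive_aff n b e (s : R) : is_derive s 1 (aff n b e) n.+1%:R.
Proof.
have D := is_deriveD (is_deriveZ n.+1%:R (is_deriveB (is_derive_id s 1) (is_derive_cst b s 1)))
    (is_derive_cst e s 1).
by apply: (is_derive_eq D); rewrite /GRing.scale/=; ring.
Qed.

Lemma step_kernel_cvg (V : R -> R) (b e : R) : 0 <= e <= 1 ->
  leb.-integrable setT (EFin \o V) -> lebesgue_pt V b ->
  \int[leb]_s (V s * (n.+1%:R * eta (n.+1%:R * (s - b) + e))) @[n --> \oo] --> V b.
Proof.
move=> /andP[e0 e1] iV Vb; have [M hM] := dstep_bounded.
have caff n : continuous (aff n b e).
  by move=> s; apply: is_derive_continuous; exact: is_derive_aff.
have cK n : continuous (fun s => n.+1%:R * eta (aff n b e s)).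
  move=> s; apply: cvgM; first exact: cvg_cst.
  apply: (@continuous_comp _ _ _ (aff n b e) eta); first exact: caff.
  exact: dstep_continuous.
have K0 n s : 2 / n.+1%:R <= `|s - b| -> n.+1%:R * eta (aff n b e s) = 0.
  rewrite ler_pdivrMr// => h.
  have [sb|sb] := leP b s.
    move: h; rewrite ger0_norm ?subr_ge0// => h.
    rewrite dstep1 ?mulr0// /aff mulrC (lt_le_trans (y := 2)) ?ltr1n//.
    by rewrite (le_trans h)// lerDl.
  move: h; rewrite ltr0_norm ?subr_lt0// => h.
  rewrite dstep0 ?mulr0// /aff mulrC.
  by move: h; rewrite mulNr; set X := _ * _; move=> ?; lra.
apply: (@kernel_cvg R V b M (fun n s => n.+1%:R * eta (aff n b e s))) => //.
  by move=> n s; rewrite mulr_ge0 ?dstep_ge0//= mulrC ler_wpM2r.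
move=> n; have [q q0 qE] : exists2 q : R, 0 < q & q = 2 / n.+1%:R by exists (2 / n.+1%:R); rewrite ?divr_gt0.
have dK (s : R) : is_derive s 1 (step \o aff n b e) (n.+1%:R * eta (aff n b e s)).
  have D := @is_derive1_comp _ step (aff n b e) s _ _ (is_derive_step _) (is_derive_aff n b e s).
  by apply: (is_derive_eq D); rewrite mulrC.
have -> := @integral_compact_derivative R (step \o aff n b e) _ (b - q) (b + q)
  _ dK (cK n) _.
- have nq : n.+1%:R * q = 2 by rewrite qE mulrCA mulfV ?mulr1.
  congr EFin; rewrite /= /aff addrAC subrr add0r addrAC subrr add0r mulrN nq.
  by rewrite step1 ?step0 ?subr0//; lra.
- by lra.
- move=> s sb; apply: K0; rewrite -qE leNgt; apply: contra sb.
  by rewrite ltr_norml => /andP[h1 h2]; apply/andP; split; lra.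
Qed.

(** The derivative of a plateau is the difference of two kernels of mass 1 that
    concentrate at the end points. *)
Lemma plateau_derivative_cvg (V : R -> R) (a b : R) :
  leb.-integrable setT (EFin \o V) -> lebesgue_pt V a -> lebesgue_pt V b ->
  \int[leb]_s (V s * derive1 (plateau n a b) s) @[n --> \oo] --> V a - V b.
Proof.
move=> iV Va Vb.
have h1 := @step_kernel_cvg V a 1 _ iV Va.
have h2 := @step_kernel_cvg V b 0 _ iV Vb.
have [M hM] := dstep_bounded.
have iVK c e n : leb.-integrable setT
    (EFin \o (fun s => V s * (n.+1%:R * eta (n.+1%:R * (s - c) + e)))).
  apply: (integrable_mul_bounded (M := n.+1%:R * M) iV) => [|s].
    apply: continuous_measurable_R => s; apply: cvgM; first exact: cvg_cst.
    apply: (@continuous_comp _ _ _ (aff n c e) eta).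
      by apply: is_derive_continuous; exact: is_derive_aff.
    exact: dstep_continuous.
  by rewrite ger0_norm ?mulr_ge0 ?dstep_ge0// ler_wpM2l.
rewrite (_ : (fun n => _) = (fun n => \int[leb]_s (V s * (n.+1%:R * eta (n.+1%:R * (s - a) + 1))) -
  \int[leb]_s (V s * (n.+1%:R * eta (n.+1%:R * (s - b) + 0))))); last first.
  apply/funext => n; rewrite -RintegralB//; apply: eq_Rintegral => s _.
  have [_ ->] := is_derive1_eq (is_derive_plateau n a b s).
  by rewrite addr0 mulrBr.
by apply: cvgB; [apply: h1|apply: h2]; rewrite ?lexx ?ler01.
Qed.

End plateau_kernel.

(** * Radial test functions and the divergence theorem *)

Section integration_by_parts.
Context {R : realType} {N : nat}.
Notation ei i := (delta_mx ord0 i : 'rV[R]_N).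

Lemma compact_box (a b : 'rV[R]_N) : compact (box a b).
Proof.
have := @rV_compact R N (fun i => `[a ord0 i, b ord0 i]%classic) (fun i => @segment_compact R _ _).
by rewrite (_ : [set v | _] = box a b).
Qed.

Lemma continuous_bounded_on (A : set 'rV[R]_N) (D : 'rV[R]_N -> R) : compact A -> continuous D ->
  exists2 M, 0 <= M & forall x, A x -> `|D x| <= M.
Proof.
move=> cA cD; have : compact (D @` A).
  by apply: continuous_compact => //; apply: continuous_subspaceT.
move=> /compact_bounded[M [_ hM]].
exists (`|M| + 1); first by rewrite addr_ge0.
move=> x Ax; apply: (hM (`|M| + 1)); last by exists x.
by rewrite (le_lt_trans (ler_norm M))// ltrDl.
Qed.

Lemma continuous_box_bounded (D : 'rV[R]_N -> R) B : continuous D ->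
  (forall x, ~ box (const_mx (- B)) (const_mx B) x -> D x = 0) ->
  exists2 M, 0 <= M & box_bounded D B M.
Proof.
move=> cD D0; have [M M0 hM] := continuous_bounded_on (@compact_box (const_mx (- B)) (const_mx B)) cD.
exists M => //; split => //; first exact: continuous_measurable_rV.
move=> x; have [/hM//|/D0 ->] := pselect (box (const_mx (- B)) (const_mx B) x).
by rewrite normr0.
Qed.

(** On every line parallel to the axis, the integral is the increment of a
    function that vanishes at both ends. *)
Lemma integral_partial0 (i : 'I_N) (F D : 'rV[R]_N -> R) B : continuous D ->
  (forall x, is_derive x (ei i) F (D x)) ->
  (forall x, ~ box (const_mx (- B)) (const_mx B) x -> D x = 0) ->
  (forall x, ~ box (const_mx (- B)) (const_mx B) x -> F x = 0) ->
  (\int[lebesgue_rV N]_x (D x)%:E = 0)%E.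
Proof.
move=> cD dF D0 F0; have [M M0 bD] := continuous_box_bounded cD D0.
apply: (integral_slices0 (i := i) M0 bD) => x.
pose L := `|B| + 1.
have out t : L <= `|t| -> ~ box (const_mx (- B)) (const_mx B) (set_coord i x t).
  move=> Lt /(_ i); rewrite set_coord_i !mxE -ler_norml => tB.
  have := le_trans Lt (le_trans tB (ler_norm B)).
  by rewrite /L gerDl ler10.
have L0 : 0 < L by rewrite ltr_wpDl.
have -> := @integral_compact_derivative R (fun t => F (set_coord i x t)) _ (- L) L _
  (is_derive_lineT x dF) _ _.
- by rewrite !F0 ?subrr//; apply: out; rewrite ?normrN gtr0_norm.
- by rewrite ge0_cp ?ltW.
- by move=> t; apply: continuous_comp; [exact: continuous_set_coord|exact: cD].
- by move=> t tL; apply/D0/out; move: tL; rewrite -ler_norml -ltNge; exact: ltW.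
Qed.

End integration_by_parts.

Section radial.
Context {R : realType} {N : nat} (N0 : (0 < N)%N).
Notation C := (@ball_volume R N).
Notation ei i := (delta_mx ord0 i : 'rV[R]_N).

Let C0 : 0 < C. Proof. exact: ball_volume_gt0. Qed.

(** The radius of the ball of volume s. *)
Definition rad (s : R) : R := (s / C) `^ N%:R^-1.

Lemma rad_ge0 s : 0 <= rad s. Proof. exact: powR_ge0. Qed.

Lemma rad_gt0 s : 0 < s -> 0 < rad s.
Proof. by move=> s0; rewrite powR_gt0// divr_gt0. Qed.

Lemma radK s : 0 <= s -> C * rad s ^+ N = s.
Proof.
move=> s0; rewrite -powR_mulrn ?rad_ge0// /rad -powRrM mulVf ?pnatr_eq0 -?lt0n//.
by rewrite powRr1 ?divr_ge0 ?(ltW C0)// mulrCA mulfV ?mulr1// gt_eqF.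
Qed.

Lemma rad_volr r : 0 <= r -> rad (C * r ^+ N) = r.
Proof.
move=> r0; rewrite /rad mulrC mulKf ?gt_eqF// -powR_mulrn// -powRrM.
by rewrite mulfV ?powRr1// pnatr_eq0 -lt0n.
Qed.

Lemma rad_vol (x : 'rV[R]_N) : rad (vol x) = enorm x.
Proof. by rewrite rad_volr// enorm_ge0. Qed.

Lemma vol0 : vol (0 : 'rV[R]_N) = 0.
Proof. by rewrite /vol enorm_0 expr0n gtn_eqF// mulr0. Qed.

Lemma vol_gt0_neq0 (x : 'rV[R]_N) : 0 < vol x -> x != 0.
Proof. by apply: contraTneq => ->; rewrite vol0 ltxx. Qed.

Lemma vol_out_box (b : R) (x : 'rV[R]_N) : 0 <= b ->
  ~ box (const_mx (- rad b)) (const_mx (rad b)) x -> b < vol x.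
Proof.
move=> b0 /existsNP[i /negP]; rewrite !mxE -ler_norml -ltNge => h.
have {}h : rad b < enorm x := lt_le_trans h (coord_le_enorm x i).
rewrite -[ltLHS](radK b0) /vol ltr_pM2l// ltr_pXn2r// ?nnegrE ?rad_ge0 ?enorm_ge0//.
Qed.

Lemma continuous_vol : continuous (@vol R N).
Proof.
rewrite (_ : @vol R N = fun x => C * enorm x ^+ N)// => x.
refine (@continuousM R 'rV[R]_N (cst C) (fun x => enorm x ^+ N) x _ _); first exact: cst_continuous.
apply: (@continuous_comp _ _ _ (@enorm R N) (fun r : R => r ^+ N)).
  exact: continuous_enorm.
exact: exprn_continuous.
Qed.

(** The partial derivatives of vol. *)
Definition dvol (i : 'I_N) (x : 'rV[R]_N) : R := C * N%:R * enorm x ^+ N.-2 * x ord0 i.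

Lemma continuous_dvol i : continuous (dvol i).
Proof.
rewrite (_ : dvol i = fun x => C * N%:R * enorm x ^+ N.-2 * x ord0 i)// => x.
refine (@continuousM R 'rV[R]_N (fun x => C * N%:R * enorm x ^+ N.-2) (fun x : 'rV[R]_N => x ord0 i) x _ _);
  last exact: coord_continuous.
refine (@continuousM R 'rV[R]_N (cst (C * N%:R)) (fun x => enorm x ^+ N.-2) x _ _); first exact: cst_continuous.
apply: (@continuous_comp _ _ _ (@enorm R N) (fun r : R => r ^+ N.-2)).
  exact: continuous_enorm.
exact: exprn_continuous.
Qed.

Lemma is_derive_volr (r : R) : is_derive r 1 (fun r => C * r ^+ N) (C * (N%:R * r ^+ N.-1)).
Proof.
have D := is_deriveZ C (is_deriveX N (is_derive_id r 1)).
rewrite (_ : (fun r => _) = C \*: ((@id R : R -> R) ^+ N)); last first.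
  by apply/funext => t; rewrite -[RHS]/(C * ((@id R : R -> R) ^+ N) t) fctE.
by apply: (is_derive_eq D); rewrite /GRing.scale/= mulr1.
Qed.

Lemma is_derive_vol i (x : 'rV[R]_N) : (1 < N)%N -> x != 0 -> is_derive x (ei i) (@vol R N) (dvol i x).
Proof.
move=> N1 x0.
have D := @is_derive_comp1 R N (fun r => C * r ^+ N) (@enorm R N) i x _ _ (is_derive_volr _) (is_derive_enorm i x0).
apply: (@is_derive_eq _ _ _ (@vol R N) x (ei i) _ _ D).
have e0 : enorm x != 0 by rewrite gt_eqF// enorm_gt0.
have NE : N.-1 = N.-2.+1 by rewrite prednK// -subn1 subn_gt0.
by rewrite /dvol NE exprS; field.
Qed.

Section test_functions.
Variables (be : R -> R) (a b : R).
Hypotheses (a0 : 0 < a) (b0 : 0 <= b) (sbe : smooth1 be).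
Hypotheses (bea : forall s, s < a -> be s = 0) (beb : forall s, b < s -> be s = 0).

Let th r := be (C * r ^+ N).

Let th_smooth : smooth1 th.
Proof.
move=> n; apply: (C1n_comp (sbe n)); apply: C1nM; first exact: C1n_cst.
by apply: C1nX; exact: C1n_id.
Qed.

Let th_near0 : exists2 d, 0 < d & forall r, `|r| < d -> th r = 0.
Proof.
exists (rad a); first exact: rad_gt0.
move=> r ra; apply: bea; rewrite -[ltRHS](radK (ltW a0)).
rewrite ltr_pM2l// (le_lt_trans (ler_norm _))// normrX.
by rewrite ltr_pXn2r// ?nnegrE ?rad_ge0.
Qed.

Let thd k r := th r / r ^+ k.

Let thd_smooth k : smooth1 (thd k).
Proof.
have [d d0 thd0] := th_near0.
move=> n; elim: k => [|k IH].
  by rewrite (_ : thd 0 = th)//; apply/funext => r; rewrite /thd expr0 divr1.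
rewrite (_ : thd k.+1 = fun r => thd k r / r).
  by apply: (C1n_div_id d0) => // r rd; rewrite /thd thd0// mul0r.
by apply/funext => r; rewrite /thd exprSr invfM mulrA.
Qed.

Let thd_near0 k : exists2 d, 0 < d & forall r, `|r| < d -> thd k r = 0.
Proof.
by have [d d0 h] := th_near0; exists d => // r rd; rewrite /thd h// mul0r.
Qed.

Lemma test_radial : test_function (fun x : 'rV[R]_N => be (vol x)).
Proof.
have [d d0 h] := th_near0.
apply: (@test_functionP _ _ _ (rad b)) => [n|x /(vol_out_box b0)]; last exact: beb.
exact: (@Cn_radial R N n th d d0 h th_smooth).
Qed.

Lemma test_radial_mul psi : (forall n, Cn n psi) ->
  test_function (fun x : 'rV[R]_N => be (vol x) * psi x).
Proof.
move=> Cpsi; apply: (@test_functionP _ _ _ (rad b)) => [n|x /(vol_out_box b0) bx].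
  by apply: CnM => //; have [] := test_radial.
by rewrite beb// mul0r.
Qed.

Lemma is_derive_be_vol i x : (1 < N)%N ->
  is_derive x (ei i) (fun x : 'rV[R]_N => be (vol x)) (derive1 be (vol x) * dvol i x).
Proof.
move=> N1; have [x0|x0] := eqVneq x 0.
  have dbe0 : derive1 be (vol x) = 0.
    apply: (@derive1_vanish _ _ a) => [s sa|]; first by apply: bea; rewrite (le_lt_trans (ler_norm _)).
    by rewrite x0 vol0 normr0.
  rewrite dbe0 mul0r; apply: (near_eq_is_derive (f := cst 0)).
  have va : vol x < a by rewrite x0 vol0.
  have := @continuous_vol x => /cvgr_lt/(_ _ va).
  by apply: filterS => y ya; rewrite bea.
apply: is_derive_comp1; first exact: (C1n_is_derive _ (sbe 1)).
exact: is_derive_vol.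
Qed.

(** The field x / |x|^N is divergence free off the origin, so only the radial
    factor contributes to the divergence. *)
Definition radial_field (i : 'I_N) (x : 'rV[R]_N) : R := be (vol x) / enorm x ^+ N * x ord0 i.

Lemma test_radial_field i : test_function (radial_field i).
Proof.
have [d d0 h] := thd_near0 N.
apply: (@test_functionP _ _ _ (rad b)) => [n|x /(vol_out_box b0) bx].
  apply: CnM; last exact: Cn_coord.
  exact: (@Cn_radial R N n (thd N) d d0 h (thd_smooth N)).
by rewrite /radial_field beb// !mul0r.
Qed.

Lemma div_radial_field x :
  \sum_i partial i (radial_field i) x = C * N%:R * derive1 be (vol x).
Proof.
have [d d0 h] := thd_near0 N.
have D i : partial i (radial_field i) x =
    thd N (enorm x) + x ord0 i * (derive1 (thd N) (enorm x) / enorm x * x ord0 i).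
  have D1 := is_derive_radial i x d0 h (thd_smooth N 1).
  have D2 := is_deriveM D1 (is_derive_coord i i x).
  by rewrite (partial_eq D2) /GRing.scale/= eqxx mulr1.
under eq_bigr do rewrite D.
rewrite big_split/= sumr_const card_ord -[_ *+ N]mulr_natl.
have [x0|x0] := eqVneq x 0.
  rewrite x0 enorm_0 vol0 h ?normr0// mulr0 add0r big1; last by move=> j _; rewrite mxE mul0r.
  rewrite (_ : derive1 be 0 = 0) ?mulr0//.
  apply: (@derive1_vanish _ _ a) => [s sa|]; last by rewrite normr0.
  by apply: bea; rewrite (le_lt_trans (ler_norm _)).
have e0 := enorm_gt0 x0; set r := enorm x.
have r0 : r != 0 by rewrite gt_eqF.
have -> : \sum_j x ord0 j * (derive1 (thd N) r / r * x ord0 j) = derive1 (thd N) r * r.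
  under eq_bigr => j _ do rewrite mulrCA.
  rewrite -mulr_sumr -/(dot x x) -enorm_sqr -/r; by field.
have -> : derive1 (thd N) r = (derive1 be (C * r ^+ N) * (C * (N%:R * r ^+ N.-1))) / r ^+ N
   - be (C * r ^+ N) * N%:R * r ^+ N.-1 / (r ^+ N) ^+ 2.
  have dth : is_derive r 1 th (derive1 be (C * r ^+ N) * (C * (N%:R * r ^+ N.-1))).
    exact: (@is_derive1_comp _ be (fun r => C * r ^+ N) r _ _ (C1n_is_derive _ (sbe 1)) (is_derive_volr r)).
  have dX : is_derive r 1 (fun r : R => r ^+ N) (N%:R * r ^+ N.-1).
    have D0 := is_derive_volr r.
    have D1 := is_deriveZ C^-1 D0.
    have -> : (fun r : R => r ^+ N) = C^-1 \*: (fun r => C * r ^+ N).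
      apply/funext => t; rewrite -[RHS]/(C^-1 * (C * t ^+ N)) mulKf// gt_eqF//.
    by apply: (is_derive_eq D1); rewrite /GRing.scale/= mulKf// gt_eqF.
  have rN0 : r ^+ N != 0 by rewrite expf_neq0.
  have D1 := is_deriveM dth (@is_deriveV _ (fun r : R => r ^+ N) r _ 1 rN0 dX).
  have -> : derive1 (thd N) r = _ := (is_derive1_eq D1).2.
  rewrite /GRing.scale/= /th; by field.
rewrite /thd /th /vol -/r.
have rE : r ^+ N = r * r ^+ N.-1 by rewrite -[in LHS](prednK N0) exprS.
have : r ^+ N.-1 != 0 by rewrite expf_neq0.
rewrite rE; set y := r ^+ N.-1 => y0; field; by rewrite y0 r0.
Qed.

End test_functions.

End radial.

(** * The flux of the weak gradient through shells *)

Section shells.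
Context {R : realType} {N : nat} (N0 : (0 < N)%N).
Notation lam := (lebesgue_rV (R := R) N).
Notation leb := (@lebesgue_measure R).
Notation ei i := (delta_mx ord0 i : 'rV[R]_N).

Definition shell (a b : R) : set 'rV[R]_N := @vol R N @^-1` `[a, b].

Lemma measurable_shell a b : measurable (shell a b).
Proof. exact: measurable_preimage_vol. Qed.

Lemma shell_fin a b : (lam (shell a b) < +oo)%E.
Proof.
rewrite /shell lebesgue_vol//.
apply: (@le_lt_trans _ _ (leb `[a, b])).
  by rewrite le_measure ?inE//; apply: measurableI => //; exact: measurable_itv.
by rewrite lebesgue_measure_itv/=; case: ifP => _; rewrite ?ltry.
Qed.

Lemma integral_volT (F : R -> R) : measurable_fun setT F -> (forall s, s < 0 -> F s = 0) ->
  (\int[lam]_x (F (vol x))%:E = \int[leb]_s (F s)%:E)%E.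
Proof.
move=> mF F0.
have D0 : (`[0%R, +oo[ : set R) `<=` `[0, +oo[ by [].
have mF' : measurable_fun (`[0%R, +oo[ : set R) (EFin \o F).
  by apply: measurable_funTS; apply/measurable_EFinP.
have := @integral_vol R N N0 _ _ (measurable_itv `[0%R, +oo[) D0 mF'.
rewrite (_ : @vol R N @^-1` _ = setT); last first.
  by apply/seteqP; split => // x _ /=; rewrite in_itv/= andbT vol_ge0.
move=> ->; rewrite integral_mkcond; apply: eq_integral => s _; rewrite patchE.
case: ifPn => // sn; rewrite F0//.
by move: sn; rewrite notin_setE/= in_itv/= andbT => /negP; rewrite ltNge.
Qed.

Lemma integrable_volT (F : R -> R) : leb.-integrable setT (EFin \o F) ->
  lam.-integrable setT (EFin \o (fun x => F (vol x))).
Proof.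
move=> iF.
have D0 : (`[0%R, +oo[ : set R) `<=` `[0, +oo[ by [].
have iF' : leb.-integrable `[0%R, +oo[ (EFin \o F).
  by apply: integrableS iF.
have := @integrable_vol R N N0 _ _ (measurable_itv `[0%R, +oo[) D0 iF'.
rewrite (_ : @vol R N @^-1` _ = setT)//.
by apply/seteqP; split => // x _ /=; rewrite in_itv/= andbT vol_ge0.
Qed.

(** On a set of finite measure, |f| <= 1 + |f|^p is enough. *)
Lemma Lfun_locally_integrable (p : R) (f : 'rV[R]_N -> R) (S : set 'rV[R]_N) : 1 <= p ->
  measurable S -> (lam S < +oo)%E -> f \in Lfun lam p%:E ->
  lam.-integrable setT (EFin \o (fun x => f x * \1_S x)).
Proof.
move=> p1 mS Soo fL; have ifp := Lfun_integrable p1 fL.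
have mf : measurable_fun setT f.
  by move: fL; rewrite inE => /andP[]; rewrite inE.
have i1S : lam.-integrable setT (EFin \o (\1_S : 'rV[R]_N -> R)).
  apply: (@bounded_support_integrable _ _ _ lam _ S 1) => // [x Sx|x Sx].
    by rewrite indicE mem_set// normr1.
  by rewrite indicE memNset.
apply: (@le_integrable _ _ _ lam setT measurableT _
  (fun x => (EFin \o (\1_S : 'rV[R]_N -> R)) x + (`|f x| `^ p)%:E)%E).
- by apply/measurable_EFinP; apply: measurable_funM => //; exact: measurable_indic.
- move=> x _ /=; rewrite lee_fin normrM indicE.
  have h : 0 <= `|f x| `^ p by exact: powR_ge0.
  case: (x \in S); rewrite ?normr1 ?mulr1 ?normr0 ?mulr0// [leRHS]ger0_norm ?addr_ge0//.
  have [f1|f1] := leP `|f x| 1; first by rewrite (le_trans f1)// lerDl.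
  by rewrite (@le_trans _ _ (`|f x| `^ p)) ?lerDr// le1r_powR// ltW.
- exact: integrableD.
Qed.

Lemma partial_out_shell (phi : 'rV[R]_N -> R) (a b : R) i x : (forall x, ~ shell a b x -> phi x = 0) ->
  ~ shell a b x -> partial i phi x = 0.
Proof.
move=> phi0 xab; apply: partial_eq; apply: (near_eq_is_derive (f := cst 0)).
suff : \forall y \near x, ~ shell a b y by apply: filterS => y /phi0 ->.
have [va|va] := ltP (vol x) a.
  have := @continuous_vol R N x => /cvgr_lt/(_ _ va); apply: filterS => y ya.
  by rewrite /shell/= in_itv/= leNgt ya.
have bv : b < vol x.
  by rewrite ltNge; apply/negP => vb; apply: xab; rewrite /shell/= in_itv/= va.
have := @continuous_vol R N x => /cvgr_gt/(_ _ bv); apply: filterS => y ya.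
by rewrite /shell/= in_itv/= => /andP[_]; rewrite leNgt ya.
Qed.

Lemma test_bounded (phi : 'rV[R]_N -> R) : test_function phi ->
  exists2 M, 0 <= M & forall x, `|phi x| <= M.
Proof.
move=> [/(_ 0%N) /Cn_continuous cphi cK].
have [M M0 hM] := continuous_bounded_on cK (fun x => cphi x).
exists M => // x; have [px|px] := eqVneq (phi x) 0; first by rewrite px normr0.
by apply: hM; exact: subset_closure.
Qed.

Lemma test_partial_bounded (phi : 'rV[R]_N -> R) (a b : R) i : test_function phi ->
  (forall x, ~ shell a b x -> phi x = 0) ->
  [/\ continuous (partial i phi), exists2 M, 0 <= M & forall x, `|partial i phi x| <= M &
      forall x, ~ shell a b x -> partial i phi x = 0].
Proof.
move=> [Cphi cK] phi0.
have cd : continuous (partial i phi) by move=> x; exact: (Cn_continuous (Cn_partial i (Cphi 1%N))).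
have d0 x := @partial_out_shell phi a b i x phi0.
split => //.
have [M M0 hM] := continuous_bounded_on cK cd.
exists M => // x; have [px|px] := pselect (closure [set x | phi x != 0] x); first exact: hM.
rewrite (_ : partial i phi x = 0) ?normr0//.
apply: partial_eq; apply: (near_eq_is_derive (f := cst 0)).
have : open (~` closure [set x | phi x != 0]) by exact/closed_openC/closed_closure.
move=> /(_ x px); apply: filterS => y /= yc.
apply/esym/eqP/negPn/negP => py; apply: yc; exact: (@subset_closure _ _ y py).
Qed.

End shells.

Section flux.
Context {R : realType} {N : nat} (N0 : (0 < N)%N).
Notation lam := (lebesgue_rV (R := R) N).
Notation leb := (@lebesgue_measure R).
Notation C := (@ball_volume R N).
Variables (p : R) (u : 'rV[R]_N -> R) (g : 'rV[R]_N -> 'rV[R]_N) (V : R -> R).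
Hypotheses (p1 : 1 <= p) (hu : sobolev_with_gradient p u g).
Hypothesis uV : forall x, x != 0 -> u x = V (vol x).
Hypothesis cV : forall s, 0 < s -> {for s, continuous V}.

(** Since grad vol = C N |x|^(N-2) x, this is the derivative of u with respect
    to the volume along the radial direction. *)
Definition flux (x : 'rV[R]_N) : R := dot (g x) x / (C * N%:R * enorm x ^+ N).

Let C0 : 0 < C. Proof. exact: ball_volume_gt0. Qed.
Let CN0 : C * N%:R != 0. Proof. by rewrite mulf_neq0// ?gt_eqF// ltr0n. Qed.

Lemma integrable_u_shell a b : lam.-integrable setT (EFin \o (fun x => u x * \1_(@shell R N a b) x)).
Proof.
have [uL _ _] := hu.
by apply: (Lfun_locally_integrable p1) => //; [exact: measurable_shell|exact: shell_fin].
Qed.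

Lemma integrable_g_shell i a b : lam.-integrable setT (EFin \o (fun x => g x ord0 i * \1_(@shell R N a b) x)).
Proof.
have [_ gL _] := hu.
by apply: (Lfun_locally_integrable p1) => //; [exact: measurable_shell|exact: shell_fin].
Qed.

Lemma integrable_mul_shell (f h : 'rV[R]_N -> R) a b :
  lam.-integrable setT (EFin \o (fun x => f x * \1_(@shell R N a b) x)) ->
  continuous h -> (exists2 M, 0 <= M & forall x, `|h x| <= M) ->
  (forall x, ~ shell a b x -> h x = 0) ->
  lam.-integrable setT (EFin \o (fun x => f x * h x)).
Proof.
move=> fi ch [M _ hM] h0.
have := integrable_mul_bounded fi (continuous_measurable_rV ch) hM.
rewrite (_ : (fun x => f x * \1_(shell a b) x * h x) = (fun x => f x * h x))//.
apply/funext => x; rewrite indicE; have [xs|xs] := pselect (shell a b x).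
  by rewrite mem_set// mulr1.
by rewrite memNset// h0// !mulr0.
Qed.

Lemma integrable_profile a b : 0 < a -> leb.-integrable setT (EFin \o (V \* \1_`[a, b])).
Proof.
move=> a0.
have : leb.-integrable `[a, b] (EFin \o V).
  apply: continuous_compact_integrable; first exact: segment_compact.
  apply: continuous_in_subspaceT => s; rewrite inE/= in_itv/= => /andP[sa _].
  exact/cV/(lt_le_trans a0 sa).
have mI : measurable (`[a, b]%classic : set (measurableTypeR R)) by exact: measurable_itv.
move=> h; have := (@integrable_mkcond _ (measurableTypeR R) R leb _ (EFin \o V) mI).1 h.
rewrite (_ : (EFin \o V) \_ _ = EFin \o (V \* \1_`[a, b]))//.
apply/funext => s; rewrite patchE/= indicE; case: ifPn => _; rewrite ?mulr1 ?mulr0//.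
Qed.

Lemma measurable_profile a b : 0 < a -> measurable_fun setT (V \* \1_`[a, b]).
Proof.
move=> a0; have h := measurable_int leb (integrable_profile b a0).
by move/measurable_EFinP : h.
Qed.

Lemma integrable_flux a b : 0 < a -> lam.-integrable setT (EFin \o (fun x => flux x * \1_(shell a b) x)).
Proof.
move=> a0; have [ba|ab] := ltP b a.
  rewrite (_ : EFin \o _ = cst 0%E); first exact: integrable0.
  apply/funext => x /=; rewrite indicE memNset ?mulr0// /shell/= in_itv/= => /andP[h1 h2].
  by have := lt_le_trans ba (le_trans h1 h2); rewrite ltxx.
pose k := Num.truncn (a / 2)^-1; pose be := plateau k a b.
have a20 : 0 < a / 2 by rewrite divr_gt0.
have ka : k.+1%:R^-1 <= a / 2 by rewrite invf_ple ?posrE// ltW// truncnS_gt.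
have b'0 : 0 <= b + 1 by rewrite addr_ge0// (le_trans (ltW a0)).
have bea s : s < a / 2 -> be s = 0.
  by move=> sa; rewrite /be plateau_left// lerBrDr (le_trans (lerD (ltW sa) ka))// -splitr.
have beb s : b + 1 < s -> be s = 0.
  move=> sb; rewrite /be plateau_right// (le_trans _ (ltW sb))// lerD2l.
  by rewrite invf_le1// ler1n.
have sbe : smooth1 be by exact: plateau_smooth.
have tf i := test_radial_field N0 a20 b'0 sbe bea beb i.
have ig i : lam.-integrable setT
    (EFin \o (fun x => (g x ord0 i * \1_(shell a b) x) * radial_field be i x)).
  have [M _ hM] := test_bounded (tf i); apply: integrable_mul_bounded (integrable_g_shell i a b) _ hM.
  by apply: continuous_measurable_rV => x; have [/(_ 0%N) Cf _] := tf i; exact: (Cn_continuous Cf).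
have [S1 _] := Rintegral_sum ig.
have := integrableZl measurableT (C * N%:R)^-1 S1.
rewrite (_ : (fun x => _) = EFin \o (fun x => flux x * \1_(shell a b) x))//.
apply/funext => x /=; rewrite -EFinM; congr EFin; rewrite indicE.
have [xs|xs] := pselect (shell a b x); last first.
  by rewrite memNset// mulr0 big1 ?mulr0// => i _; rewrite mulr0 mul0r.
rewrite mem_set//= mulr1 /flux /dot mulr_sumr mulr_suml.
apply: eq_bigr => i _; rewrite /radial_field /be plateau_in.
  by rewrite mulr1 mul1r [in RHS]invfM; set c := (C * _)^-1; set d := (_ ^+ _)^-1; ring.
by move: xs; rewrite /shell/= in_itv.
Qed.

(** The defining identity of the weak gradient, tested with the field
    x / |x|^N cut off by a plateau in the volume variable. *)
Lemma flux_plateau k a b : 0 < a -> a <= b -> k.+1%:R^-1 <= a / 2 -> k.+1%:R^-1 <= 1 :> R ->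
  \int[leb]_s (V s * \1_`[a / 2, b + 1] s * derive1 (plateau k a b) s) =
  - \int[lam]_x (flux x * plateau k a b (vol x)).
Proof.
move=> a0 ab ka k1; set be := plateau k a b; set a' := a / 2; set b' := b + 1.
have a'0 : 0 < a' by rewrite divr_gt0.
have b'0 : 0 <= b' by rewrite addr_ge0// (le_trans (ltW a0)).
have bea s : s < a' -> be s = 0.
  by move=> sa; rewrite /be plateau_left// lerBrDr (le_trans (lerD (ltW sa) ka))// /a' -splitr.
have beb s : b' < s -> be s = 0.
  by move=> sb; rewrite /be plateau_right// (le_trans _ (ltW sb))// lerD2l.
have sbe : smooth1 be by exact: plateau_smooth.
have tf i := test_radial_field N0 a'0 b'0 sbe bea beb i.
have f0 i (x : 'rV[R]_N) : ~ shell a' b' x -> radial_field be i x = 0.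
  rewrite /shell/= in_itv/= /radial_field => h; have [va|va] := ltP (vol x) a'; first by rewrite bea// !mul0r.
  rewrite beb ?mul0r// ltNge; apply/negP => vb; apply: h; by rewrite va.
have tb i := test_partial_bounded i (tf i) (f0 i).
have [_ _ wg] := hu.
have E1 i := wg i _ (tf i).
have iu i : lam.-integrable setT (EFin \o (fun x => u x * partial i (radial_field be i) x)).
  by have [h1 h2 h3] := tb i; apply: (integrable_mul_shell (integrable_u_shell a' b')).
have ig i : lam.-integrable setT (EFin \o (fun x => g x ord0 i * radial_field be i x)).
  apply: (integrable_mul_shell (integrable_g_shell i a' b')); [|exact: test_bounded|exact: f0].
  by move=> x; have [/(_ 0%N) Cf _] := tf i; exact: (Cn_continuous Cf).
have [_ S1] := Rintegral_sum iu; have [_ S2] := Rintegral_sum ig.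
have {E1} : \int[lam]_x (C * N%:R * (V (vol x) * \1_`[a', b'] (vol x) * derive1 be (vol x))) =
    - \int[lam]_x (C * N%:R * (flux x * be (vol x))).
  transitivity (\int[lam]_x (\sum_i u x * partial i (radial_field be i) x)).
    apply: eq_Rintegral => x _; rewrite -mulr_sumr (div_radial_field N0 a'0 sbe bea).
    have [xs|xs] := pselect (shell a' b' x).
      rewrite indicE mem_set// mulr1 uV; first by ring.
      apply: vol_gt0_neq0 => //; move: xs; rewrite /shell/= in_itv/= => /andP[+ _].
      exact: lt_le_trans.
    have be0 : derive1 be (vol x) = 0.
      apply: (proj2 (is_derive1_eq (d := 0) _)).
      apply: (near_eq_is_derive (f := cst 0)).
      have [va|va] := ltP (vol x) a'.
        by near=> s; rewrite bea//; near: s; exact: lt_nbhsl.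
      have vb : b' < vol x.
        by rewrite ltNge; apply/negP => vb; apply: xs; rewrite /shell/= in_itv/= va.
      by near=> s; rewrite beb//; near: s; exact: lt_nbhsr.
    by rewrite be0 !mulr0.
  transitivity (- \int[lam]_x (\sum_i g x ord0 i * radial_field be i x)).
    by rewrite S1 S2 -sumrN; apply: eq_bigr => i _.
  congr (- _); apply: eq_Rintegral => x _; rewrite /radial_field /flux /dot.
  under eq_bigr => i _ do rewrite mulrCA.
  rewrite -mulr_sumr.
  have [->|x0] := eqVneq x 0.
    by rewrite vol0// bea// mul0r !mulr0 mul0r.
  have e0 : enorm x ^+ N != 0 by rewrite expf_neq0// gt_eqF// enorm_gt0.
  move: CN0; rewrite mulf_eq0 negb_or => /andP[c0 n0]; by field; rewrite c0 n0 e0.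
have mV : measurable_fun setT (V \* \1_`[a', b']) := measurable_profile b' a'0.
have cdbe : continuous (derive1 be) by have [_ [_ []]] := sbe 1%N.
have mF : measurable_fun setT (fun s => V s * \1_`[a', b'] s * derive1 be s).
  by apply: measurable_funM => //; exact: continuous_measurable_R.
have dbe_bd : exists2 M, 0 <= M & forall s, `|derive1 be s| <= M.
  have [M hM] := @dstep_bounded R.
  have M0 : 0 <= M := le_trans (dstep_ge0 0) (hM 0).
  exists (k.+1%:R * M + k.+1%:R * M) => [|s]; first by rewrite addr_ge0 ?mulr_ge0.
  have [_ ->] := is_derive1_eq (is_derive_plateau k a b s).
  rewrite (le_trans (ler_normB _ _))// lerD// ger0_norm ?mulr_ge0 ?dstep_ge0//;
  by rewrite ler_wpM2l.
have [M M0 hM] := dbe_bd.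
have iF : leb.-integrable setT (EFin \o (fun s => V s * \1_`[a', b'] s * derive1 be s)).
  exact: (integrable_mul_bounded (integrable_profile b' a'0) (continuous_measurable_R cdbe) hM).
have iFv := integrable_volT N0 iF.
have ifl : lam.-integrable setT (EFin \o (fun x => flux x * be (vol x))).
  apply: (integrable_mul_shell (integrable_flux b' a'0)).
  - move=> x; apply: (@continuous_comp _ _ _ (@vol R N) be); first exact: continuous_vol.
    exact: (C1n_continuous (sbe 0%N)).
  - by exists 1 => // x; rewrite ger0_norm ?plateau_ge0// plateau_le1.
  - move=> x; rewrite /shell/= in_itv/= => h; have [va|va] := ltP (vol x) a'; first by rewrite bea.
    by rewrite beb// ltNge; apply/negP => vb; apply: h; rewrite va.
rewrite RintegralZl// RintegralZl// -mulrN => /(mulfI CN0).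
rewrite /Rintegral (integral_volT N0 mF)// => s s0.
by rewrite indicE memNset ?mulr0 ?mul0r//= in_itv/= leNgt (lt_trans s0 a'0).
Unshelve. all: by end_near. Qed.

(** The limit of flux_plateau as the plateaus converge to the indicator of
    [a, b]; every point is a Lebesgue point of the continuous profile. *)
Lemma flux_identity a b : 0 < a -> a <= b ->
  V b - V a = \int[lam]_x (flux x * \1_(shell a b) x).
Proof.
move=> a0 ab.
have a20 : 0 < a / 2 by rewrite divr_gt0.
have [k0 k0P] : exists k0, forall n, ((n + k0).+1%:R^-1 : R) <= Num.min (a / 2) 1.
  pose e := Num.min (a / 2) 1.
  have e0 : 0 < e by rewrite lt_min a20 ltr01.
  exists (Num.truncn e^-1) => n; rewrite invf_ple ?posrE//.
  rewrite (le_trans (ltW (truncnS_gt _)))// ler_nat ltnS leq_addl//.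
have k0a n : ((n + k0).+1%:R^-1 : R) <= a / 2 by have := k0P n; rewrite le_min => /andP[].
have k01 n : ((n + k0).+1%:R^-1 : R) <= 1 by have := k0P n; rewrite le_min => /andP[].
have i1 := integrable_profile (b + 1) a20.
pose V1 := V \* \1_`[a / 2, b + 1].
have inU s : a <= s <= b -> lebesgue_pt V1 s /\ V1 s = V s.
  move=> /andP[sa sb]; have s0 : 0 < s by exact: lt_le_trans sa.
  have V1s t : a / 2 <= t <= b + 1 -> V1 t = V t.
    by move=> ht; rewrite /V1/= indicE mem_set ?mulr1//= in_itv.
  have sab : a / 2 < s < b + 1.
    by rewrite (lt_le_trans _ sa) ?gtr_pMr ?invf_lt1 ?ltr1n//= (le_lt_trans sb)// ltrDl.
  split; last by rewrite V1s//; case/andP: sab => ? ?; rewrite !ltW.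
  apply: (@continuous_lebesgue_pt _ _ _ (`]a / 2, b + 1[)%classic).
  - by split; [exact: interval_open|rewrite /= in_itv].
  - exact: measurable_itv.
  - by apply: measurable_funTS; exact: measurable_profile.
  - have V1V : \forall t \near s, V t = V1 t.
      have sI : s \in `]a / 2, b + 1[ by rewrite in_itv.
      by apply: filterS (near_in_itvoo sI) => t; rewrite in_itv/= => /andP[h1 h2]; rewrite V1s// !ltW.
    have V1sE : V1 s = V s by rewrite V1s//; case/andP: sab => ? ?; rewrite !ltW.
    have h : V1 t @[t --> s] --> V s by apply: cvg_trans (cV s0); exact: near_eq_cvg.
    by rewrite -V1sE in h; exact: h.
have aab : a <= a <= b by rewrite lexx.
have bab : a <= b <= b by rewrite ab lexx.
have [lpa Va] := inU a aab; have [lpb Vb] := inU b bab.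
have cL : (\int[leb]_s (V1 s * derive1 (plateau (n + k0) a b) s)) @[n --> \oo] --> V a - V b.
  rewrite -Va -Vb.
  apply: (@cvg_comp _ _ _ (fun n => (n + k0)%N)
    (fun n => \int[leb]_s (V1 s * derive1 (plateau n a b) s)) _ _ _ (cvg_addnr k0)).
  exact: plateau_derivative_cvg.
have pl0 n (x : 'rV[R]_N) : ~ shell (a / 2) (b + 1) x -> plateau (n + k0) a b (vol x) = 0.
  rewrite /shell/= in_itv/= => h; have [va|va] := ltP (vol x) (a / 2).
    by rewrite plateau_left// lerBrDr (le_trans (lerD (ltW va) (k0a n)))// -splitr.
  rewrite plateau_right// (@le_trans _ _ (b + 1))// ?lerD2l// ltW// ltNge.
  by apply/negP => vb; apply: h; rewrite va.
have : (- \int[lam]_x (flux x * plateau (n + k0) a b (vol x))) @[n --> \oo] -->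
   - \int[lam]_x (flux x * \1_(shell a b) x).
  apply: cvgN; apply: (@dominated_cvgR _ _ _ lam _ _
    (fun x => `|flux x * \1_(shell (a / 2) (b + 1)) x|)).
  - move=> n; rewrite (_ : (fun x => _) =
      (fun x => flux x * \1_(shell (a / 2) (b + 1)) x * plateau (n + k0) a b (vol x))).
      apply: measurable_funM.
        by apply/measurable_EFinP; exact: (measurable_int lam (integrable_flux (b + 1) a20)).
      apply: continuous_measurable_rV => x.
      apply: (@continuous_comp _ _ _ (@vol R N) (plateau (n + k0) a b)); first exact: continuous_vol.
      exact: (C1n_continuous (plateau_smooth _ _ _ 0%N)).
    apply/funext => x; rewrite indicE; have [xs|xs] := pselect (shell (a / 2) (b + 1) x).
      by rewrite mem_set// mulr1.
    by rewrite memNset// pl0// !mulr0.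
  - move=> x; apply: (@cvg_comp _ _ _ (fun n => (n + k0)%N)
      (fun n => flux x * plateau n a b (vol x)) _ _ _ (cvg_addnr k0)).
    apply: cvg_near_cst; have := plateau_cvg (vol x) ab.
    by apply: filterS => n ->; rewrite !indicE.
  - by apply: integrable_norm; exact: integrable_flux.
  - move=> n x; rewrite indicE; have [xs|xs] := pselect (shell (a / 2) (b + 1) x).
      rewrite mem_set// mulr1 normrM ler_piMr//.
      by rewrite ger0_norm ?plateau_ge0// plateau_le1.
    by rewrite pl0// !mulr0 normr0.
rewrite (_ : (fun n => - _) = (fun n => \int[leb]_s (V1 s * derive1 (plateau (n + k0) a b) s))); last first.
  by apply/funext => n; rewrite -flux_plateau.
move=> cR; have := cvg_unique _ cL cR => /(_ _) h.
by apply: oppr_inj; rewrite opprB; apply: h.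
Qed.

End flux.

(** * Absolute continuity of the profile *)

Section identification.
Context {R : realType} {N : nat} (N1 : (1 < N)%N).
Notation lam := (lebesgue_rV (R := R) N).
Notation leb := (@lebesgue_measure R).
Notation C := (@ball_volume R N).
Variables (p : R) (u : 'rV[R]_N -> R) (g : 'rV[R]_N -> 'rV[R]_N) (V : R -> R).
Hypotheses (p1 : 1 <= p) (hu : sobolev_with_gradient p u g).
Hypothesis uV : forall x, x != 0 -> u x = V (vol x).
Hypothesis cV : forall s, 0 < s -> {for s, continuous V}.

Let N0 : (0 < N)%N. Proof. exact: ltnW. Qed.

(** The flux through shells is absolutely continuous with respect to volume,
    so the profile is the primitive of an integrable density. *)
Lemma flux_density (a0 b0 : R) : 0 < a0 ->
  exists2 e : R -> R, leb.-integrable setT (EFin \o e) &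
    forall s t, a0 <= s -> s <= t -> t <= b0 -> V t - V s = \int[leb]_(x in `[s, t]) e x.
Proof.
move=> a00.
have ifl := integrable_flux N0 p1 hu b0 a00.
pose nu0 := induced_charge ifl.
have mv : measurable_fun setT (@vol R N : 'rV[R]_N -> measurableTypeR R) := @measurable_vol R N.
pose nu : {charge set (measurableTypeR R) -> \bar R} :=
  measure_function_pushforward__canonical__charge_Charge nu0 mv.
have nuE A : nu A = (\int[lam]_(x in @vol R N @^-1` A) (flux g x * \1_(shell a0 b0) x)%:E)%E by [].
have dom : nu `<< leb.
  apply/null_content_dominatesP => A mA A0; rewrite nuE; apply: null_set_integral.
  - exact: measurable_preimage_vol.
  - exact: measurable_int (integrableS measurableT (measurable_preimage_vol mA) (@subsetT _ _) ifl).
  - exact: vol_null.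
pose e := fine \o Radon_Nikodym nu leb.
have eE : EFin \o e = Radon_Nikodym nu leb.
  by apply/funext => s /=; rewrite /e/= fineK// Radon_Nikodym_fin_num.
exists e; first by rewrite eE; exact: Radon_Nikodym_integrable.
move=> s t as_ st tb; have s0 : 0 < s by exact: lt_le_trans as_.
rewrite (flux_identity N0 p1 hu uV cV s0 st) /Rintegral; congr fine.
have mI : measurable (`[s, t]%classic : set (measurableTypeR R)) by exact: measurable_itv.
transitivity (nu `[s, t]%classic).
  rewrite nuE [RHS]integral_mkcond; apply: eq_integral => x _; rewrite patchE.
  rewrite !indicE; case: ifPn => [|xs].
    rewrite inE => xs; rewrite mem_set//.
    move: xs; rewrite /shell/= !in_itv/= => /andP[h1 h2].
    by rewrite (le_trans as_ h1) (le_trans h2 tb).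
  by rewrite mulr0.
rewrite (Radon_Nikodym_integral dom mI); apply: eq_integral => x _.
by rewrite -eE.
Qed.

Variables (a0 b0 : R) (e : R -> R).
Hypotheses (a00 : 0 < a0) (ab0 : a0 <= b0) (ie : leb.-integrable setT (EFin \o e)).
Hypothesis Ve : forall s t, a0 <= s -> s <= t -> t <= b0 -> V t - V s = \int[leb]_(x in `[s, t]) e x.

Lemma shell_out_box (phi : 'rV[R]_N -> R) b : 0 <= b -> (forall x, b < vol x -> phi x = 0) ->
  forall x, ~ box (const_mx (- @rad R N b)) (const_mx (@rad R N b)) x -> phi x = 0.
Proof. by move=> bge0 phi0 x /(vol_out_box N0 bge0); exact: phi0. Qed.

Lemma continuous_primitive (E : R -> R) : continuous E ->
  exists P : R -> R, forall s : R, - 1 < s -> is_derive s 1 P (E s).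
Proof.
move=> cE; exists (fun s => \int[leb]_(x in `[- 1, s]) E x) => s s1.
have iE : leb.-integrable `[- 1, s + 1] (EFin \o E).
  apply: continuous_compact_integrable; first exact: segment_compact.
  exact: continuous_subspaceT.
have [] := @continuous_FTC1_closed R E (- 1) s (s + 1) _ iE s1 (cE s); first by rewrite ltrDl.
by move=> h1 h2; apply: DeriveDef => //; rewrite -derive1E.
Qed.

(** The integrand is the partial derivative of W(vol) phi, which has compact
    support away from the origin. *)
Lemma partial_profile_integral0 (W E : R -> R) (phi : 'rV[R]_N -> R) (a b : R) i :
  0 < a -> a <= b -> continuous E ->
  (forall s : R, - 1 < s -> is_derive s 1 W (E s)) ->
  test_function phi -> (forall x, ~ shell a b x -> phi x = 0) ->
  lam.-integrable setT (EFin \o (fun x => W (vol x) * partial i phi x + E (vol x) * (dvol i x * phi x))) /\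
  \int[lam]_x (W (vol x) * partial i phi x + E (vol x) * (dvol i x * phi x)) = 0.
Proof.
move=> ag0 ab cE dW tphi phi0.
have b_ge0 : 0 <= b by rewrite (le_trans (ltW ag0)).
have [cd _ d0] := test_partial_bounded i tphi phi0.
have cphi : continuous phi by move=> x; have [/(_ 0%N) Cf _] := tphi; exact: (Cn_continuous Cf).
have out (h : 'rV[R]_N -> R) : (forall x, ~ shell a b x -> h x = 0) ->
    forall x, ~ box (const_mx (- @rad R N b)) (const_mx (@rad R N b)) x -> h x = 0.
  move=> h0; apply: (@shell_out_box _ b b_ge0) => x bx; apply: h0.
  by rewrite /shell/= in_itv/= => /andP[_]; rewrite leNgt bx.
have v1 (x : 'rV[R]_N) : -1 < vol x by rewrite (@lt_le_trans _ _ 0 _ _ _ (vol_ge0 x N0))// oppr_lt0 ltr01.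
have cW (x : 'rV[R]_N) : {for x, continuous (fun x => W (vol x))}.
  apply: (@continuous_comp _ _ _ (@vol R N) W); first exact: continuous_vol.
  exact: (is_derive_continuous (dW _ (v1 x))).
set D := fun x => _.
have D0 x : ~ shell a b x -> D x = 0.
  by move=> xs; rewrite /D phi0// d0// !mulr0 addr0.
have cD : continuous D.
  move=> x; refine (@continuousD R R^o 'rV[R]_N _ _ x _ _).
    by refine (@continuousM R 'rV[R]_N _ _ x _ _); [exact: cW|exact: cd].
  refine (@continuousM R 'rV[R]_N (fun x => E (vol x)) (fun x => dvol i x * phi x) x _ _).
    by apply: (@continuous_comp _ _ _ (@vol R N) E); [exact: continuous_vol|exact: cE].
  by refine (@continuousM R 'rV[R]_N _ _ x _ _); [exact: continuous_dvol|exact: cphi].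
have [K K0 bK] := continuous_box_bounded cD (out _ D0).
split; first exact: (box_bounded_integrable bK).
have F0 x : ~ shell a b x -> W (vol x) * phi x = 0 by move=> /phi0 ->; rewrite mulr0.
suff D_int : (\int[lam]_x (D x)%:E = 0)%E by rewrite /Rintegral D_int.
apply: (@integral_partial0 R N i (fun x => W (vol x) * phi x) D (@rad R N b)) => //; last 2 first.
  exact: out.
  exact: out.
move=> x; have [x0|x0] := eqVneq x 0.
  have xs : ~ shell a b x.
    by rewrite /shell/= in_itv/= x0 vol0// leNgt ag0.
  rewrite D0//; apply: (near_eq_is_derive (f := cst 0)).
  have va : vol x < a by rewrite x0 vol0.
  have := @continuous_vol R N x => /cvgr_lt/(_ _ va); apply: filterS => y ya.
  by rewrite F0// /shell/= in_itv/= leNgt ya.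
have dWv : is_derive x (delta_mx ord0 i) (fun y => W (vol y)) (E (vol x) * dvol i x).
  by apply: is_derive_comp1; [exact: dW|exact: is_derive_vol].
have [Cphi _] := tphi.
have dWp := is_deriveM dWv (Cn_is_derive i x (Cphi 1%N)).
by apply: (is_derive_eq dWp); rewrite /D /GRing.scale/=; ring.
Qed.

(** The chain rule for a profile that is only absolutely continuous: the
    density e is a limit in L^1 of continuous densities, whose primitives are C^1
    profiles converging uniformly to V, and for those the formula is classical. *)
Lemma weak_radial_partial (phi : 'rV[R]_N -> R) (a b : R) i : test_function phi ->
  a0 < a -> a <= b -> b < b0 -> (forall x, ~ shell a b x -> phi x = 0) ->
  \int[lam]_x (u x * partial i phi x) = - \int[lam]_x (e (vol x) * dvol i x * phi x).
Proof.
move=> tphi aa ab bb phi0.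
have a_gt0 : 0 < a by exact: lt_trans aa.
have b_ge0 : 0 <= b by rewrite (le_trans (ltW a_gt0)).
have [cd [M M0 hM] d0] := test_partial_bounded i tphi phi0.
have cphi : continuous phi by move=> x; have [/(_ 0%N) Cf _] := tphi; exact: (Cn_continuous Cf).
have out (h : 'rV[R]_N -> R) : (forall x, ~ shell a b x -> h x = 0) ->
    forall x, ~ box (const_mx (- @rad R N b)) (const_mx (@rad R N b)) x -> h x = 0.
  move=> h0; apply: (@shell_out_box _ b b_ge0) => x bx; apply: h0.
  by rewrite /shell/= in_itv/= => /andP[_]; rewrite leNgt bx.
pose w x := dvol i x * phi x.
have cw : continuous w by move=> x; apply: continuousM; [exact: continuous_dvol|exact: cphi].
have w0 x : ~ shell a b x -> w x = 0 by move=> /phi0 h; rewrite /w h mulr0.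
have [K K0 [_ hK _]] := continuous_box_bounded cw (out _ w0).
have iu : lam.-integrable setT (EFin \o (fun x => u x * partial i phi x)).
  apply: (integrable_mul_shell (integrable_u_shell N0 p1 hu a b)) => //; by exists M.
have iew : lam.-integrable setT (EFin \o (fun x => e (vol x) * w x)).
  exact: (integrable_mul_bounded (integrable_volT N0 ie) (continuous_measurable_rV cw) hK).
have -> : \int[lam]_x (e (vol x) * dvol i x * phi x) = \int[lam]_x (e (vol x) * w x).
  by apply: eq_Rintegral => x _; rewrite /w mulrA.
apply/eqP; rewrite -addr_eq0 -RintegralD//; set X := Rintegral _ _ _.
pose Q := M * fine (lam (shell a b)) + K.
have Q0 : 0 <= Q by rewrite addr_ge0// mulr_ge0// fine_ge0.
have mI : measurable (`[a0, b0]%classic : set (measurableTypeR R)) by exact: measurable_itv.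
have ieI : leb.-integrable `[a0, b0] (EFin \o e).
  exact: (integrableS measurableT mI (@subsetT _ _) ie).
(* The density is only integrable, so the classical chain rule is applied to continuous approximations. *)
have [|E [cE iE limE]] := approximation_continuous_integrable mI _ ieI.
  by have := lebesgue_measure_itv `[a0, b0] => /= ->; case: ifP => _; rewrite ?ltry.
suff bound n : (`|X|%:E <= Q%:E * \int[leb]_(z in `[a0, b0]) `|(e z - E n z)%:E|)%E.
  rewrite -normr_eq0 eq_le normr_ge0 andbT -lee_fin.
  have lim0 : (Q%:E * \int[leb]_(z in `[a0, b0]) `|(e z - E n z)%:E|)%E @[n --> \oo] --> 0%E.
    by rewrite -[X in _ --> X](mule0 Q%:E); apply: cvgeZl.
  have ev : \forall n \near \oo, (`|X|%:E <= Q%:E * \int[leb]_(z in `[a0, b0]) `|(e z - E n z)%:E|)%E.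
    by apply: nearW => n; exact: bound.
  exact: (cvge_ge ev lim0).
have [P dP] := continuous_primitive (cE n).
(* Normalised to agree with V at a0, so that the distance to V is at most the L^1 error. *)
pose W s := V a0 + (P s - P a0).
have dW (s : R) : - 1 < s -> is_derive s 1 W (E n s).
  move=> s1; have D1 := dP s s1.
  have D := is_deriveD (is_derive_cst (V a0) s 1) (is_deriveB D1 (is_derive_cst (P a0) s 1)).
  by apply: (is_derive_eq D); rewrite subr0 add0r.
have [iD D0] := partial_profile_integral0 i a_gt0 ab (cE n) dW tphi phi0.
pose h s := `|e s - E n s|.
have ih : leb.-integrable `[a0, b0] (EFin \o h).
  by have := integrable_abse (integrableB mI ieI (iE n)).
have h0 : 0 <= \int[leb]_(z in `[a0, b0]) h z by apply: Rintegral_ge0 => z _; exact: normr_ge0.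
set dl := \int[leb]_(z in `[a0, b0]) h z in h0.
have dlE : (\int[leb]_(z in `[a0, b0]) `|(e z - E n z)%:E| = dl%:E)%E.
  by rewrite /dl /Rintegral fineK//; exact: integrable_fin_num.
rewrite dlE -EFinM lee_fin.
have WV s : a0 <= s <= b0 -> `|V s - W s| <= dl.
  move=> /andP[as_ sb].
  have mJ : measurable (`[a0, s]%classic : set (measurableTypeR R)) by exact: measurable_itv.
  have sJ : `[a0, s]%classic `<=` (`[a0, b0]%classic : set R).
    by move=> z /=; rewrite !in_itv/= => /andP[-> /le_trans]; exact.
  have ieJ := integrableS mI mJ sJ ieI; have iEJ := integrableS mI mJ sJ (iE n).
  have -> : V s - W s = \int[leb]_(z in `[a0, s]) (e z - E n z).
    have FT : (\int[leb]_(z in `[a0, s]) (E n z)%:E = (P s - P a0)%:E)%E.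
      apply: FTC2 => //; last exact: continuous_subspaceT (cE n).
      move=> z /andP[az _]; apply: dP; apply: lt_le_trans az.
      by rewrite (lt_trans _ a00)// oppr_lt0.
    rewrite RintegralB// -Ve// /Rintegral FT/=.
    by rewrite /W opprD addrA.
  apply: (le_trans (le_normr_Rintegral mJ _)); first exact: (integrableB mJ ieJ iEJ).
  rewrite -lee_fin /dl /Rintegral !fineK; last 2 first.
  - exact: integrable_fin_num.
  - by apply: integrable_fin_num => //; exact: integrableS mI mJ sJ ih.
  by apply: ge0_subset_integral => //; exact: measurable_int ih.
pose hI := h \* \1_`[a0, b0].
have ihI : leb.-integrable setT (EFin \o hI).
  exact: integrable_cut.
have ihv := integrable_volT N0 ihI.
have inS : lam.-integrable setT (EFin \o (\1_(@shell R N a b) : _ -> R)).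
  apply: (bounded_support_integrable (M := 1) (@measurable_shell R N a b) (@shell_fin R N N0 a b)) => [|x _|x xs].
  - exact: measurable_indic (measurable_shell a b).
  - by rewrite indicE; case: (_ \in _); rewrite ?normr1 ?normr0.
  - by rewrite indicE memNset.
have bnd x : `|u x * partial i phi x + e (vol x) * w x -
    (W (vol x) * partial i phi x + E n (vol x) * (dvol i x * phi x))| <=
    dl * M * \1_(@shell R N a b) x + K * hI (vol x).
  have [xs|xs] := pselect (shell a b x); last first.
    rewrite indicE memNset// d0// w0// /w phi0// !mulr0 !addr0 subrr normr0 add0r.
    by rewrite mulr_ge0// /hI mulr_ge0// ?normr_ge0// indicE ler0n.
  rewrite indicE mem_set// mulr1.
  have vx : a0 <= vol x <= b0.
    by move: xs; rewrite /shell/= in_itv/= => /andP[h1 h2]; rewrite (le_trans (ltW aa) h1) (le_trans h2 (ltW bb)).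
  have x0 : x != 0 by apply: (vol_gt0_neq0 N0); move/andP: vx => [vx _]; exact: (lt_le_trans a00 vx).
  rewrite uV// -[dvol i x * phi x]/(w x).
  have -> : V (vol x) * partial i phi x + e (vol x) * w x -
    (W (vol x) * partial i phi x + E n (vol x) * w x) =
    (V (vol x) - W (vol x)) * partial i phi x + (e (vol x) - E n (vol x)) * w x by ring.
  apply: (le_trans (ler_normD _ _)).
  rewrite (normrM (V _ - _)) (normrM (e _ - _)); apply: lerD.
    by apply: ler_pM => //; exact: WV.
  rewrite mulrC; apply: ler_pM => //.
  by rewrite /hI/= indicE mem_set ?mulr1//= in_itv.
have iX := integrableD measurableT iu iew.
have -> : X = \int[lam]_x (u x * partial i phi x + e (vol x) * w x -
    (W (vol x) * partial i phi x + E n (vol x) * (dvol i x * phi x))).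
  by rewrite RintegralB// D0 subr0.
have iXD := integrableB measurableT iX iD.
have i1 := integrableZl measurableT (dl * M) inS.
have i2 := integrableZl measurableT K ihv.
apply: (le_trans (le_normr_Rintegral measurableT iXD)).
apply: (le_trans (le_Rintegral measurableT (integrable_abse iXD) (integrableD measurableT i1 i2) (fun x _ => bnd x))).
rewrite RintegralD// !RintegralZl//.
have -> : \int[lam]_x \1_(@shell R N a b) x = fine (lam (shell a b)).
  by rewrite /Rintegral integral_indic ?setIT//; exact: measurable_shell.
have -> : \int[lam]_x hI (vol x) = dl.
  rewrite /Rintegral integral_volT//.
  - by rewrite /dl /Rintegral integral_cut.
  - by have /measurable_int/measurable_EFinP := ihI.
  - move=> s s0; rewrite /hI/= indicE memNset ?mulr0//= in_itv/= leNgt.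
    by rewrite (lt_trans s0 a00).
have -> : Q * dl = dl * M * fine (lam (shell a b)) + K * dl by rewrite /Q; ring.
exact: lexx.
Qed.

End identification.

(** * The weak form in the volume variable *)

Section reduction.
Context {R : realType} {N : nat} (N1 : (1 < N)%N).
Notation lam := (lebesgue_rV (R := R) N).
Notation leb := (@lebesgue_measure R).
Notation C := (@ball_volume R N).
Notation rad := (@rad R N).

Let N0 : (0 < N)%N. Proof. exact: ltnW. Qed.

(** The factor h may be singular at 0, but there the cutoff vanishes. *)
Lemma mul_cutoff_continuous (h be : R -> R) (a : R) : 0 < a ->
  (forall s, 0 < s -> {for s, continuous h}) -> continuous be ->
  (forall s, s < a -> be s = 0) -> continuous (fun s => h s * be s).
Proof.
move=> a0 ch cbe bea s; have [s0|s0] := ltP 0 s.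
  by apply: continuousM; [exact: ch|exact: cbe].
have sa : s < a by exact: le_lt_trans a0.
apply: (is_derive_continuous (f := cst 0)); apply: (near_eq_is_derive (f := cst 0)).
have : \forall t \near s, t < a by exact: cvgr_lt (@cvg_id _ _) _ _.
by apply: filterS => t ta; rewrite bea// mulr0.
Qed.

Lemma cutoff_integrable (h be : R -> R) (a b : R) : 0 < a ->
  (forall s, 0 < s -> {for s, continuous h}) -> continuous be ->
  (forall s, s < a -> be s = 0) -> (forall s, b < s -> be s = 0) ->
  leb.-integrable setT (EFin \o (fun s => h s * be s)).
Proof.
move=> a0 ch cbe bea beb.
have c := mul_cutoff_continuous a0 ch cbe bea.
have mI : measurable (`[a, b]%classic : set (measurableTypeR R)) by exact: measurable_itv.
have i : leb.-integrable `[a, b] (EFin \o (fun s => h s * be s)).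
  by apply: continuous_compact_integrable; [exact: segment_compact|exact: continuous_subspaceT].
have := (@integrable_mkcond _ (measurableTypeR R) R leb _ _ mI).1 i.
apply: eq_integrable => // s _; rewrite patchE; case: ifPn => //=.
rewrite notin_setE/= in_itv/= => /negP; rewrite negb_and -!ltNge => /orP[/bea|/beb] ->;
  by rewrite mulr0.
Qed.

Lemma integrable_vol_inv (F : R -> R) : measurable_fun setT F -> (forall s, s < 0 -> F s = 0) ->
  lam.-integrable setT (EFin \o (fun x => F (vol x))) -> leb.-integrable setT (EFin \o F).
Proof.
move=> mF F0 /integrableP[_ iF]; apply/integrableP; split; first exact/measurable_EFinP.
have mN : measurable_fun setT (fun s => `|F s|) by exact: measurableT_comp.
have := integral_volT N0 mN; rewrite /= => H.
apply: le_lt_trans iF; rewrite -H//.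
by move=> s s0; rewrite F0// normr0.
Qed.

Variables (u : 'rV[R]_N -> R) (V : R -> R).
Hypothesis uV : forall x, x != 0 -> u x = V (vol x).
Hypothesis cV : forall s, 0 < s -> {for s, continuous V}.
Variables (a0 b0 : R) (e : R -> R).
Hypotheses (a00 : 0 < a0) (ab0 : a0 <= b0) (ie : leb.-integrable setT (EFin \o e)).
Hypothesis Ve : forall s t, a0 <= s -> s <= t -> t <= b0 -> V t - V s = \int[leb]_(x in `[s, t]) e x.
Variables (p : R) (g : 'rV[R]_N -> 'rV[R]_N).
Hypotheses (p1 : 1 <= p) (hu : sobolev_with_gradient p u g).

Section cutoff.
Variables (be : R -> R) (a b : R).
Hypotheses (aa : a0 < a) (ab : a <= b) (bb : b < b0) (sbe : smooth1 be).
Hypotheses (bea : forall s, s < a -> be s = 0) (beb : forall s, b < s -> be s = 0).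

Let ap : 0 < a. Proof. exact: lt_trans aa. Qed.
Let bp : 0 <= b. Proof. by rewrite (le_trans (ltW ap)). Qed.

Lemma cutoff_vol_out (x : 'rV[R]_N) : ~ shell a b x -> be (vol x) = 0.
Proof.
rewrite /shell/= in_itv/= => /negP; rewrite negb_and -!ltNge => /orP[/bea|/beb] //.
Qed.

(** Both sides have the same integral against every smooth function cut off
    to a shell, by the definition of the weak gradient and the chain rule. *)
Lemma gradient_radial i :
  {ae lam, forall x, g x ord0 i * be (vol x) = e (vol x) * dvol i x * be (vol x)}.
Proof.
have T := test_radial N0 ap bp sbe bea beb.
have cbe : continuous (fun x : 'rV[R]_N => be (vol x)).
  by move=> x; have [/(_ 0%N) Cf _] := T; exact: (Cn_continuous Cf).
have ig : lam.-integrable setT (EFin \o (fun x => g x ord0 i * be (vol x))).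
  apply: (integrable_mul_shell (integrable_g_shell N0 p1 hu i a b)) => //.
    exact: test_bounded.
  exact: cutoff_vol_out.
have cd : continuous (fun x : 'rV[R]_N => dvol i x * be (vol x)).
  by move=> x; refine (@continuousM R 'rV[R]_N _ _ x _ _); [exact: continuous_dvol|exact: cbe].
have outc x : ~ box (const_mx (- rad b)) (const_mx (rad b)) x -> dvol i x * be (vol x) = 0.
  by move=> /(vol_out_box N0 bp) /beb ->; rewrite mulr0.
have [K K0 [_ hK _]] := continuous_box_bounded cd outc.
have iec : lam.-integrable setT (EFin \o (fun x => e (vol x) * (dvol i x * be (vol x)))).
  exact: (integrable_mul_bounded (integrable_volT N0 ie) (continuous_measurable_rV cd) hK).
pose h x := g x ord0 i * be (vol x) - e (vol x) * (dvol i x * be (vol x)).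
have ih : lam.-integrable setT (EFin \o h) by exact: (integrableB measurableT ig iec).
suff : {ae lam, forall x, h x = 0}.
  by apply: filterS => x /eqP; rewrite subr_eq0 => /eqP ->; rewrite mulrA.
apply: (fundamental_lemma ih) => k c d cd_.
have Tp : test_function (fun x : 'rV[R]_N => be (vol x) * box_plateau k c d x).
  by apply: (test_radial_mul N0 ap bp sbe bea beb (psi := box_plateau k c d)) => n; exact: Cn_box_plateau.
have P0 x : ~ shell a b x -> be (vol x) * box_plateau k c d x = 0.
  by move=> /cutoff_vol_out ->; rewrite mul0r.
have [_ _ wg] := hu.
have := weak_radial_partial N1 p1 hu uV a00 ie Ve i Tp aa ab bb P0.
rewrite (wg i _ Tp) => /oppr_inj E.
have mB : measurable_fun setT (box_plateau k c d).
  by apply: continuous_measurable_rV => x; exact: (Cn_continuous (Cn_box_plateau 0 k c d)).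
have B1 x : `|box_plateau k c d x| <= 1.
  rewrite /box_plateau normr_prod; apply: num_theory.numdomain.Num.Theory.prodr_ile1 => j _.
  by rewrite normr_ge0/= ger0_norm ?plateau_le1// plateau_ge0.
have i1 := integrable_mul_bounded ig mB B1.
have i2 := integrable_mul_bounded iec mB B1.
have i12 := integrable_mul_bounded ih mB B1.
have E2 : \int[lam]_x (h x * box_plateau k c d x) = 0.
  have -> : \int[lam]_x (h x * box_plateau k c d x) = \int[lam]_x (g x ord0 i * be (vol x) * box_plateau k c d x
     - e (vol x) * (dvol i x * be (vol x)) * box_plateau k c d x).
    by apply: eq_Rintegral => x _; rewrite /h mulrBl.
  rewrite RintegralB//; apply/eqP; rewrite subr_eq0; apply/eqP.
  transitivity (\int[lam]_x (g x ord0 i * (be (vol x) * box_plateau k c d x))).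
    by apply: eq_Rintegral => x _; rewrite mulrA.
  by rewrite E; apply: eq_Rintegral => x _; ring.
by rewrite -[LHS]fineK ?(integrable_fin_num measurableT i12)//; congr _%:E.
Qed.

End cutoff.

(** The area of the sphere that bounds volume s, which is also |grad vol| there. *)
Definition rim (s : R) : R := C * N%:R * rad s ^+ N.-1.

Lemma dvol_dot (x : 'rV[R]_N) : \sum_i dvol i x * dvol i x = rim (vol x) ^+ 2.
Proof.
transitivity ((C * N%:R * enorm x ^+ N.-2) ^+ 2 * dot x x).
  by rewrite /dot mulr_sumr; apply: eq_bigr => i _; rewrite /dvol; ring.
rewrite -enorm_sqr /rim rad_vol//.
have -> : enorm x ^+ N.-1 = enorm x * enorm x ^+ N.-2.
  by rewrite -exprS prednK// -subn1 subn_gt0.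
by ring.
Qed.

Lemma rim_gt0 s : 0 < s -> 0 < rim s.
Proof.
by move=> s0; rewrite mulr_gt0 ?exprn_gt0 ?rad_gt0// mulr_gt0// ?ball_volume_gt0// ltr0n.
Qed.

Lemma dvol_enorm (c : R) (x y : 'rV[R]_N) : (forall i, y ord0 i = c * dvol i x) ->
  enorm y = `|c * rim (vol x)|.
Proof.
move=> yE; rewrite -[RHS]sqrtr_sqr /enorm; congr Num.sqrt.
rewrite exprMn -dvol_dot mulr_sumr; apply: eq_bigr => i _; rewrite yE; ring.
Qed.

(** The nonlinearity |z|^(p-2) z of the p-Laplacian in one dimension. At z = 0
    the second factor makes the value 0, whatever the value of the first. *)
Definition angular (z : R) : R := `|z| `^ (p - 2) * z.

Variables (mu m : R) (f : R -> R).
Hypothesis cf : continuous f.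
Hypothesis V0 : forall s, 0 < s -> 0 < V s.

Definition potential (s : R) : R := (m - mu / rad s `^ p) * V s `^ (p - 1).

Lemma continuous_rad s : 0 < s -> {for s, continuous rad}.
Proof.
move=> s0; have sC : 0 < s / C by rewrite divr_gt0// ball_volume_gt0.
refine (@continuous_comp R R R (fun s => s / C) (fun z => z `^ N%:R^-1) s _ _).
  exact: mulrr_continuous.
exact: (is_derive_continuous (f := fun z => N%:R^-1 * z `^ (N%:R^-1 - 1)) (is_derive1_powR _ sC)).
Qed.

Lemma powR_continuous (z al : R) : 0 < z -> {for z, continuous (fun t => t `^ al)}.
Proof.
move=> z0.
exact: (is_derive_continuous (f := fun t => al * t `^ (al - 1)) (is_derive1_powR _ z0)).
Qed.

Lemma continuous_potential s : 0 < s -> {for s, continuous potential}.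
Proof.
move=> s0; apply: continuousM; last first.
  by apply: (@continuous_comp _ _ _ V (fun z => z `^ (p - 1))); [exact: cV|exact/powR_continuous/V0].
apply: continuousB; first exact: cst_continuous.
apply: continuousM; first exact: cst_continuous.
apply: continuousV; first by rewrite gt_eqF// powR_gt0// rad_gt0.
apply: (@continuous_comp _ _ _ rad (fun z => z `^ p)); first exact: continuous_rad.
by apply: powR_continuous; exact: rad_gt0.
Qed.

Section weak_form.
Variables (be : R -> R) (a b : R).
Hypotheses (aa : a0 < a) (ab : a <= b) (bb : b < b0) (sbe : smooth1 be).
Hypotheses (bea : forall s, s < a -> be s = 0) (beb : forall s, b < s -> be s = 0).

Let ap : 0 < a. Proof. exact: lt_trans aa. Qed.
Let bp : 0 <= b. Proof. by rewrite (le_trans (ltW ap)). Qed.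

Lemma derive1_cutoff_out s : ~ (a <= s <= b) -> derive1 be s = 0.
Proof.
move=> /negP; rewrite negb_and -!ltNge => sab; apply: (proj2 (is_derive1_eq (d := 0) _)).
apply: (near_eq_is_derive (f := cst 0)); case/orP: sab => h.
  have : \forall t \near s, t < a by exact: cvgr_lt (@cvg_id _ _) _ _.
  by apply: filterS => t ta; rewrite bea.
have : \forall t \near s, b < t by exact: cvgr_gt (@cvg_id _ _) _ _.
by apply: filterS => t ta; rewrite beb.
Qed.

(** The flux of |grad u|^(p-2) grad u through the sphere that bounds volume s. *)
Definition profile_flux (s : R) : R := angular (e s * rim s) * rim s.

(** The gradients of u and of the test function are both multiples of
    grad vol, so the integrand is a function of the volume. *)
Lemma weak_lhs_radial :
  {ae lam, forall x, weak_lhs p mu m u g (fun x => be (vol x)) x =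
     profile_flux (vol x) * derive1 be (vol x) + potential (vol x) * be (vol x)}.
Proof.
pose d := Num.min (a - a0) (b0 - b) / 2.
have d0 : 0 < d by rewrite divr_gt0// lt_min !subr_gt0 aa bb.
have [k [kd _]] : exists k : nat, k.+1%:R^-1 < d /\ True.
  have [k _ hk] := near_infty_natSinv_lt (PosNum d0).
  by exists k; split => //; exact: (hk k (leqnn k)).
pose c := plateau k a b.
have dd : d < a - a0 /\ d < b0 - b.
  have : Num.min (a - a0) (b0 - b) <= a - a0 by rewrite ge_min lexx.
  have : Num.min (a - a0) (b0 - b) <= b0 - b by rewrite ge_min lexx orbT.
  by move: d0; rewrite /d; set z := Num.min _ _; split; lra.
have G i := gradient_radial (be := c) (a := a - d) (b := b + d) _ _ _ (plateau_smooth k a b) _ _ i.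
have {}G : {ae lam, forall x, forall i, g x ord0 i * c (vol x) = e (vol x) * dvol i x * c (vol x)}.
  apply: filter_forall => i; apply: G.
  - by move: dd => [? ?]; lra.
  - by apply: (@le_trans _ _ a); [rewrite gerBl ltW|apply: (le_trans ab); rewrite lerDl ltW].
  - by move: dd => [? ?]; lra.
  - move=> s sa; apply: plateau_left => //; apply/ltW/(lt_trans sa).
    by rewrite ltrD2l ltrN2.
  - move=> s sa; apply: plateau_right => //; apply/ltW; apply: lt_trans sa.
    by rewrite ltrD2l.
apply: filterS G => x G.
have gradE i : grad (fun y : 'rV[R]_N => be (vol y)) x ord0 i = derive1 be (vol x) * dvol i x.
  rewrite mxE; apply: partial_eq; exact: (is_derive_be_vol N0 ap sbe bea i x N1).
have [xs|xs] := pselect (a <= vol x <= b); last first.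
  have xsh : ~ shell a b x by rewrite /shell/= in_itv.
  have be0 : be (vol x) = 0 by exact: (cutoff_vol_out bea beb xsh).
  rewrite /weak_lhs derive1_cutoff_out// be0 !mulr0 subr0 !addr0.
  rewrite (_ : dot _ _ = 0) ?mulr0// /dot big1// => i _.
  by rewrite gradE derive1_cutoff_out// mul0r mulr0.
have c1 : c (vol x) = 1 by exact: plateau_in.
have vx : 0 < vol x by case/andP: xs => h _; exact: lt_le_trans h.
have x0 := vol_gt0_neq0 N0 vx.
have gE i : g x ord0 i = e (vol x) * dvol i x by have := G i; rewrite c1 !mulr1.
rewrite /weak_lhs (dvol_enorm gE).
have -> : dot (g x) (grad (fun y : 'rV[R]_N => be (vol y)) x) =
    e (vol x) * derive1 be (vol x) * rim (vol x) ^+ 2.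
  by rewrite -dvol_dot mulr_sumr; apply: eq_bigr => i _; rewrite gradE gE; ring.
rewrite uV// (gtr0_norm (V0 vx)) /profile_flux /angular /potential rad_vol//.
have -> : V (vol x) `^ (p - 2) * V (vol x) = V (vol x) `^ (p - 1).
  rewrite (_ : p - 1 = (p - 2) + 1); last by ring.
  rewrite [in RHS]powRD; last by rewrite (gt_eqF (V0 vx)) implybT.
  by rewrite powRr1// ltW// V0.
by ring.
Qed.

Lemma measurable_profile_flux : measurable_fun setT profile_flux.
Proof.
have me : measurable_fun setT e by have /measurable_int/measurable_EFinP := ie.
have mr : measurable_fun setT rim.
  apply: measurable_funM; first exact: measurable_cst.
  apply: measurable_funX; apply: (measurableT_comp (measurable_powR _)).
  by apply: measurable_funM => //; exact: measurable_cst.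
have mer : measurable_fun setT (fun s => e s * rim s) by exact: measurable_funM.
apply: measurable_funM => //; apply: measurable_funM => //.
apply: (measurableT_comp (measurable_powR _)).
exact: (measurableT_comp (@normr_measurable R setT)).
Qed.

Lemma weak_form_radial :
  lam.-integrable setT (EFin \o weak_lhs p mu m u g (fun x => be (vol x))) ->
  [/\ leb.-integrable setT (EFin \o (fun s => profile_flux s * derive1 be s)),
      leb.-integrable setT (EFin \o (fun s => potential s * be s)) &
      \int[lam]_x weak_lhs p mu m u g (fun x => be (vol x)) x =
      \int[leb]_s (profile_flux s * derive1 be s) + \int[leb]_s (potential s * be s)].
Proof.
move=> iw.
have cbe : continuous be by move=> s; exact: (C1n_continuous (sbe 0)).
have ip := cutoff_integrable ap continuous_potential cbe bea beb.
pose F s := profile_flux s * derive1 be s + potential s * be s.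
have F0 s : s < 0 -> F s = 0.
  move=> s0; rewrite /F derive1_cutoff_out ?bea ?mulr0 ?addr0//.
    exact: lt_trans ap.
  by move=> /andP[/(lt_le_trans ap)]; rewrite ltNge (ltW s0).
have mbe' : measurable_fun setT (derive1 be).
  have c' : continuous (derive1 be).
    by have [_ [_ [h _]]] := sbe 1%N.
  exact: (continuous_measurable_R c').
have mp : measurable_fun setT (fun s => potential s * be s).
  by have /measurable_int/measurable_EFinP := ip.
have mF : measurable_fun setT F.
  by apply: measurable_funD => //; apply: measurable_funM => //; exact: measurable_profile_flux.
have mFv : measurable_fun setT (fun x : 'rV[R]_N => F (vol x)).
  exact: (measurableT_comp mF (@measurable_vol R N)).
have E : ae_eq lam setT (EFin \o weak_lhs p mu m u g (fun x => be (vol x)))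
    (EFin \o (fun x => F (vol x))).
  by apply: filterS weak_lhs_radial => x h _ /=; rewrite h.
have iF : lam.-integrable setT (EFin \o (fun x => F (vol x))).
  have mFvE : measurable_fun setT (EFin \o (fun x : 'rV[R]_N => F (vol x))) by exact/measurable_EFinP.
  have [mw iwf] := integrableP _ _ _ iw.
  apply/integrableP; split => //; apply: le_lt_trans iwf.
  rewrite le_eqVlt; apply/orP; left; apply/eqP; apply: ae_eq_integral => //.
  - exact: measurableT_comp mFvE.
  - exact: measurableT_comp mw.
  - by apply: filterS E => x h Dx; congr (`|_|%E); exact/esym/h.
have iFR := integrable_vol_inv mF F0 iF.
have i1 : leb.-integrable setT (EFin \o (fun s => profile_flux s * derive1 be s)).
  have := integrableB measurableT iFR ip; apply: eq_integrable => // s _ /=.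
  by rewrite -EFinB /F addrK.
split => //; rewrite -RintegralD// /Rintegral; congr fine.
rewrite -(integral_volT N0 mF F0).
apply: ae_eq_integral => //; first by case/integrableP: iw.
exact/measurable_EFinP.
Qed.

End weak_form.
End reduction.

(** * Increments of the nonlinear flux *)

Section duality.
Context {R : realType}.

(** The functions z |-> |z|^(p-2) z for conjugate exponents are inverse to
    each other. *)
Lemma angularK (p q z : R) : (p - 1) * (q - 1) = 1 -> angular q (angular p z) = z.
Proof.
move=> pq; rewrite /angular; have [->|z0] := eqVneq z 0; first by rewrite !mulr0.
have z1 : 0 < `|z| by rewrite normr_gt0.
rewrite normrM (ger0_norm (powR_ge0 _ _)).
have -> : `|z| `^ (p - 2) * `|z| = `|z| `^ (p - 1).
  rewrite (_ : p - 1 = (p - 2) + 1); last by ring.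
  by rewrite [in RHS]powRD ?(gt_eqF z1) ?implybT// powRr1.
rewrite -powRrM mulrA -powRD ?(gt_eqF z1) ?implybT//.
have -> : (p - 1) * (q - 2) + (p - 2) = 0.
  have -> : (p - 1) * (q - 2) + (p - 2) = (p - 1) * (q - 1) - 1 by ring.
  by rewrite pq subrr.
by rewrite powRr0 mul1r.
Qed.

Lemma angular_norm (p z : R) : 1 < p -> `|angular p z| = `|z| `^ (p - 1).
Proof.
move=> p1; rewrite /angular; have [->|z0] := eqVneq z 0.
  by rewrite mulr0 !normr0 powR0// subr_eq0 gt_eqF.
have z1 : 0 < `|z| by rewrite normr_gt0.
rewrite normrM (ger0_norm (powR_ge0 _ _)) (_ : p - 1 = (p - 2) + 1); last by ring.
by rewrite [in RHS]powRD ?(gt_eqF z1) ?implybT// powRr1.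
Qed.

Lemma continuous_angular (p : R) : 1 < p -> continuous (angular p).
Proof.
move=> p1 z; have [->|z0] := eqVneq z 0.
  have a0 : angular p 0 = 0 by rewrite /angular mulr0.
  apply/cvgrPdist_lt => ep ep0; rewrite a0.
  have d0 : 0 < ep `^ (p - 1)^-1 by exact: powR_gt0.
  exists (ep `^ (p - 1)^-1) => //= t; rewrite /= !sub0r !normrN => td.
  rewrite angular_norm//.
  have -> : ep = (ep `^ (p - 1)^-1) `^ (p - 1).
    by rewrite -powRrM mulVf ?subr_eq0 ?gt_eqF// powRr1// ltW.
  by rewrite gt0_ltr_powR// ?nnegrE ?subr_gt0// ltW.
refine (@continuousM R R (fun t => `|t| `^ (p - 2)) id z _ _); last exact: cvg_id.
apply: (@continuous_comp R R R (fun t => `|t|) (fun t => t `^ (p - 2)) z).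
  exact: (@norm_continuous _ R^o).
by apply: powR_continuous; rewrite normr_gt0.
Qed.
End duality.

Section local_equation.
Context {R : realType} {N : nat} (N1 : (1 < N)%N).
Notation lam := (lebesgue_rV (R := R) N).
Notation leb := (@lebesgue_measure R).
Notation C := (@ball_volume R N).
Notation rad := (@rad R N).
Notation rim := (@rim R N).

Let N0 : (0 < N)%N. Proof. exact: ltnW. Qed.

Variables (u : 'rV[R]_N -> R) (V : R -> R).
Hypothesis uV : forall x, x != 0 -> u x = V (vol x).
Hypothesis cV : forall s, 0 < s -> {for s, continuous V}.
Hypothesis V0 : forall s, 0 < s -> 0 < V s.
Variables (p mu m : R) (f : R -> R).
Hypotheses (p1 : 1 < p) (cf : continuous f).
Hypothesis hweak : weak_solution p mu m f u.

Notation potential := (@potential R N V p mu m).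

Lemma continuous_source s : 0 < s -> {for s, continuous (fun t => f (V t) - potential t)}.
Proof.
move=> s0; apply: continuousB; last exact: continuous_potential.
by apply: (@continuous_comp _ _ _ V f); [exact: cV|exact: cf].
Qed.

Section density.
Variables (a0 b0 : R) (e : R -> R).
Hypotheses (a00 : 0 < a0) (ab0 : a0 <= b0) (ie : leb.-integrable setT (EFin \o e)).
Hypothesis Ve : forall s t, a0 <= s -> s <= t -> t <= b0 -> V t - V s = \int[leb]_(x in `[s, t]) e x.

Notation flux := (@profile_flux R N e p).

Section cutoff.
Variables (be : R -> R) (a b : R).
Hypotheses (aa : a0 < a) (ab : a <= b) (bb : b < b0) (sbe : smooth1 be) (be0 : forall s, 0 <= be s).
Hypotheses (bea : forall s, s < a -> be s = 0) (beb : forall s, b < s -> be s = 0).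

(** The weak gradients of the sub- and the supersolution property need not be
    the same function, but both are given by the density e, so the two
    inequalities combine into an equality. *)
Lemma flux_balance :
  leb.-integrable setT (EFin \o (fun s => flux s * derive1 be s)) /\
  \int[leb]_s (flux s * derive1 be s) = \int[leb]_s ((f (V s) - potential s) * be s).
Proof.
have ap : 0 < a by exact: lt_trans aa.
have b_ge0 : 0 <= b by rewrite (le_trans (ltW ap)).
have T := test_radial N0 ap b_ge0 sbe bea beb.
have [[g1 hg1 /(_ _ T (fun x => be0 _)) [iw1 if1 le1]]
      [g2 hg2 /(_ _ T (fun x => be0 _)) [iw2 _ le2]]] := hweak.
have [iF iP E1] := weak_form_radial N1 uV cV a00 ie Ve (ltW p1) hg1 V0 aa ab bb sbe bea beb iw1.
have [_ _ E2] := weak_form_radial N1 uV cV a00 ie Ve (ltW p1) hg2 V0 aa ab bb sbe bea beb iw2.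
split => //.
have cbe : continuous be by move=> s; exact: (C1n_continuous (sbe 0)).
have cfV s : 0 < s -> {for s, continuous (f \o V)}.
  by move=> s0; apply: continuous_comp; [exact: cV|exact: cf].
have ifV := cutoff_integrable ap cfV cbe bea beb.
have mfV : measurable_fun setT (fun s => (f \o V) s * be s).
  by have /measurable_int/measurable_EFinP := ifV.
have E3 : \int[lam]_x (f (u x) * be (vol x)) = \int[leb]_s ((f \o V) s * be s).
  rewrite /Rintegral -(integral_volT N0 mfV) => [|s s0].
    congr fine; apply: eq_integral => x _ /=; have [x0|x0] := eqVneq x 0.
      by rewrite x0 vol0// bea// !mulr0.
    by rewrite uV.
  by rewrite bea ?mulr0//; exact: lt_trans ap.
have -> : \int[leb]_s ((f (V s) - potential s) * be s) =
    \int[leb]_s ((f \o V) s * be s) - \int[leb]_s (potential s * be s).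
  by rewrite -RintegralB//; apply: eq_Rintegral => s _; rewrite mulrBl.
apply/eqP; rewrite eq_sym subr_eq -E3; apply/eqP/le_anti.
by rewrite -{1}E2 -E1 [X in X && _]le2 le1.
Qed.

End cutoff.

Section interval.
Variables (a b : R).
Hypotheses (aa : a0 < a) (ab : a < b) (bb : b < b0).

Let ap : 0 < a. Proof. exact: lt_trans aa. Qed.

Lemma small_inv (d : R) : 0 < d -> \forall k \near \oo, (k.+1%:R^-1 : R) < d.
Proof. by move=> d0; exact: near_infty_natSinv_lt (PosNum d0). Qed.

Lemma plateau_support (x y c d : R) : c < x -> x <= y -> y < d ->
  \forall k \near \oo, (forall s, s < c -> plateau k x y s = 0) /\
                       (forall s, d < s -> plateau k x y s = 0).
Proof.
move=> cx xy yd.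
have h1 : 0 < x - c by rewrite subr_gt0.
have h2 : 0 < d - y by rewrite subr_gt0.
near=> k.
have k1 : k.+1%:R^-1 < x - c by near: k; exact: small_inv.
have k2 : k.+1%:R^-1 < d - y by near: k; exact: small_inv.
split=> s hs; [apply: plateau_left => //|apply: plateau_right => //].
  by apply/ltW/(lt_trans hs); rewrite ltrBrDr addrC -ltrBrDr.
by apply/ltW/(lt_trans _ hs); rewrite addrC -ltrBrDr.
Unshelve. all: by end_near. Qed.

(** A nonnegative test function with derivative 1 on [a, b], namely s times a
    plateau, exhibits the flux on [a, b] inside an integrable function. *)
Lemma integrable_profile_flux :
  leb.-integrable setT (EFin \o (fun s => flux s * \1_`[a, b] s)).
Proof.
pose c := (a0 + a) / 2; pose d := (b + b0) / 2.
have c1 : a0 < c by rewrite midf_lt.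
have c2 : c < a by rewrite midf_lt.
have d1 : b < d by rewrite midf_lt.
have d2 : d < b0 by rewrite midf_lt.
have c0 : 0 < c by exact: lt_trans c1.
pose a' := (c + a) / 2; pose b' := (b + d) / 2.
have a'1 : c < a' by rewrite midf_lt.
have a'2 : a' < a by rewrite midf_lt.
have b'1 : b < b' by rewrite midf_lt.
have b'2 : b' < d by rewrite midf_lt.
have a'b' : a' <= b' by rewrite ltW// (lt_trans a'2)// (lt_trans ab).
have [k [hk1 hk2]] : exists k, (forall s, s < c -> plateau k a' b' s = 0) /\
                       (forall s, d < s -> plateau k a' b' s = 0).
  have [k _ hk] := plateau_support a'1 a'b' b'2.
  by exists k; exact: (hk k (leqnn k)).
(* The factor s gives derivative 1 where the plateau is constant. *)
pose be s := s * plateau k a' b' s.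
have sbe : smooth1 be.
  by move=> n; apply: C1nM; [exact: C1n_id|exact: plateau_smooth].
have bec s : s < c -> be s = 0 by move=> /hk1 h; rewrite /be h mulr0.
have bed s : d < s -> be s = 0 by move=> /hk2 h; rewrite /be h mulr0.
have be0 s : 0 <= be s.
  have [sc|cs] := ltP s c; first by rewrite bec.
  by rewrite mulr_ge0 ?plateau_ge0// (le_trans (ltW c0)).
have cd : c <= d by rewrite ltW// (lt_trans c2)// (lt_trans ab).
have [iF _] := flux_balance c1 cd d2 sbe be0 bec bed.
have mI : measurable (`[a, b]%classic : set (measurableTypeR R)) by exact: measurable_itv.
have I1 s : `|\1_`[a, b]%classic s : R| <= 1.
  by rewrite indicE; case: (_ \in _); rewrite ?normr1 ?normr0.
have := integrable_mul_bounded iF (measurable_indic mI) I1.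
apply: eq_integrable => // s _ /=; rewrite indicE; case: (boolP (s \in `[a, b]%classic)) => [|_]; last by rewrite !mulr0.
rewrite inE/= in_itv/= => /andP[as_ sb]; rewrite !mulr1 (_ : derive1 be s = 1) ?mulr1//.
apply: (proj2 (is_derive1_eq _)); apply: (near_eq_is_derive (f := id)).
have n1 : \forall t \near s, a' < t by apply: cvgr_gt (@cvg_id _ _) _ _; exact: lt_le_trans as_.
have n2 : \forall t \near s, t < b' by apply: cvgr_lt (@cvg_id _ _) _ _; exact: le_lt_trans b'1.
by near=> t; rewrite /be plateau_in ?mulr1//; apply/andP; split; apply/ltW; near: t.
Unshelve. all: by end_near. Qed.

(** Testing with plateaus over [x, y], the derivatives of the plateaus isolate
    the values of the flux at the end points and the plateaus themselves converge
    to the indicator of [x, y]. *)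
Lemma flux_increment (x y : R) (P : R -> R) :
  lebesgue_pt (fun s => flux s * \1_`[a, b] s) x -> lebesgue_pt (fun s => flux s * \1_`[a, b] s) y ->
  a < x -> x <= y -> y < b ->
  (forall s, x <= s <= y -> is_derive s 1 P (f (V s) - potential s)) ->
  flux x - flux y = P y - P x.
Proof.
move=> lx ly ax xy yb dP; set W := fun s => _ in lx ly.
have Wx s : a <= s <= b -> W s = flux s.
  by move=> h; rewrite /W indicE mem_set ?mulr1//= in_itv.
have cv : (\int[leb]_s (W s * derive1 (plateau n x y) s)) @[n --> \oo] --> W x - W y.
  exact: plateau_derivative_cvg integrable_profile_flux lx ly.
have WxE : W x = flux x by apply: Wx; rewrite (ltW ax) (le_trans xy (ltW yb)).
have WyE : W y = flux y by apply: Wx; rewrite (ltW yb) (le_trans (ltW ax) xy).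
rewrite WxE WyE in cv.
pose c := (a + x) / 2; pose d := (y + b) / 2.
have c1 : a < c by rewrite midf_lt.
have c2 : c < x by rewrite midf_lt.
have d1 : y < d by rewrite midf_lt.
have d2 : d < b by rewrite midf_lt.
have cd : c <= d by rewrite (le_trans (ltW c2))// (le_trans xy (ltW d1)).
pose src s := f (V s) - potential s.
pose J s := src s * plateau 0 a b s.
have mI : measurable (`[a, b]%classic : set (measurableTypeR R)) by exact: measurable_itv.
have isrc : leb.-integrable `[a, b] (EFin \o src).
  apply: continuous_compact_integrable; first exact: segment_compact.
  apply: continuous_in_subspaceT => s; rewrite inE/= in_itv/= => /andP[as_ _].
  by apply: continuous_source; exact: lt_le_trans as_.
pose h s := src s * \1_`[a, b] s.
have ih : leb.-integrable setT (EFin \o h) by exact: integrable_cut.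
have mh : measurable_fun setT h by have /measurable_int/measurable_EFinP := ih.
have cv2 : (\int[leb]_s (h s * plateau k x y s)) @[k --> \oo] --> \int[leb]_s (h s * \1_`[x, y] s).
  apply: (@dominated_cvgR _ (measurableTypeR R) R leb _ _ (fun s => `|h s|)) => [k|s||k s].
  - apply: measurable_funM => //; apply: continuous_measurable_R => s.
    exact: (C1n_continuous (plateau_smooth k x y 0)).
  - apply: cvgMl_tmp => //; apply: cvg_near_cst; have := plateau_cvg s xy.
    by apply: filterS => k ->.
  - exact: integrable_norm.
  - by rewrite normrM ler_piMr// ger0_norm ?plateau_le1// plateau_ge0.
have E k : ((forall s, s < c -> plateau k x y s = 0) /\ (forall s, d < s -> plateau k x y s = 0)) ->
    \int[leb]_s (W s * derive1 (plateau k x y) s) = \int[leb]_s (h s * plateau k x y s).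
  move=> [hc hd].
  have [_ B] := flux_balance (lt_trans aa c1) cd (lt_trans d2 bb) (plateau_smooth k x y)
    (fun s => plateau_ge0 k s xy) hc hd.
  transitivity (\int[leb]_s (flux s * derive1 (plateau k x y) s)).
    apply: eq_Rintegral => s _; have [sI|sI] := pselect (c <= s <= d).
      by rewrite Wx//; move/andP: sI => [h1 h2]; rewrite (le_trans (ltW c1) h1) (le_trans h2 (ltW d2)).
    by rewrite (derive1_cutoff_out hc hd sI) !mulr0.
  rewrite B; apply: eq_Rintegral => s _; have [sI|sI] := pselect (c <= s <= d).
    rewrite /h indicE mem_set ?mulr1//= in_itv/=.
    by move/andP: sI => [h1 h2]; rewrite (le_trans (ltW c1) h1) (le_trans h2 (ltW d2)).
  have -> : plateau k x y s = 0; last by rewrite !mulr0.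
  by move/negP: sI; rewrite negb_and -!ltNge => /orP[/hc|/hd].
have cv3 : (\int[leb]_s (W s * derive1 (plateau k x y) s)) @[k --> \oo] --> \int[leb]_s (h s * \1_`[x, y] s).
  apply: cvg_trans cv2; apply: near_eq_cvg.
  by have := plateau_support c2 xy d1; apply: filterS => k /E ->.
rewrite (cvg_unique _ cv cv3)//.
have FT : (\int[leb]_(s in `[x, y]) (src s)%:E = (P y - P x)%:E)%E.
  apply: FTC2 => //; apply: continuous_in_subspaceT => s; rewrite inE/= in_itv/= => /andP[xs _].
  by apply: continuous_source; rewrite (lt_le_trans _ xs)// (lt_trans ap).
rewrite /Rintegral -[RHS]/(fine (P y - P x)%:E) -FT [in RHS]integral_mkcond; congr fine.
apply: eq_integral => s _; rewrite patchE /h; case: ifPn => sI.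
  move: sI; rewrite inE/= => sI; rewrite !indicE !mem_set ?mulr1//=.
  move: sI; rewrite !in_itv/= => /andP[h1 h2].
  by rewrite (le_trans (ltW ax) h1) (le_trans h2 (ltW yb)).
by rewrite [X in _ * X]indicE (negbTE sI) mulr0.
Qed.

End interval.
End density.
End local_equation.

(** * Regularity of the profile *)

Section regularity.
Context {R : realType} {N : nat} (N1 : (1 < N)%N).
Notation lam := (lebesgue_rV (R := R) N).
Notation leb := (@lebesgue_measure R).
Notation C := (@ball_volume R N).
Notation rad := (@rad R N).
Notation rim := (@rim R N).

Let N0 : (0 < N)%N. Proof. exact: ltnW. Qed.

Variables (u : 'rV[R]_N -> R) (V : R -> R).
Hypothesis uV : forall x, x != 0 -> u x = V (vol x).
Hypothesis cV : forall s, 0 < s -> {for s, continuous V}.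
Hypothesis V0 : forall s, 0 < s -> 0 < V s.
Variables (p mu m : R) (f : R -> R).
Hypotheses (p1 : 1 < p) (cf : continuous f).
Hypothesis hweak : weak_solution p mu m f u.

Notation potential := (@potential R N V p mu m).
Notation src := (fun s => f (V s) - potential s).

Lemma continuous_rim s : 0 < s -> {for s, continuous rim}.
Proof.
move=> s0; apply: continuousM; first exact: cst_continuous.
apply: (@continuous_comp R R R rad (fun r => r ^+ N.-1)); first exact: continuous_rad.
exact: exprn_continuous.
Qed.

Lemma ae_itv_exists (P : R -> Prop) (a b : R) : a < b ->
  {ae leb, forall s, P s} -> exists2 s, a < s < b & P s.
Proof.
move=> ab [Z [mZ Z0 hZ]].
have [//|nP] := pselect (exists2 s, a < s < b & P s).
have sub : `]a, b[%classic `<=` Z.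
  move=> s; rewrite /= in_itv/= => sab; apply: hZ => Ps; apply: nP; by exists s.
have : (leb `]a, b[ <= leb Z)%E by rewrite le_measure ?inE.
have := lebesgue_measure_itv `]a, b[ => /= ->; rewrite Z0 lte_fin ab -EFinB lee_fin.
by rewrite leNgt subr_gt0 ab.
Qed.

Lemma leb_ae_mono (P Q : R -> Prop) : (forall s, P s -> Q s) ->
  {ae leb, forall s, P s} -> {ae leb, forall s, Q s}.
Proof.
move=> PQ [Z [mZ Z0 hZ]]; exists Z; split => // s nQ; apply: hZ => Ps.
exact/nQ/PQ.
Qed.

Section density.
Variables (a0 b0 : R) (e : R -> R).
Hypotheses (a00 : 0 < a0) (ab0 : a0 <= b0) (ie : leb.-integrable setT (EFin \o e)).
Hypothesis Ve : forall s t, a0 <= s -> s <= t -> t <= b0 -> V t - V s = \int[leb]_(x in `[s, t]) e x.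
Variables (a b : R).
Hypotheses (aa : a0 < a) (ab : a < b) (bb : b < b0).

Notation flux := (@profile_flux R N e p).

Let ap : 0 < a. Proof. exact: lt_trans aa. Qed.

Lemma source_primitive : exists P : R -> R, forall s, a <= s <= b -> is_derive s 1 P (src s).
Proof.
have [k [hk1 hk2]] : exists k, (forall s, s < a0 -> plateau k a b s = 0) /\
                       (forall s, b0 < s -> plateau k a b s = 0).
  have [k _ hk] := plateau_support aa (ltW ab) bb.
  by exists k; exact: (hk k (leqnn k)).
have cc : continuous (fun s => src s * plateau k a b s).
  apply: (mul_cutoff_continuous a00 _ _ hk1); first by move=> s s0; exact: continuous_source.
  by move=> s; exact: (C1n_continuous (plateau_smooth k a b 0)).
have [P dP] := continuous_primitive cc; exists P => s /andP[as_ sb].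
apply: (is_derive_eq (dP s _)); last by rewrite plateau_in ?mulr1// as_.
by rewrite (lt_le_trans _ as_)// (lt_trans _ ap)// oppr_lt0.
Qed.

(** Almost everywhere the flux equals a C^1 function. Inverting the increasing
    homeomorphism z |-> |z|^(p-2) z turns it into a continuous representative of
    the density, so the profile is C^1. *)
Lemma profile_regular : exists D : R -> R,
  [/\ {ae leb, forall s, a < s < b -> e s = D s},
      forall s, a < s < b -> is_derive s 1 V (D s),
      forall s, a < s < b -> {for s, continuous D} &
      forall s, a < s < b ->
        is_derive s 1 (fun t => angular p (D t * rim t) * rim t) (potential s - f (V s))].
Proof.
have [P dP] := source_primitive.
pose W s := flux s * \1_`[a, b]%classic s.
have iW : leb.-integrable setT (EFin \o W).
  exact: (integrable_profile_flux N1 uV cV V0 p1 cf hweak a00 ie Ve aa ab bb).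
have aeW : {ae leb, forall s, lebesgue_pt W s}.
  by apply: lebesgue_differentiation; apply: open_integrable_locally => //; exact: openT.
have [x0 x0ab lx0] := ae_itv_exists ab aeW.
(* The quantity flux + P is constant on Lebesgue points. *)
pose c := flux x0 + P x0.
have fluxE s : a < s < b -> lebesgue_pt W s -> flux s = c - P s.
  have I := flux_increment N1 uV cV V0 p1 cf hweak a00 ie Ve aa ab bb.
  have dPxy x y : a < x -> y < b -> forall s, x <= s <= y -> is_derive s 1 P (src s).
    by move=> ax yb t /andP[h1 h2]; apply: dP; rewrite (le_trans (ltW ax) h1) (le_trans h2 (ltW yb)).
  move=> /andP[as_ sb] ls; move/andP: x0ab => [ax xb].
  have [xs|/ltW sx] := leP x0 s.
    have := I x0 s P lx0 ls ax xs sb (dPxy _ _ ax sb); rewrite /c.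
    move=> h; rewrite -addrA -[P x0 - P s]opprB -h; ring.
  have := I s x0 P ls lx0 as_ sx xb (dPxy _ _ as_ xb); rewrite /c.
  by move=> h; rewrite -addrA -h; ring.
pose q := p / (p - 1).
have p10 : p - 1 != 0 by rewrite subr_eq0 gt_eqF.
have qE : q - 1 = (p - 1)^-1.
  by rewrite /q; field.
have q1 : 1 < q by rewrite -subr_gt0 qE invr_gt0 subr_gt0.
have pq : (p - 1) * (q - 1) = 1 by rewrite qE mulfV.
have qp : (q - 1) * (p - 1) = 1 by rewrite mulrC.
pose D s := angular q ((c - P s) / rim s) / rim s.
have s_gt0 s : a < s < b -> 0 < s by move=> /andP[/(lt_trans ap)].
have rim0 s : a < s < b -> rim s != 0 by move=> /s_gt0 s0; rewrite gt_eqF// rim_gt0.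
have cP s : a < s < b -> {for s, continuous P}.
  move=> /andP[h1 h2]; apply: (is_derive_continuous (f := src)).
  by apply: dP; rewrite !ltW.
have cD s : a < s < b -> {for s, continuous D}.
  move=> sab; have cr := continuous_rim (s_gt0 s sab).
  apply: continuousM; last by apply: continuousV => //; exact: rim0.
  apply: (@continuous_comp R R R (fun s => (c - P s) / rim s) (angular q)).
    apply: continuousM; last by apply: continuousV => //; exact: rim0.
    by apply: continuousB; [exact: cst_continuous|exact: cP].
  exact: continuous_angular.
have aeD : {ae leb, forall s, a < s < b -> e s = D s}.
  apply: leb_ae_mono aeW => s ls sab; have := fluxE s sab ls.
  rewrite /profile_flux => h; have r0 := rim0 s sab.
  by rewrite /D -h mulfK// angularK// mulfK.
have dV s : a < s < b -> is_derive s 1 V (D s).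
  move=> /andP[as_ sb]; pose a' := (a + s) / 2; pose b' := (s + b) / 2.
  have a1 : a < a' by rewrite midf_lt.
  have a2 : a' < s by rewrite midf_lt.
  have b1 : s < b' by rewrite midf_lt.
  have b2 : b' < b by rewrite midf_lt.
  have inab z : a' <= z <= b' -> a < z < b.
    by move=> /andP[h1 h2]; rewrite (lt_le_trans a1 h1) (le_lt_trans h2 b2).
  have iD : leb.-integrable `[a', b'] (EFin \o D).
    apply: continuous_compact_integrable; first exact: segment_compact.
    by apply: continuous_in_subspaceT => z; rewrite inE/= in_itv/= => /inab; exact: cD.
  have csD : {for s, continuous D} by apply: cD; rewrite as_ sb.
  have [dF FE] := continuous_FTC1_closed b1 iD a2 csD.
  have dF' : is_derive s 1 (fun t => V a' + \int[leb]_(x in `[a', t]) D x) (D s).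
    have dF0 : is_derive s 1 (fun t => \int[leb]_(x in `[a', t]) D x) (D s).
      by apply: DeriveDef => //; rewrite -derive1E.
    have DD := is_deriveD (is_derive_cst (V a') s 1) dF0.
    by apply: (is_derive_eq DD); rewrite add0r.
  apply: (near_eq_is_derive (f := fun t => V a' + \int[leb]_(x in `[a', t]) D x)).
  have n1 : \forall t \near s, a' < t by apply: cvgr_gt (@cvg_id _ _) _ _.
  have n2 : \forall t \near s, t < b' by apply: cvgr_lt (@cvg_id _ _) _ _.
  near=> t; have ta : a' < t by near: t.
  have tb : t < b' by near: t.
  apply/eqP; rewrite eq_sym addrC -subr_eq; apply/eqP.
  rewrite (Ve (ltW (lt_trans aa a1)) (ltW ta) (ltW (lt_trans tb (lt_trans b2 bb)))) /Rintegral.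
  congr fine; have mI : measurable (`[a', t]%classic : set (measurableTypeR R)) by exact: measurable_itv.
  have sI : `[a', t]%classic `<=` (`[a', b']%classic : set R).
    by move=> z /=; rewrite !in_itv/= => /andP[-> /le_trans]; apply; exact: ltW.
  have mI' : measurable (`[a', b']%classic : set (measurableTypeR R)) by exact: measurable_itv.
  apply: ae_eq_integral => //.
  - exact: measurable_int (integrableS measurableT mI (@subsetT _ _) ie).
  - exact: measurable_int (integrableS mI' mI sI iD).
  - apply: leb_ae_mono aeD => z h; rewrite /= in_itv/= => /andP[h1 h2].
    by rewrite h// inab// h1 (le_trans h2 (ltW tb)).
exists D; split => // s sab.
have dc : is_derive s 1 (fun t => c - P t) (potential s - f (V s)).
  have dPs : is_derive s 1 P (src s) by apply: dP; case/andP: sab => h1 h2; rewrite !ltW.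
  have DD := is_deriveB (is_derive_cst c s 1) dPs.
  by apply: (is_derive_eq DD); rewrite sub0r opprB.
apply: (near_eq_is_derive (f := fun t => c - P t)).
have n1 : \forall t \near s, a < t by apply: cvgr_gt (@cvg_id _ _) _ _; case/andP: sab.
have n2 : \forall t \near s, t < b by apply: cvgr_lt (@cvg_id _ _) _ _; case/andP: sab.
near=> t; have tab : a < t < b by apply/andP; split; near: t.
have r0 := rim0 t tab.
by rewrite /D mulfVK// angularK// mulfVK.
Unshelve. all: by end_near. Qed.

End density.

(** The density of the profile is only defined up to null sets and over a
    compact range of radii, but the derivative it represents is not. *)
Lemma profile_local (x y : R) : 0 < x -> x < y -> exists (e D : R -> R),
  [/\ leb.-integrable setT (EFin \o e),
      forall s t, x / 2 <= s -> s <= t -> t <= 2 * y -> V t - V s = \int[leb]_(z in `[s, t]) e z,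
      {ae leb, forall t, x < t < y -> e t = D t} &
   [/\ forall t, x < t < y -> is_derive t 1 V (D t),
      forall t, x < t < y -> {for t, continuous D} &
      forall t, x < t < y ->
        is_derive t 1 (fun z => angular p (D z * rim z) * rim z) (potential t - f (V t))]].
Proof.
move=> x0 xy; have [[g hg _] _] := hweak.
have x2 : 0 < x / 2 by lra.
have y2 : y < 2 * y by lra.
have xx : x / 2 < x by lra.
have [e ie Ve] := flux_density N1 (ltW p1) hg uV cV (2 * y) x2.
have [D [h1 h2 h3 h4]] := @profile_regular (x / 2) (2 * y) e x2 ie Ve x y xx xy y2.
by exists e, D; split.
Qed.

Let mid (s : R) : 0 < s -> s / 2 < s < 2 * s.
Proof. by move=> s0; apply/andP; split; lra. Qed.

Let around (s : R) : 0 < s -> 0 < s / 2 /\ s / 2 < 2 * s.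
Proof. by move=> s0; split; lra. Qed.

Lemma profile_is_derive (s : R) : 0 < s -> is_derive s 1 V (derive1 V s).
Proof.
move=> s0; have [e [D [_ _ _ [dV _ _]]]] := profile_local (around s0).1 (around s0).2.
by have d := dV s (mid s0); rewrite (is_derive1_eq d).2.
Qed.

Lemma profile_equation (s : R) : 0 < s ->
  is_derive s 1 (fun t => angular p (derive1 V t * rim t) * rim t) (potential s - f (V s)).
Proof.
move=> s0; have [e [D [_ _ _ [dV _ dE]]]] := profile_local (around s0).1 (around s0).2.
have d := dE s (mid s0).
apply: (near_eq_is_derive (f := fun z => angular p (D z * rim z) * rim z)).
have /andP[m1 m2] := mid s0.
have n1 : \forall t \near s, s / 2 < t by apply: cvgr_gt (@cvg_id _ _) _ _.
have n2 : \forall t \near s, t < 2 * s by apply: cvgr_lt (@cvg_id _ _) _ _.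
near=> t; have tab : s / 2 < t < 2 * s by apply/andP; split; near: t.
by rewrite (is_derive1_eq (dV t tab)).2.
Unshelve. all: by end_near. Qed.

Lemma profile_continuous_derive (s : R) : 0 < s -> {for s, continuous (derive1 V)}.
Proof.
move=> s0; have [e [D [_ _ _ [dV cD _]]]] := profile_local (around s0).1 (around s0).2.
have /andP[m1 m2] := mid s0.
have DE t : s / 2 < t < 2 * s -> D t = derive1 V t by move=> h; rewrite (is_derive1_eq (dV t h)).2.
suff : derive1 V x @[x --> s] --> D s by rewrite DE ?mid.
apply: cvg_trans (cD s (mid s0)); apply: near_eq_cvg.
have n1 : \forall t \near s, s / 2 < t by apply: cvgr_gt (@cvg_id _ _) _ _.
have n2 : \forall t \near s, t < 2 * s by apply: cvgr_lt (@cvg_id _ _) _ _.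
by near=> t; apply: DE; apply/andP; split; near: t.
Unshelve. all: by end_near. Qed.

End regularity.

(** * The energy of the profile *)

Section energy.
Context {R : realType} {N : nat} (N1 : (1 < N)%N).
Notation lam := (lebesgue_rV (R := R) N).
Notation leb := (@lebesgue_measure R).
Notation rim := (@rim R N).

Let N0 : (0 < N)%N. Proof. exact: ltnW. Qed.

Variables (u : 'rV[R]_N -> R) (V : R -> R).
Hypothesis uV : forall x, x != 0 -> u x = V (vol x).
Hypothesis cV : forall s, 0 < s -> {for s, continuous V}.
Hypothesis V0 : forall s, 0 < s -> 0 < V s.
Variables (p mu m : R) (f : R -> R).
Hypotheses (p1 : 1 < p) (cf : continuous f).
Hypothesis hweak : weak_solution p mu m f u.

(** The largest coordinate is at least the Euclidean norm divided by N. *)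
Lemma powR_enorm_le (x : 'rV[R]_N) : enorm x `^ p <= N%:R `^ p * \sum_i `|x ord0 i| `^ p.
Proof.
have i0 : 'I_N by case: N N0 => // n _; exact: ord0.
pose i := [arg max_(j > i0) `|x ord0 j|]%O.
have hi j : `|x ord0 j| <= `|x ord0 i|.
  by rewrite /i; case: arg_maxP => // k _; exact.
have xle : enorm x <= N%:R * `|x ord0 i|.
  rewrite -(@ler_pXn2r _ 2) ?nnegrE ?enorm_ge0 ?mulr_ge0// enorm_sqr exprMn.
  apply: (@le_trans _ _ (\sum_(j < N) `|x ord0 i| ^+ 2)).
    apply: ler_sum => j _; rewrite -expr2 -real_normK ?num_real//.
    by rewrite ler_pXn2r// nnegrE.
  rewrite sumr_const card_ord -[leLHS]mulr_natl ler_wpM2r ?sqr_ge0// -natrX ler_nat.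
  by rewrite -[leqLHS]muln1 expnS expn1 leq_mul.
apply: (@le_trans _ _ ((N%:R * `|x ord0 i|) `^ p)).
  by apply: ge0_ler_powR => //; rewrite ?nnegrE ?enorm_ge0 ?mulr_ge0// ltW// (lt_trans ltr01).
rewrite powRM// ler_wpM2l ?powR_ge0//.
by rewrite (bigD1 i)//= lerDl sumr_ge0// => j _; exact: powR_ge0.
Qed.

Lemma gradient_profile (g : 'rV[R]_N -> 'rV[R]_N) (a b : R) :
  sobolev_with_gradient p u g -> 0 < a -> a <= b ->
  {ae lam, forall x, shell a b x -> enorm (g x) = `|derive1 V (vol x) * rim (vol x)|}.
Proof.
move=> hg a0 ab.
have a2 : 0 < a / 2 by lra.
have ab2 : a / 2 < 2 * b by lra.
have [e [D [ie Ve [Z [mZ Z0 hZ]] [dV _ _]]]] := profile_local N1 uV cV V0 p1 cf hweak a2 ab2.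
pose a' := a / 2; pose b' := 2 * b.
have a4 : 0 < a / 2 / 2 by lra.
have aa : a / 2 / 2 < a' by rewrite /a'; lra.
have ab' : a' <= b' by rewrite /a' /b'; lra.
have bb : b' < 2 * (2 * b) by rewrite /b'; lra.
have [k [hk1 hk2]] : exists k, (forall s, s < a' -> plateau k a b s = 0) /\
                       (forall s, b' < s -> plateau k a b s = 0).
  have h1 : a' < a by rewrite /a'; lra.
  have h2 : b < b' by rewrite /b'; lra.
  have [k _ hk] := plateau_support h1 ab h2.
  by exists k; exact: (hk k (leqnn k)).
have G i := gradient_radial N1 uV a4 ie Ve (ltW p1) hg aa ab' bb (plateau_smooth k a b) hk1 hk2 i.
have {}G : {ae lam, forall x, forall i, g x ord0 i * plateau k a b (vol x) =
    e (vol x) * dvol i x * plateau k a b (vol x)} by exact: filter_forall.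
have Zv : {ae lam, forall x, ~ Z (vol x)}.
  exists (@vol R N @^-1` Z); split.
  - exact: measurable_preimage_vol.
  - exact: vol_null.
  - by move=> x /= /contrapT.
near=> x.
have Gx : forall i, g x ord0 i * plateau k a b (vol x) = e (vol x) * dvol i x * plateau k a b (vol x).
  by near: x.
have Zx : ~ Z (vol x) by near: x.
rewrite /shell/= in_itv/= => /andP[ax xb].
have gE i : g x ord0 i = e (vol x) * dvol i x.
  by have := Gx i; rewrite plateau_in ?ax ?xb// !mulr1.
rewrite (dvol_enorm N1 gE); congr (`|_ * _|).
have [//|ne] := pselect (e (vol x) = derive1 V (vol x)).
exfalso; apply: Zx; apply: hZ => /= h; apply: ne.
have vx : a / 2 < vol x < 2 * b by apply/andP; split; lra.
by rewrite h// (is_derive1_eq (dV _ vx)).2.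
Unshelve. all: by end_near. Qed.

Definition energy_density (s : R) : R := V s `^ p + `|derive1 V s * rim s| `^ p.

Lemma continuous_energy_density (s : R) : 0 < s -> {for s, continuous energy_density}.
Proof.
move=> s0; apply: continuousD.
  by apply: (@continuous_comp R R R V (fun z => z `^ p)); [exact: cV|exact/powR_continuous/V0].
have cz : {for s, continuous (fun s => derive1 V s * rim s)}.
  apply: continuousM; last exact: continuous_rim.
  exact: (profile_continuous_derive N1 uV cV V0 p1 cf hweak).
have pE : (fun s => `|derive1 V s * rim s| `^ p) =
    (fun z => `|angular (p + 1) z|) \o (fun s => derive1 V s * rim s).
  by apply/funext => z /=; rewrite angular_norm ?ltrDr// ?addrK// (lt_trans ltr01).
rewrite pE; apply: continuous_comp; first exact: cz.
apply: (@continuous_comp R R R (angular (p + 1)) (fun z => `|z|)); last exact: (@norm_continuous _ R^o).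
by apply: continuous_angular; rewrite ltrDr (lt_trans ltr01).
Qed.

(** Over a shell, the two terms integrate to integrals of |u|^p and of
    |grad u|^p, which are finite over the whole space. *)
Lemma energy_bound : exists K : R, forall a b, 0 < a -> a <= b ->
  \int[leb]_(s in `[a, b]) energy_density s <= K.
Proof.
have [[g hg _] _] := hweak; have [uL gL _] := hg.
have iu := Lfun_integrable (ltW p1) uL.
have ig i := Lfun_integrable (ltW p1) (gL i).
pose G x := N%:R `^ p * \sum_i `|g x ord0 i| `^ p.
have iG : lam.-integrable setT (EFin \o G).
  have [iS _] := Rintegral_sum ig.
  exact: (integrableZl measurableT (N%:R `^ p) iS).
pose H x := `|u x| `^ p + G x.
have iH : lam.-integrable setT (EFin \o H) by exact: (integrableD measurableT iu iG).
have G0 x : 0 <= G x by rewrite mulr_ge0 ?powR_ge0// sumr_ge0// => i _; exact: powR_ge0.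
have H0 x : 0 <= H x by rewrite addr_ge0// powR_ge0.
exists (\int[lam]_x H x) => a b a0 ab.
pose F := energy_density.
have F0 s : 0 <= F s by rewrite addr_ge0// powR_ge0.
have mI : measurable (`[a, b]%classic : set (measurableTypeR R)) by exact: measurable_itv.
have cF := continuous_energy_density.
have iF : leb.-integrable `[a, b] (EFin \o F).
  apply: continuous_compact_integrable; first exact: segment_compact.
  apply: continuous_in_subspaceT => s; rewrite inE/= in_itv/= => /andP[as_ _].
  by apply: cF; exact: lt_le_trans as_.
pose FI s := F s * \1_`[a, b]%classic s.
have iFI : leb.-integrable setT (EFin \o FI) by exact: integrable_cut.
have mFI : measurable_fun setT FI by have /measurable_int/measurable_EFinP := iFI.
have E : (\int[leb]_(s in `[a, b]) (F s)%:E = \int[lam]_x (FI (vol x))%:E)%E.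
  rewrite integral_volT//; last first.
    by move=> s s0; rewrite /FI indicE memNset ?mulr0//= in_itv/= leNgt (lt_trans s0 a0).
  exact: integral_cut.
have FI0 s : 0 <= FI s by rewrite mulr_ge0// indicE ler0n.
rewrite -lee_fin /Rintegral fineK; last exact: integrable_fin_num.
rewrite E fineK; last exact: integrable_fin_num.
apply: ae_ge0_le_integral => //.
- by move=> x _; rewrite lee_fin.
- by apply/measurable_EFinP; exact: (measurableT_comp mFI (@measurable_vol R N)).
- by move=> x _; rewrite lee_fin.
- exact: measurable_int iH.
have [Z [mZ Z0 hZ]] := gradient_profile hg a0 ab.
exists Z; split => // x nx; apply: hZ => hx; apply: nx => _; rewrite lee_fin.
have [xs|xs] := pselect (shell a b x); last first.
  by rewrite /FI indicE memNset ?mulr0.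
have vx : 0 < vol x by move: xs; rewrite /shell/= in_itv/= => /andP[h _]; exact: lt_le_trans h.
rewrite /FI indicE mem_set ?mulr1//.
rewrite /F /energy_density -hx// /H uV ?(vol_gt0_neq0 N0 vx)// (gtr0_norm (V0 vx)) lerD2l.
exact: powR_enorm_le.
Qed.

End energy.

(** * Escape and decay on a half-line *)

Section escape.
Context {R : realType}.
Implicit Types Y dY H h : R -> R.

Lemma derive_gt0_right Y (t d : R) : is_derive t 1 Y d -> 0 < d ->
  exists2 e : R, 0 < e & forall s, t < s < t + e -> Y t < Y s.
Proof.
move=> [dY YE] d0.
have cv : h^-1 *: (Y (h *: 1 + t) - Y t) @[h --> 0^'] --> d by rewrite -YE; exact: dY.
have := cv => /cvgr_gt/(_ _ d0) [e /= e0 he]; exists e => // s /andP[ts se].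
have h0 : 0 < s - t by rewrite subr_gt0.
have := he (s - t); rewrite /= sub0r normrN gtr0_norm// ltrBlDl => /(_ se).
rewrite gt_eqF// => /(_ isT).
by rewrite -[(s - t) *: 1]/((s - t) * 1) mulr1 subrK -[X in 0 < X]/((s - t)^-1 * _) pmulr_rgt0 ?invr_gt0// subr_gt0.
Qed.

Lemma increment_ge Y dY (a b k : R) : a <= b ->
  (forall t, a <= t <= b -> is_derive t 1 Y (dY t)) ->
  (forall t, a <= t <= b -> k <= dY t) -> k * (b - a) <= Y b - Y a.
Proof.
rewrite le_eqVlt => /predU1P[<-|ab] dYt kd; first by rewrite !subrr mulr0.
have [||c cab ->] := @MVT R Y dY a b ab.
- by move=> x; rewrite in_itv/= => /andP[h1 h2]; apply: dYt; rewrite !ltW.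
- apply: continuous_in_subspaceT => x; rewrite inE/= in_itv/= => xab.
  exact: is_derive_continuous (dYt x xab).
rewrite ler_wpM2r ?subr_ge0 ?(ltW ab)//; apply: kd.
by move: cab; rewrite in_itv/= => /andP[h1 h2]; rewrite !ltW.
Qed.

(** The maximum over an initial segment sits at its right end, as the function
    increases wherever it is above its initial value. *)
Lemma escape Y dY (r1 k : R) : 0 < k ->
  (forall r, r1 <= r -> is_derive r 1 Y (dY r)) ->
  (forall r, r1 <= r -> Y r1 <= Y r -> k <= dY r) ->
  forall r, r1 <= r -> k * (r - r1) <= Y r - Y r1.
Proof.
move=> k0 dYr kd.
suff above r : r1 <= r -> Y r1 <= Y r.
  move=> r r1r; apply: (increment_ge r1r (dY := dY)) => t /andP[rt _]; first exact: dYr.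
  by apply: kd => //; exact: above.
move=> r1r; have cY : {within `[r1, r], continuous Y}.
  apply: continuous_in_subspaceT => x; rewrite inE/= in_itv/= => /andP[rx _].
  exact: is_derive_continuous (dYr x rx).
have [c] := EVT_max r1r cY; rewrite in_itv/= => /andP[rc cr] cmax.
have Yc : Y r1 <= Y c by apply: cmax; rewrite in_itv/= lexx r1r.
have [->//|cr'] := eqVneq r c.
have cltr : c < r by rewrite lt_neqAle cr eq_sym cr'.
have [e e0 he] := derive_gt0_right (dYr c rc) (lt_le_trans k0 (kd c rc Yc)).
pose s := c + Num.min (e / 2) (r - c).
have mpos : 0 < Num.min (e / 2) (r - c) by rewrite lt_min divr_gt0// subr_gt0.
have m1 : Num.min (e / 2) (r - c) <= e / 2 by rewrite ge_min lexx.
have m2 : Num.min (e / 2) (r - c) <= r - c by rewrite ge_min lexx orbT.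
have e2 : e / 2 < e by rewrite ltr_pdivrMr// mulr_natr mulr2n ltrDl.
have cs : c < s by rewrite /s ltrDl.
have se : s < c + e by rewrite /s ltrD2l (le_lt_trans m1).
have sr : s <= r by rewrite /s -lerBrDl.
have := he s; rewrite cs se => /(_ isT).
have : Y s <= Y c by apply: cmax; rewrite in_itv/= sr (le_trans rc (ltW cs)).
by move=> h /(le_lt_trans h); rewrite ltxx.
Qed.

Lemma bounded_nondecreasing_tail H (s1 K : R) :
  (forall s t, s1 <= s -> s <= t -> H s <= H t) -> (forall s, s1 <= s -> H s <= K) ->
  forall ep, 0 < ep -> exists2 T, s1 <= T & forall t, T <= t -> H t - H T <= ep.
Proof.
move=> Hmon HK ep ep0; pose E := [set H t | t in [set t | s1 <= t]].
have hE : has_sup E.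
  split; first by exists (H s1); exists s1 => //=.
  by exists K => _ [t /= st <-]; exact: HK.
have [_ [T /= sT <-] hT] := sup_adherent ep0 hE.
exists T => // t Tt.
have : H t <= sup E.
  by apply: (sup_upper_bound hE); exists t => //=; exact: le_trans Tt.
move: hT; lra.
Qed.

(** The increments of Y are at most c times those of the bounded nondecreasing
    function H, which are small at infinity; and Y <= h = H' is small somewhere on
    every far interval of length 1. *)
Lemma vanish_of_energy Y dY H h (s1 c K : R) : 0 <= c ->
  (forall s, s1 <= s -> is_derive s 1 Y (dY s)) ->
  (forall s, s1 <= s -> is_derive s 1 H (h s)) ->
  (forall s, s1 <= s -> `|dY s| <= c * h s) ->
  (forall s, s1 <= s -> 0 <= Y s <= h s) ->
  (forall s, s1 <= s -> H s <= K) ->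
  forall ep, 0 < ep -> exists T, forall s, T <= s -> Y s <= ep.
Proof.
move=> c0 dYs dHs Yh Yp HK ep ep0.
have Hmon s t : s1 <= s -> s <= t -> H s <= H t.
  move=> ss st; rewrite -subr_ge0 -[leLHS](mul0r (t - s)).
  apply: (increment_ge st (dY := h)) => x /andP[sx _]; first exact/dHs/(le_trans ss).
  by have /andP[h1 h2] := Yp x (le_trans ss sx); exact: le_trans h2.
have d0 : 0 < ep / (c + 1) by rewrite divr_gt0// ltr_wpDl.
have [T sT hT] := bounded_nondecreasing_tail Hmon HK d0.
have TT1 : T < T + 1 by rewrite ltrDl.
have [||x xT Hx] := @MVT R H h T (T + 1) TT1.
- by move=> x; rewrite in_itv/= => /andP[h1 h2]; apply/dHs/(le_trans sT)/ltW.
- apply: continuous_in_subspaceT => x; rewrite inE/= in_itv/= => /andP[Tx _].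
  exact: is_derive_continuous (dHs x (le_trans sT Tx)).
move: xT; rewrite in_itv/= => /andP[Tx xT1].
have sx : s1 <= x by rewrite (le_trans sT)// ltW.
have Yx : Y x <= ep / (c + 1).
  have /andP[_ h2] := Yp x sx; apply: (le_trans h2).
  have := hT (T + 1) (ltW TT1); rewrite Hx; have -> : T + 1 - T = 1 by ring.
  by rewrite mulr1.
exists (T + 1) => s Ts; have xs : x <= s by rewrite (le_trans (ltW xT1)).
have inc : 0 <= (c * H s - Y s) - (c * H x - Y x).
  rewrite -[leLHS](mul0r (s - x)).
  apply: (@increment_ge (fun t => c * H t - Y t) (fun t => c * h t - dY t) x s 0 xs) => t /andP[xt _].
    have D := is_deriveB (is_deriveZ c (dHs t (le_trans sx xt))) (dYs t (le_trans sx xt)).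
    exact: (is_derive_eq D).
  rewrite subr_ge0; apply: le_trans (Yh t (le_trans sx xt)); exact: ler_norm.
have Hs : H s - H x <= ep / (c + 1).
  apply: le_trans (hT s (le_trans (ltW Tx) xs)); rewrite lerD2l lerN2.
  by apply: Hmon => //; exact: ltW.
have cHs : c * (H s - H x) <= c * (ep / (c + 1)) by rewrite ler_wpM2l.
have epE : ep = c * (ep / (c + 1)) + ep / (c + 1).
  by rewrite -[X in _ + X]mul1r -mulrDl mulrC divfK// gt_eqF// ltr_wpDl.
rewrite epE; move: inc cHs Yx; rewrite mulrBr; lra.
Qed.

Lemma is_derive_pow n (r : R) : is_derive r 1 (fun r => r ^+ n) (n%:R * r ^+ n.-1).
Proof.
have D := is_deriveX n (is_derive_id r 1).
rewrite (_ : (fun r => _) = (@id R : R -> R) ^+ n); last first.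
  by apply/funext => t; rewrite fctE.
by apply: (is_derive_eq D); rewrite /GRing.scale/= mulr1.
Qed.

End escape.

(** * The radial equation *)

Section radial_ode.
Context {R : realType} {N : nat} (N1 : (1 < N)%N).
Notation leb := (@lebesgue_measure R).
Notation C := (@ball_volume R N).
Notation rad := (@rad R N).
Notation rim := (@rim R N).

Let N0 : (0 < N)%N. Proof. exact: ltnW. Qed.
Let C0 : 0 < C. Proof. exact: ball_volume_gt0. Qed.

Variables (u : 'rV[R]_N -> R) (U : R -> R) (p mu m : R) (f : R -> R).
Hypotheses (p1 : 1 < p) (cf : continuous f).
Hypothesis hweak : weak_solution p mu m f u.
Hypothesis hrad : radial_profile u U.
Hypothesis hpos : forall x, x != 0 -> 0 < u x.

Let V (s : R) := U (rad s).

Lemma radial_gt0 (r : R) : 0 < r -> 0 < U r.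
Proof.
move=> r0; pose x : 'rV[R]_N := r *: delta_mx ord0 (Ordinal N0).
have xr : enorm x = r.
  rewrite enormZ ?(ltW r0)// -[RHS]mulr1; congr (_ * _).
  rewrite /enorm (_ : dot _ _ = 1) ?sqrtr1// /dot (bigD1 (Ordinal N0))//= !mxE !eqxx mulr1.
  rewrite big1 ?addr0// => j /negbTE ji; rewrite !mxE ji andbF mulr0//.
have x0 : x != 0.
  by apply: contraTneq r0 => x0; rewrite -xr x0 enorm_0 ltxx.
by have := hpos x0; rewrite (hrad.1 x x0) xr.
Qed.

Let uV x : x != 0 -> u x = V (vol x).
Proof. by move=> x0; rewrite hrad.1// /V rad_vol. Qed.

Let cV (s : R) : 0 < s -> {for s, continuous V}.
Proof.
move=> s0; apply: (@continuous_comp R R R rad U); first exact: continuous_rad.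
by apply: hrad.2; exact: rad_gt0.
Qed.

Let V0 (s : R) : 0 < s -> 0 < V s.
Proof. by move=> s0; apply/radial_gt0/rad_gt0. Qed.

Let volr_gt0 (r : R) : 0 < r -> 0 < C * r ^+ N.
Proof. by move=> r0; rewrite mulr_gt0// exprn_gt0. Qed.

Let rimE (r : R) : 0 < r -> rim (C * r ^+ N) = C * N%:R * r ^+ N.-1.
Proof. by move=> r0; rewrite /rim rad_volr// ltW. Qed.

Let is_derive_profile (r : R) : 0 < r ->
  is_derive r 1 U (derive1 V (C * r ^+ N) * rim (C * r ^+ N)).
Proof.
move=> r0.
have dV := profile_is_derive N1 uV cV V0 p1 cf hweak (volr_gt0 r0).
have D := @is_derive1_comp _ V (fun r => C * r ^+ N) r _ _ dV (is_derive_volr r).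
apply: (near_eq_is_derive (f := V \o (fun r => C * r ^+ N))).
  have : \forall t \near r, 0 < t by apply: cvgr_gt (@cvg_id _ _) _ _.
  by apply: filterS => t t0; rewrite /= /V rad_volr// ltW.
by apply: (is_derive_eq D); rewrite rimE// !mulrA.
Qed.

Lemma radial_is_derive (r : R) : 0 < r -> is_derive r 1 U (derive1 U r).
Proof. by move=> r0; rewrite (is_derive1_eq (is_derive_profile r0)).2; exact: is_derive_profile. Qed.

Lemma radial_flux_is_derive (r : R) : 0 < r ->
  is_derive r 1 (fun t => t ^+ N.-1 * angular p (derive1 U t))
    (r ^+ N.-1 * ((m - mu / r `^ p) * U r `^ (p - 1) - f (U r))).
Proof.
move=> r0.
have dF := profile_equation N1 uV cV V0 p1 cf hweak (volr_gt0 r0).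
have D := @is_derive1_comp _ (fun t => angular p (derive1 V t * rim t) * rim t) (fun r => C * r ^+ N) r _ _ dF (is_derive_volr r).
have C00 : C != 0 by rewrite gt_eqF.
have NN0 : N%:R != 0 :> R by rewrite pnatr_eq0 -lt0n.
have D2 := is_deriveZ (C * N%:R)^-1 D.
apply: (near_eq_is_derive (f := (C * N%:R)^-1 \*: ((fun t => angular p (derive1 V t * rim t) * rim t) \o (fun r => C * r ^+ N)))).
  have : \forall t \near r, 0 < t by apply: cvgr_gt (@cvg_id _ _) _ _.
  apply: filterS => t t0; rewrite (is_derive1_eq (is_derive_profile t0)).2 /=.
  rewrite -[LHS]/((C * N%:R)^-1 * (angular p (derive1 V (C * t ^+ N) * rim (C * t ^+ N)) * rim (C * t ^+ N))).
  by rewrite [X in _ * (_ * X)]rimE//; field; rewrite ?C00 ?NN0.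
apply: (is_derive_eq D2).
rewrite -[LHS]/((C * N%:R)^-1 * ((potential V p mu m (C * r ^+ N) - f (V (C * r ^+ N))) * (C * (N%:R * r ^+ N.-1)))).
have rp : r `^ p != 0 by rewrite gt_eqF// powR_gt0.
by rewrite /potential /V rad_volr ?(ltW r0)//; field; rewrite ?C00 ?NN0 ?rp.
Qed.

(** The energy density dominates V^p and, where spheres have area at least 1,
    also its derivative. *)
Lemma radial_vanish (ep : R) : 0 < ep -> exists T, forall r, T <= r -> U r <= ep.
Proof.
move=> ep0; pose h := @energy_density R N V p.
have [K hK] := energy_bound N1 uV cV V0 p1 cf hweak.
have CN : 0 < C * N%:R by rewrite mulr_gt0// ltr0n.
(* Beyond this radius spheres have area at least 1. *)
pose r1 := 1 + (C * N%:R)^-1.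
have r1_1 : 1 <= r1 by rewrite lerDl invr_ge0 ltW.
pose s1 := C * r1 ^+ N.
have s1_gt0 : 0 < s1 by apply: volr_gt0; exact: lt_le_trans r1_1.
have rim1 s : s1 <= s -> 1 <= rim s.
  move=> ss; have s0 : 0 < s by exact: lt_le_trans ss.
  have rr : r1 <= rad s.
    rewrite leNgt; apply/negP => lt; move: ss; rewrite leNgt => /negP; apply.
    rewrite -(radK N0 (ltW s0)) /s1 ltr_pM2l// ltr_pXn2r// ?nnegrE ?rad_ge0//.
    by rewrite (le_trans ler01).
  have : 1 <= C * N%:R * r1.
    by rewrite /r1 mulrDr mulfV ?gt_eqF// mulr1 lerDr ltW.
  move=> /le_trans; apply; rewrite /rim ler_wpM2l ?(ltW CN)// (le_trans rr)//.
  have NE : N.-1 = N.-2.+1 by rewrite prednK// -subn1 subn_gt0.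
  rewrite NE exprS ler_peMr ?rad_ge0// exprn_ege1// (le_trans r1_1)//.
have dV s : s1 <= s -> is_derive s 1 V (derive1 V s).
  by move=> ss; apply: (profile_is_derive N1 uV cV V0 p1 cf hweak); exact: lt_le_trans ss.
have p0 : 0 < p by rewrite (lt_trans ltr01).
have ch s : 0 < s -> {for s, continuous h}.
  exact: (continuous_energy_density N1 uV cV V0 p1 cf hweak).
pose a := s1 / 2.
have a0 : 0 < a by rewrite divr_gt0.
have as1 : a < s1 by rewrite /a; lra.
pose H s := \int[leb]_(t in `[a, s]) h t.
have dH s : s1 <= s -> is_derive s 1 H (h s).
  move=> ss; have s_a : a < s by exact: lt_le_trans ss.
  have ih : leb.-integrable `[a, s + 1] (EFin \o h).
    apply: continuous_compact_integrable; first exact: segment_compact.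
    apply: continuous_in_subspaceT => t; rewrite inE/= in_itv/= => /andP[at_ _].
    by apply: ch; exact: lt_le_trans at_.
  have ss1 : s < s + 1 by rewrite ltrDl.
  have [dF FE] := continuous_FTC1_closed ss1 ih s_a (ch s (lt_trans a0 s_a)).
  by apply: DeriveDef => //; rewrite -derive1E.
pose Y s := V s `^ p; pose dY s := p * V s `^ (p - 1) * derive1 V s.
have dYs s : s1 <= s -> is_derive s 1 Y (dY s).
  move=> ss; have Vs : 0 < V s by apply: V0; exact: lt_le_trans ss.
  have D := is_derive1_comp (is_derive1_powR p Vs) (dV s ss).
  by apply: (is_derive_eq D); rewrite /dY mulrC.
have bd s : s1 <= s -> `|dY s| <= p * h s.
  move=> ss; have Vs : 0 < V s by apply: V0; exact: lt_le_trans ss.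
  rewrite /dY -mulrA normrM (gtr0_norm p0) ler_wpM2l ?(ltW p0)// normrM.
  rewrite (gtr0_norm (powR_gt0 _ Vs)).
  set y := `|derive1 V s|.
  have yy : y <= `|derive1 V s * rim s|.
    by rewrite normrM; apply: ler_peMr; [exact: normr_ge0|exact: le_trans (rim1 s ss) (ler_norm _)].
  have yp : y `^ p <= `|derive1 V s * rim s| `^ p.
    by apply: ge0_ler_powR => //; rewrite ?nnegrE ?normr_ge0 ?(ltW p0).
  rewrite /h /energy_density; apply: (@le_trans _ _ (V s `^ p + y `^ p)); last by rewrite lerD2l.
  have [yV|Vy] := leP y (V s).
    apply: (@le_trans _ _ (V s `^ p)); last by rewrite lerDl powR_ge0.
    by rewrite -(mulr_powRB1 (ltW Vs) p0) mulrC ler_wpM2r ?powR_ge0.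
  apply: (@le_trans _ _ (y `^ p)); last by rewrite lerDr powR_ge0.
  have y0 : 0 <= y := normr_ge0 _.
  rewrite -(mulr_powRB1 y0 p0) mulrC ler_wpM2l//.
  by apply: ge0_ler_powR; rewrite ?nnegrE ?subr_ge0 ?(ltW p1) ?(ltW Vs) ?(ltW Vy) ?normr_ge0.
have bY s : s1 <= s -> 0 <= Y s <= h s.
  by move=> ss; rewrite /h /energy_density powR_ge0/= lerDl powR_ge0.
have bH s : s1 <= s -> H s <= K.
  by move=> ss; apply: hK => //; rewrite (le_trans (ltW as1)).
have epp : 0 < ep `^ p by exact: powR_gt0.
have [T hT] := vanish_of_energy (ltW p0) dYs dH bd bY bH epp.
exists (1 + `|T| / C) => r Tr.
have r1' : 1 <= r by rewrite (le_trans _ Tr)// lerDl divr_ge0// ltW.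
have r0 : 0 < r by exact: lt_le_trans r1'.
have : T <= C * r ^+ N.
  apply: (@le_trans _ _ (C * r)); last first.
    rewrite ler_wpM2l ?(ltW C0)//; case: (N) N0 => // n _.
    by rewrite exprS ler_peMr ?exprn_ege1// ltW.
  apply: (@le_trans _ _ (C * (`|T| / C))).
    by rewrite mulrC divfK ?gt_eqF// ler_norm.
  by rewrite ler_wpM2l ?(ltW C0)// (le_trans _ Tr)// lerDr.
move=> /hT; rewrite /Y /V rad_volr ?(ltW r0)// => h1.
rewrite leNgt; apply/negP => lt; move: h1; rewrite leNgt => /negP; apply.
by rewrite gt0_ltr_powR// ?nnegrE ?(ltW ep0) ?(ltW (radial_gt0 r0)).
Qed.

End radial_ode.

(** * The Riccati equation and the limit of its solution *)

Lemma lt_powRN (R : realType) (a x y : R) : 0 < a -> 0 < x -> x < y -> y `^ (- a) < x `^ (- a).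
Proof.
move=> a0 x0 xy; have y0 : 0 < y by exact: lt_trans xy.
rewrite !powRN ltf_pV2 ?posrE ?powR_gt0//.
by rewrite gt0_ltr_powR// ?nnegrE ltW.
Qed.

Section linear_bounds.
Context {R : realType}.
Implicit Types x y z m w t : R.

Let third_le x y m : 3 * x = y - m -> m + x <= y - 2 * x.
Proof. lra. Qed.

Let third_ge0 x y m : 3 * x = y - m -> 0 < x -> 0 < m -> 0 <= y - 2 * x.
Proof. lra. Qed.

Lemma growth_balance (k c e m w y t : R) : 3 * (k * c) = e * c - m -> 0 < k * c -> 0 < m -> 0 < c ->
  c <= w -> y <= k * w -> t - m <= k * c -> k * w <= e * w - y - t.
Proof.
move=> kE kc m0 c0 cw yk tm.
have pk : 0 <= e - 2 * k.
  by rewrite -(pmulr_lge0 _ c0) mulrBl -mulrA; exact: third_ge0 kE kc m0.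
have h2 : m + k * c <= (e - 2 * k) * w.
  by apply: le_trans (ler_wpM2l pk cw); rewrite mulrBl -mulrA; exact: third_le kE.
move: h2 yk tm; rewrite mulrBl -mulrA.
by move: (k * w) (e * w) (k * c) => a b d; lra.
Qed.

Lemma decay_balance (k d m w y t : R) : 2 * k = m - d -> w <= d -> 0 <= y -> - k <= t - m ->
  k <= - (w - y - t).
Proof. lra. Qed.
End linear_bounds.

Section asymptotics.
Context {R : realType}.
Variables (n : nat) (p m mu q B dl : R) (f U U1 : R -> R).
Hypotheses (p1 : 1 < p) (m0 : 0 < m) (pq : p < q) (B0 : 0 <= B) (dl0 : 0 < dl).
Hypothesis U_gt0 : forall r, 0 < r -> 0 < U r.
Hypothesis dU : forall r : R, 0 < r -> is_derive r 1 U (U1 r).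
Hypothesis dP : forall r : R, 0 < r ->
  is_derive r 1 (fun t => t ^+ n * angular p (U1 t))
    (r ^+ n * ((m - mu / r `^ p) * U r `^ (p - 1) - f (U r))).
Hypothesis U_vanish : forall ep, 0 < ep -> exists T, forall r, T <= r -> U r <= ep.
Hypothesis f_small : forall t, 0 < t -> t <= dl -> `|f t| <= B * t `^ (q - 1).

Let p0 : 0 < p. Proof. exact: lt_trans p1. Qed.
Let p10 : 0 < p - 1. Proof. by rewrite subr_gt0. Qed.

Notation rest := (fun r => f (U r) / U r `^ (p - 1)).
Notation pot := (fun r => m - mu / r `^ p - f (U r) / U r `^ (p - 1)).

Lemma near_pinfty (P : R -> Prop) : (exists T, forall r, T <= r -> P r) <-> (\forall r \near +oo, P r).
Proof.
split=> [[T hT]|[T [_ hT]]].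
  by exists T; split; [exact: num_real|move=> r /ltW /hT].
by exists (T + 1) => r Tr; apply: hT; rewrite (lt_le_trans _ Tr)// ltrDl.
Qed.

Lemma near_ge (T : R) : \forall r \near +oo, T <= r.
Proof. by apply/near_pinfty; exists T. Qed.

Lemma rest_le r : 0 < r -> U r <= dl -> `|rest r| <= B * U r `^ (q - p).
Proof.
move=> r0 Ur; have U0 := U_gt0 r0; have Up : 0 < U r `^ (p - 1) by exact: powR_gt0.
rewrite normrM normfV (gtr0_norm Up) ler_pdivrMr//.
apply: (le_trans (f_small U0 Ur)); rewrite -mulrA -powRD.
  by have -> : q - p + (p - 1) = q - 1 by ring.
by rewrite (gt_eqF U0) implybT.
Qed.

Lemma rest_vanish ep : 0 < ep -> \forall r \near +oo, `|rest r| <= ep.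
Proof.
move=> ep0.
have qp : 0 < q - p by rewrite subr_gt0.
have e1 : 0 < ep / (B + 1) by rewrite divr_gt0// ltr_wpDl.
pose e2 := (ep / (B + 1)) `^ (q - p)^-1.
have e20 : 0 < e2 by exact: powR_gt0.
have e2E : e2 `^ (q - p) = ep / (B + 1).
  by rewrite /e2 -powRrM mulVf ?gt_eqF// powRr1// ltW.
have h1 : \forall r \near +oo, U r <= dl by apply/near_pinfty; exact: U_vanish.
have h2 : \forall r \near +oo, U r <= e2 by apply/near_pinfty; exact: U_vanish.
near=> r.
have r0 : 0 < r by rewrite (@lt_le_trans _ _ 1)//; near: r; exact: near_ge.
have Ud : U r <= dl by near: r.
have Ue : U r <= e2 by near: r.
apply: (le_trans (rest_le r0 Ud)).
have : U r `^ (q - p) <= ep / (B + 1).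
  by rewrite -e2E; apply: ge0_ler_powR; rewrite ?nnegrE ?(ltW qp) ?(ltW (U_gt0 r0)) ?(ltW e20).
move=> /(ler_wpM2l B0) /le_trans; apply.
rewrite mulrA ler_pdivrMr; last by rewrite ltr_wpDl.
by rewrite mulrDr mulr1 [X in X <= _]mulrC lerDl ltW.
Unshelve. all: by end_near. Qed.

Lemma inv_powR_vanish (a ep : R) : 0 < a -> 0 < ep -> \forall r \near +oo, (r `^ a)^-1 <= ep.
Proof.
move=> a0 ep0; near=> r.
have h : ep^-1 `^ a^-1 <= r by near: r; exact: near_ge.
have z0 : 0 < ep^-1 `^ a^-1 by rewrite powR_gt0// invr_gt0.
have r0 : 0 < r by exact: lt_le_trans h.
rewrite -[leRHS]invrK lef_pV2 ?posrE ?powR_gt0 ?invr_gt0//.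
have -> : ep^-1 = (ep^-1 `^ a^-1) `^ a.
  by rewrite -powRrM mulVf ?gt_eqF// powRr1// invr_ge0 ltW.
by apply: ge0_ler_powR; rewrite ?nnegrE ?(ltW a0) ?(ltW z0) ?(ltW r0).
Unshelve. all: by end_near. Qed.

Lemma pot_cvg ep : 0 < ep -> \forall r \near +oo, `|pot r - m| <= ep.
Proof.
move=> ep0; have e2 : 0 < ep / 2 by rewrite divr_gt0.
have e3 : 0 < ep / 2 / (`|mu| + 1) by rewrite divr_gt0// ltr_wpDl.
have h1 := rest_vanish e2; have h2 := inv_powR_vanish p0 e3.
near=> r.
have -> : pot r - m = - (mu / r `^ p) - rest r by ring.
apply: (le_trans (ler_normB _ _)); rewrite normrN normrM.
have H1 : `|rest r| <= ep / 2 by near: r.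
have H2 : (r `^ p)^-1 <= ep / 2 / (`|mu| + 1) by near: r.
have H3 : `|mu| * `|(r `^ p)^-1| <= ep / 2.
  have H2' : `|(r `^ p)^-1| <= ep / 2 / (`|mu| + 1) by rewrite ger0_norm ?invr_ge0 ?powR_ge0.
  have := ler_wpM2l (normr_ge0 mu) H2'.
  move=> /le_trans; apply; rewrite mulrA ler_pdivrMr; last by rewrite ltr_wpDl.
  by rewrite mulrDr mulr1 [X in X <= _]mulrC lerDl ltW.
by move: H1 H3; set x := `|rest r|; set y := _ * `|_|; lra.
Unshelve. all: by end_near. Qed.

Let P r := r ^+ n * angular p (U1 r).

Let dPE r : 0 < r -> r ^+ n * ((m - mu / r `^ p) * U r `^ (p - 1) - f (U r)) =
  r ^+ n * U r `^ (p - 1) * pot r.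
Proof.
move=> r0; have : U r `^ (p - 1) != 0 by rewrite gt_eqF// powR_gt0// U_gt0.
have h2 : r `^ p != 0 by rewrite gt_eqF// powR_gt0.
by move=> h; field; rewrite h h2.
Qed.

Let near_gt0 : \forall r \near +oo, 0 < r :> R.
Proof. by have := near_ge 1; apply: filterS => r; exact: lt_le_trans. Qed.

Lemma pot_gt0 : \forall r \near +oo, m / 2 <= pot r.
Proof.
have m2 : 0 < m / 2 by rewrite divr_gt0.
have := pot_cvg m2; apply: filterS => r; rewrite ler_norml => /andP[+ _].
by set x := pot r; lra.
Qed.

(** The flux increases eventually; were it ever nonnegative, the positive
    profile would increase from then on instead of vanishing. *)
Lemma derivative_lt0 : \forall r \near +oo, U1 r < 0.
Proof.
have [T hT] := (near_pinfty _).2 (filterI pot_gt0 near_gt0).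
have Pinc r s : T <= r -> r < s -> P r < P s.
  move=> Tr rs.
  have r0 : 0 < r by have [] := hT r Tr.
  have [||c cab E] := @MVT R P (fun r => r ^+ n * ((m - mu / r `^ p) * U r `^ (p - 1) - f (U r))) r s rs.
  - by move=> x; rewrite in_itv/= => /andP[rx _]; apply: dP; exact: lt_trans rx.
  - apply: continuous_in_subspaceT => x; rewrite inE/= in_itv/= => /andP[rx _].
    exact: (is_derive_continuous (f := fun r => r ^+ n * ((m - mu / r `^ p) * U r `^ (p - 1) - f (U r))) (dP (lt_le_trans r0 rx))).
  rewrite -subr_gt0 E mulr_gt0 ?subr_gt0//.
  move: cab; rewrite in_itv/= => /andP[rc _].
  have c0 : 0 < c by exact: lt_trans rc.
  rewrite dPE// mulr_gt0//; first by rewrite mulr_gt0 ?exprn_gt0 ?powR_gt0 ?U_gt0.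
  have [h _] := hT c (le_trans Tr (ltW rc)); apply: lt_le_trans h.
  by rewrite divr_gt0.
apply/near_pinfty; exists (T + 1) => r Tr; rewrite ltNge; apply/negP => Ur.
have Tr' : T <= r by rewrite (le_trans _ Tr)// lerDl.
have r0 : 0 < r by have [] := hT r Tr'.
have U1s s : r <= s -> 0 <= U1 s.
  rewrite le_eqVlt => /predU1P[<-//|rs].
  have P0 : 0 <= P r by rewrite /P mulr_ge0 ?exprn_ge0 ?(ltW r0)// mulr_ge0 ?powR_ge0.
  have := le_lt_trans P0 (Pinc r s Tr' rs).
  rewrite /P pmulr_rgt0 ?exprn_gt0 ?(lt_trans r0 rs)// /angular => h.
  rewrite leNgt; apply/negP => U1s; move: h; rewrite ltNge => /negP; apply.
  by rewrite mulr_ge0_le0 ?powR_ge0// ltW.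
have Ur2 : 0 < U r / 2 by rewrite divr_gt0// U_gt0.
have [S hS] := U_vanish Ur2.
pose s := Num.max r S.
have rs : r <= s by rewrite le_max lexx.
have Ss : S <= s by rewrite le_max lexx orbT.
have := hS s Ss; have : 0 * (s - r) <= U s - U r.
  apply: (@increment_ge R U U1 r s 0 rs) => t /andP[rt _]; last exact: U1s.
  by apply: dU; exact: lt_le_trans rt.
by rewrite mul0r subr_ge0 => /le_trans/[apply]; have := U_gt0 r0; lra.
Qed.

(** The quantity to be expanded. It obeys a first-order equation because it is
    the flux divided by - r^n U^(p-1). *)
Definition riccati r := (- U1 r / U r) `^ (p - 1).

Let pp := p / (p - 1).

Let riccatiE r : 0 < r -> U1 r < 0 -> riccati r = - P r / (r ^+ n * U r `^ (p - 1)).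
Proof.
move=> r0 Ur; have U0 := U_gt0 r0; have r00 : r != 0 by rewrite gt_eqF.
have N0 : 0 < - U1 r by rewrite oppr_gt0.
rewrite /riccati /P /angular powRM ?ltW ?invr_gt0//.
rewrite -powR_inv1 ?(ltW U0)// -powRrM mulN1r powRN ltr0_norm//.
have -> : (- U1 r) `^ (p - 1) = (- U1 r) `^ (p - 2) * (- U1 r).
  rewrite (_ : p - 1 = (p - 2) + 1); last by ring.
  by rewrite [LHS]powRD ?(gt_eqF N0) ?implybT// powRr1// ltW.
have : U r `^ (p - 1) != 0 by rewrite gt_eqF// powR_gt0.
by move=> h; field; rewrite h /= expf_neq0.
Qed.

Lemma riccati_gt0 r : 0 < r -> U1 r < 0 -> 0 < riccati r.
Proof. by move=> r0 Ur; rewrite powR_gt0// divr_gt0 ?oppr_gt0// U_gt0. Qed.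

Lemma riccati_root r : 0 < r -> U1 r < 0 -> riccati r `^ (p - 1)^-1 = - U1 r / U r.
Proof.
move=> r0 Ur; rewrite /riccati -powRrM mulfV ?gt_eqF// powRr1//.
by rewrite divr_ge0 ?oppr_ge0 ?ltW// U_gt0.
Qed.

Let ppE : pp = 1 + (p - 1)^-1.
Proof.
have h : p - 1 != 0 by rewrite gt_eqF.
by rewrite /pp; field.
Qed.

Lemma is_derive_riccati r : (\forall s \near r, 0 < s /\ U1 s < 0) ->
  is_derive r 1 riccati ((p - 1) * riccati r `^ pp - n%:R * riccati r / r - pot r).
Proof.
move=> hn; have [r0 Ur] : 0 < r /\ U1 r < 0 by exact: nbhs_singleton hn.
have U0 := U_gt0 r0; have r00 : r != 0 by rewrite gt_eqF.
have Up : U r `^ (p - 1) != 0 by rewrite gt_eqF// powR_gt0.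
have rn0 : r ^+ n != 0 by rewrite expf_neq0.
apply: (near_eq_is_derive (f := fun s => - P s / (s ^+ n * U s `^ (p - 1)))).
  by apply: filterS hn => s [s0 Us]; rewrite riccatiE.
have dUp : is_derive r 1 (fun s => U s `^ (p - 1)) ((p - 1) * U r `^ (p - 2) * U1 r).
  have D := @is_derive1_comp _ (fun z => z `^ (p - 1)) U r _ _ (is_derive1_powR _ U0) (dU r0).
  apply: (is_derive_eq D); have -> : p - 1 - 1 = p - 2 by ring.
  by rewrite mulrC.
have dX := is_derive_pow n r.
have dD := is_deriveM dX dUp.
have D0 : r ^+ n * U r `^ (p - 1) != 0 by rewrite mulf_neq0.
have dV := @is_deriveV _ (fun s => s ^+ n * U s `^ (p - 1)) r _ 1 D0 dD.
have D := is_deriveM (is_deriveN (dP r0)) dV.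
apply: (is_derive_eq D); rewrite dPE// /GRing.scale/=.
have rE : riccati r * (r ^+ n * U r `^ (p - 1)) = - P r by rewrite riccatiE// divfK.
have -> : riccati r `^ pp = riccati r * (- U1 r / U r).
  have R0 := riccati_gt0 r0 Ur.
  by rewrite ppE powRD ?(gt_eqF R0) ?implybT// powRr1 ?(ltW R0)// riccati_root.
have Up2 : U r `^ (p - 1) = U r `^ (p - 2) * U r.
  rewrite (_ : p - 1 = (p - 2) + 1); last by ring.
  by rewrite powRD ?(gt_eqF U0) ?implybT// powRr1// ltW.
have nE : n%:R * r ^+ n.-1 = n%:R * r ^+ n / r.
  case: (n) => [|k]; first by rewrite !mul0r.
  by rewrite exprS /=; field.
rewrite nE riccatiE//; rewrite Up2 in Up *.
have U00 : U r != 0 by rewrite gt_eqF.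
have Um : U r `^ (p - 2) != 0 by rewrite gt_eqF// powR_gt0.
rewrite (_ : (- (fun t : R => t ^+ n * angular p (U1 t))) r = - P r)//.
rewrite /P; field.
have rp : r `^ p != 0 by rewrite gt_eqF// powR_gt0.
by rewrite U00 r00 Um rn0 rp.
Qed.

Let good : \forall r \near +oo, forall s, r <= s -> 0 < s /\ U1 s < 0.
Proof.
have [T hT] := (near_pinfty _).2 (filterI derivative_lt0 near_gt0).
apply/near_pinfty; exists T => r Tr s rs.
by have [] := hT s (le_trans Tr rs).
Qed.

Let near_good r : (forall s, r <= s -> 0 < s /\ U1 s < 0) ->
  forall s, r < s -> \forall t \near s, 0 < t /\ U1 t < 0.
Proof.
move=> h s rs; have : \forall t \near s, r < t by apply: cvgr_gt (@cvg_id _ _) _ _.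
by apply: filterS => t /ltW /h.
Qed.

Lemma riccati_eventually : exists T, 0 < T /\ forall r, T <= r ->
  [/\ 0 < riccati r, U1 r < 0 &
     is_derive r 1 riccati ((p - 1) * riccati r `^ pp - n%:R * riccati r / r - pot r)].
Proof.
have [T hT] := (near_pinfty _).2 good.
have gT := hT T (lexx T); have [T0 _] := gT T (lexx T).
exists (T + 1); split; first by rewrite ltr_wpDl// ltW.
move=> r Tr; have Tr1 : T < r by rewrite (lt_le_trans _ Tr)// ltrDl.
have [r0 Ur] := gT r (ltW Tr1); split => //; first exact: riccati_gt0.
exact: (is_derive_riccati (near_good gT Tr1)).
Qed.

(** The positive zero of (p-1) w^(p/(p-1)) - m. *)
Definition riccati_limit := (m / (p - 1)) `^ ((p - 1) / p).

Lemma riccati_limit_gt0 : 0 < riccati_limit.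
Proof. by rewrite powR_gt0// divr_gt0. Qed.

Let p00 : p != 0. Proof. by rewrite gt_eqF. Qed.
Let p100 : p - 1 != 0. Proof. by rewrite gt_eqF. Qed.
Let pp0 : 0 < pp. Proof. by rewrite divr_gt0. Qed.

Lemma riccati_limitE : (p - 1) * riccati_limit `^ pp = m.
Proof.
rewrite /riccati_limit -powRrM /pp.
have -> : (p - 1) / p * (p / (p - 1)) = 1 by field; rewrite p100 p00.
by rewrite powRr1 ?divr_ge0 ?ltW// mulrC divfK.
Qed.

(** Below the limit value the derivative is at most a negative constant, so the
    positive solution would become negative. *)
Lemma riccati_lower ep : 0 < ep -> ep < riccati_limit ->
  \forall r \near +oo, riccati_limit - ep <= riccati r.
Proof.
move=> ep0 epc; have [T [T0 hT]] := riccati_eventually.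
have [k k0 kE] : exists2 k, 0 < k & 2 * k = m - (p - 1) * (riccati_limit - ep) `^ pp.
  exists ((m - (p - 1) * (riccati_limit - ep) `^ pp) / 2); last by field.
  rewrite divr_gt0// subr_gt0 -riccati_limitE ltr_pM2l//.
  by rewrite gt0_ltr_powR// ?nnegrE ?subr_ge0 ?(ltW epc) ?(ltW riccati_limit_gt0)// gtrBl.
have [S hS] := (near_pinfty _).2 (pot_cvg k0).
apply/near_pinfty; exists (Num.max S T) => r; rewrite ge_max => /andP[Sr Tr].
rewrite leNgt; apply/negP => wr.
pose Y := fun s => - riccati s.
pose dY s := - ((p - 1) * riccati s `^ pp - n%:R * riccati s / s - pot s).
have E := @escape R Y dY r k k0.
have dYs s : r <= s -> is_derive s 1 Y (dY s).
  by move=> rs; have [_ _ D] := hT s (le_trans Tr rs); exact: is_deriveN D.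
have kY s : r <= s -> Y r <= Y s -> k <= dY s.
  move=> rs; rewrite /Y lerN2 => ws; have [w0 _ _] := hT s (le_trans Tr rs).
  have s0 : 0 < s by rewrite (lt_le_trans T0)// (le_trans Tr).
  have h1 : riccati s `^ pp <= (riccati_limit - ep) `^ pp.
    apply: ge0_ler_powR; rewrite ?nnegrE ?(ltW pp0) ?(ltW w0) ?subr_ge0 ?(ltW epc)//.
    exact: le_trans ws (ltW wr).
  have h2 : (p - 1) * riccati s `^ pp <= (p - 1) * (riccati_limit - ep) `^ pp.
    by rewrite ler_wpM2l// ltW.
  have h3 : 0 <= n%:R * riccati s / s by rewrite divr_ge0 ?mulr_ge0 ?(ltW w0) ?(ltW s0).
  have h4 := hS s (le_trans Sr rs); move: h4; rewrite ler_norml => /andP[h4 _].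
  exact: decay_balance kE h2 h3 h4.
have wr0 : 0 < riccati r by have [] := hT r Tr.
pose s := r + riccati r / k.
have rs : r <= s by rewrite lerDl divr_ge0// ltW.
have := E dYs kY s rs; rewrite /s addrAC subrr add0r mulrC divfK ?gt_eqF// /Y opprK.
have [ws _ _] := hT s (le_trans Tr rs).
by move: ws; rewrite -/s; move: (riccati s) (riccati r) => x y; lra.
Qed.

(** Above the limit value the equation blows up in finite time. *)
Lemma riccati_upper ep : 0 < ep -> \forall r \near +oo, riccati r <= riccati_limit + ep.
Proof.
move=> ep0; have [T [T0 hT]] := riccati_eventually.
have c0 := riccati_limit_gt0; set c1 := riccati_limit + ep.
have c10 : 0 < c1 by rewrite addr_gt0.
have pc1 : 0 < c1 `^ pp by exact: powR_gt0.
have mlt : m < (p - 1) * c1 `^ pp.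
  rewrite -riccati_limitE ltr_pM2l//.
  by rewrite gt0_ltr_powR// ?nnegrE ?(ltW c0) ?(ltW c10)// ltrDl.
have [k k0 kE] : exists2 k, 0 < k & 3 * (k * c1 `^ pp) = (p - 1) * c1 `^ pp - m.
  exists (((p - 1) * c1 `^ pp - m) / c1 `^ pp / 3); first by rewrite !divr_gt0// subr_gt0.
  by field; rewrite gt_eqF.
have kp : 0 < k * c1 `^ pp by rewrite mulr_gt0.
have qk : 0 < k * c1 `^ (p - 1)^-1 by rewrite mulr_gt0// powR_gt0.
have [S hS] := (near_pinfty _).2 (pot_cvg kp).
have n1 : 0 < n%:R + 1 :> R by rewrite ltr_wpDl.
pose S2 := (n%:R + 1) / (k * c1 `^ (p - 1)^-1).
apply/near_pinfty; exists (Num.max S (Num.max S2 T)) => r; rewrite !ge_max => /and3P[Sr S2r Tr].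
rewrite leNgt; apply/negP => wr.
pose a := (p - 1)^-1.
have a0 : 0 < a by rewrite invr_gt0.
(* In terms of w^(-1/(p-1)), the blow-up of w is a crossing of 0 at bounded speed. *)
pose Y := fun s => - (riccati s `^ (- a)).
pose rhs s := (p - 1) * riccati s `^ pp - n%:R * riccati s / s - pot s.
pose dY s := a * riccati s `^ (- a - 1) * rhs s.
have wpos s : r <= s -> 0 < riccati s by move=> rs; have [] := hT s (le_trans Tr rs).
have dYs s : r <= s -> is_derive s 1 Y (dY s).
  move=> rs; have [w0 _ D] := hT s (le_trans Tr rs).
  have D1 := @is_derive1_comp _ (fun z => z `^ (- a)) riccati s _ _ (is_derive1_powR _ w0) D.
  have D2 := is_deriveN D1.
  by apply: (is_derive_eq D2); rewrite /dY /rhs; ring.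
have ak : 0 < a * k by rewrite mulr_gt0.
have E := @escape R Y dY r (a * k) ak.
have kY s : r <= s -> Y r <= Y s -> a * k <= dY s.
  move=> rs; rewrite /Y lerN2 => ws; have w0 := wpos s rs.
  have s0 : 0 < s by rewrite (lt_le_trans T0)// (le_trans Tr).
  have wrs : c1 <= riccati s.
    rewrite leNgt; apply/negP => lt; move: ws; rewrite leNgt => /negP; apply.
    exact: (lt_powRN a0 w0 (lt_trans lt wr)).
  have r1 : c1 `^ pp <= riccati s `^ pp.
    by apply: ge0_ler_powR; rewrite ?nnegrE ?(ltW pp0) ?(ltW w0) ?(ltW c10).
  have r2 : c1 `^ a <= riccati s `^ a.
    by apply: ge0_ler_powR; rewrite ?nnegrE ?(ltW a0) ?(ltW w0) ?(ltW c10).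
  have wE : riccati s `^ pp = riccati s * riccati s `^ a.
    by rewrite ppE powRD ?(gt_eqF w0) ?implybT// powRr1// ltW.
  have h1 : n%:R * riccati s / s <= k * riccati s `^ pp.
    rewrite ler_pdivrMr// wE.
    have S2s : n%:R <= k * c1 `^ a * s.
      have : S2 <= s by exact: le_trans rs.
      rewrite /S2 ler_pdivrMr// mulrC; apply: le_trans.
      by rewrite lerDl.
    have : n%:R * riccati s <= k * c1 `^ a * s * riccati s by rewrite ler_wpM2r// ltW.
    move=> /le_trans; apply; rewrite -!mulrA ler_wpM2l ?(ltW k0)//.
    have -> : riccati s * (riccati s `^ a * s) = riccati s `^ a * (s * riccati s) by ring.
    by rewrite ler_wpM2r// mulr_ge0// ltW.
  have h4 := hS s (le_trans Sr rs); move: h4; rewrite ler_norml => /andP[_ h4].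
  have h5 : k * riccati s `^ pp <= rhs s by exact: growth_balance kE kp m0 pc1 r1 h1 h4.
  rewrite /dY -mulrA ler_wpM2l ?(ltW a0)//.
  have h6 := ler_wpM2l (powR_ge0 (riccati s) (- a - 1)) h5.
  apply: le_trans h6; rewrite mulrCA -powRD ?(gt_eqF w0) ?implybT//.
  by rewrite ppE -/a (_ : - a - 1 + (1 + a) = 0) ?powRr0 ?mulr1//; ring.
pose s := r + riccati r `^ (- a) / (a * k).
have rs : r <= s by rewrite lerDl divr_ge0 ?powR_ge0// ltW.
have := E dYs kY s rs; rewrite /s addrAC subrr add0r mulrC divfK ?gt_eqF// /Y opprK.
have := powR_gt0 (- a) (wpos s rs).
by rewrite -/s; move: (riccati s `^ (- a)) (riccati r `^ (- a)) => x y; lra.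
Qed.

End asymptotics.

(** * Orders of decay and unstable linear equations *)

Section domination.
Context {R : realType}.

(** With the exponent as an explicit natural number, the order of a product or
    a power is computed by addition and multiplication of exponents. *)
Definition decays (k : nat) (g : R -> R) :=
  exists2 K : R, 0 <= K & \forall r \near +oo, `|g r| <= K / r ^+ k.

Lemma decays_eq k (g h : R -> R) : (\forall r \near +oo, g r = h r) -> decays k g -> decays k h.
Proof.
move=> gh [K K0 hK]; exists K => //; near=> r.
have <- : g r = h r by near: r.
by near: r.
Unshelve. all: by end_near. Qed.

Lemma decaysD k (g h : R -> R) : decays k g -> decays k h -> decays k (fun r => g r + h r).
Proof.
move=> [K K0 hK] [L L0 hL]; exists (K + L); first by rewrite addr_ge0.
near=> r; apply: (le_trans (ler_normD _ _)); rewrite mulrDl.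
by apply: lerD; near: r.
Unshelve. all: by end_near. Qed.

Lemma decaysM k l (g h : R -> R) : decays k g -> decays l h -> decays (k + l) (fun r => g r * h r).
Proof.
move=> [K K0 hK] [L L0 hL]; exists (K * L); first by rewrite mulr_ge0.
near=> r; rewrite normrM exprD invfM mulrACA.
by apply: ler_pM => //; near: r.
Unshelve. all: by end_near. Qed.

Lemma decays_cst (c : R) : decays 0 (fun=> c).
Proof. by exists `|c| => //; apply: nearW => r; rewrite expr0 divr1. Qed.

Lemma decaysZ k (c : R) (g : R -> R) : decays k g -> decays k (fun r => c * g r).
Proof. by move=> /(decaysM (decays_cst c)). Qed.

Lemma decaysN k (g : R -> R) : decays k g -> decays k (fun r => - g r).
Proof. by move=> [K K0 hK]; exists K => //; apply: filterS hK => r; rewrite normrN. Qed.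

Lemma decaysW k l (g : R -> R) : (l <= k)%N -> decays k g -> decays l g.
Proof.
move=> lk [K K0 hK]; exists K => //; near=> r.
have r1 : 1 <= r by near: r; exact: near_ge.
have r0 : 0 < r by exact: lt_le_trans r1.
apply: (@le_trans _ _ (K / r ^+ k)); first by near: r.
by rewrite ler_wpM2l// lef_pV2 ?posrE ?exprn_gt0// ler_weXn2l.
Unshelve. all: by end_near. Qed.

Lemma decays_inv k : decays k (fun r : R => r^-1 ^+ k).
Proof.
exists 1 => //; near=> r.
have r0 : 0 <= r by near: r; exact: near_ge.
by rewrite mul1r exprVn ger0_norm// invr_ge0 exprn_ge0.
Unshelve. all: by end_near. Qed.

Lemma decays_powR k (a : R) : k%:R <= a -> decays k (fun r : R => (r `^ a)^-1).
Proof.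
move=> ka; exists 1 => //; near=> r.
have r1 : 1 <= r by near: r; exact: near_ge.
have r0 : 0 < r by exact: lt_le_trans r1.
rewrite mul1r ger0_norm ?invr_ge0 ?powR_ge0// lef_pV2 ?posrE ?powR_gt0 ?exprn_gt0//.
by rewrite -powR_mulrn ?(ltW r0)// ler_powR.
Unshelve. all: by end_near. Qed.

Lemma decays_sum k (I : eqType) (s : seq I) (g : I -> R -> R) : (forall i, i \in s -> decays k (g i)) ->
  decays k (fun r => \sum_(i <- s) g i r).
Proof.
elim: s => [|i s IH] h.
  by exists 0 => //; apply: nearW => r; rewrite big_nil normr0 mul0r.
have E := decaysD (h i (mem_head _ _)) (IH (fun j js => h j (mem_behead (s := i :: s) js))).
by apply: decays_eq E; apply: nearW => r; rewrite big_cons.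
Qed.

Lemma decaysX k (g : R -> R) n : decays k g -> decays (n * k) (fun r => g r ^+ n).
Proof.
move=> dg; elim: n => [|n IH]; first exact: decays_cst.
apply: decays_eq (decaysM dg IH); apply: nearW => r; by rewrite exprS.
Qed.

Lemma decays_vanish (g : R -> R) (ep : R) : decays 1 g -> 0 < ep -> \forall r \near +oo, `|g r| <= ep.
Proof.
move=> [K K0 hK] ep0; near=> r.
have r1 : 1 <= r by near: r; exact: near_ge.
have r0 : 0 < r by exact: lt_le_trans r1.
have Kr : K / ep <= r by near: r; exact: near_ge.
apply: (@le_trans _ _ (K / r ^+ 1)); first by near: r.
by rewrite expr1 ler_pdivrMr// mulrC -ler_pdivrMr.
Unshelve. all: by end_near. Qed.

Lemma decays_norm_le k (g h : R -> R) : (\forall r \near +oo, `|g r| <= `|h r|) -> decays k h -> decays k g.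
Proof.
move=> gh [K K0 hK]; exists K => //; near=> r.
apply: (@le_trans _ _ `|h r|); by near: r.
Unshelve. all: by end_near. Qed.

Let one_sided (z dz : R -> R) (a1 B M : R) k (T : R) : 0 < T -> 0 < a1 -> 0 <= B ->
  (forall r, T <= r -> is_derive r 1 z (dz r)) ->
  (forall r, T <= r -> 0 <= z r -> a1 * z r - B / r ^+ k <= dz r) ->
  (forall r, T <= r -> z r <= M) ->
  forall r, T <= r -> z r <= (B / a1) / r ^+ k.
Proof.
move=> T0 a10 B0 dzr zr zM r Tr; rewrite leNgt; apply/negP => zr'.
set K := B / a1 in zr'; have K0 : 0 <= K by rewrite divr_ge0// ltW.
have KB : a1 * K = B by rewrite mulrC divfK// gt_eqF.
pose Y s := z s - K * (s ^+ k)^-1.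
pose dY s := dz s - K * (- (s ^+ k) ^- 2 * (k%:R * s ^+ k.-1)).
have Yr : 0 < Y r by rewrite subr_gt0.
have aY : 0 < a1 * Y r by rewrite mulr_gt0.
have pos s : r <= s -> 0 < s by move=> rs; rewrite (lt_le_trans T0)// (le_trans Tr).
have dYs s : r <= s -> is_derive s 1 Y (dY s).
  move=> rs; have sk : s ^+ k != 0 by rewrite expf_neq0// gt_eqF// pos.
  have dV := @is_deriveV _ (fun s => s ^+ k) s _ 1 sk (is_derive_pow k s).
  have D := is_deriveB (dzr s (le_trans Tr rs)) (is_deriveZ K dV).
  exact: (is_derive_eq D).
have kY s : r <= s -> Y r <= Y s -> a1 * Y r <= dY s.
  move=> rs Yrs; have s0 := pos s rs.
  have Ks : 0 <= K * (s ^+ k)^-1 by rewrite mulr_ge0// invr_ge0 exprn_ge0// ltW.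
  have z0 : 0 <= z s.
    by rewrite -[z s](subrK (K * (s ^+ k)^-1)) addr_ge0// (le_trans (ltW Yr)).
  have h1 := zr s (le_trans Tr rs) z0.
  have h2 : a1 * Y r <= a1 * z s - B / s ^+ k.
    have -> : a1 * z s - B / s ^+ k = a1 * Y s by rewrite /Y mulrBr mulrA KB.
    by rewrite ler_wpM2l// ltW.
  apply: (le_trans h2); apply: (le_trans h1).
  rewrite /dY lerBrDr gerDl mulNr mulrN oppr_le0 mulr_ge0//.
  by rewrite mulr_ge0 ?invr_ge0 ?sqr_ge0// mulr_ge0// exprn_ge0// ltW.
pose s := r + (`|M| / (a1 * Y r) + 1).
have rs : r <= s by rewrite lerDl addr_ge0// divr_ge0// ltW.
have E := @escape R Y dY r (a1 * Y r) aY dYs kY s rs.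
have : Y s <= M.
  apply: le_trans (zM s (le_trans Tr rs)); rewrite gerBl mulr_ge0// invr_ge0 exprn_ge0// ltW//.
  exact: pos.
have E2 : a1 * Y r * (s - r) = `|M| + a1 * Y r.
  by rewrite /s addrAC subrr add0r mulrDr mulr1 mulrC divfK// gt_eqF.
move: E; rewrite E2; have := ler_norm M.
move: Yr aY; move: (Y s) (Y r) (a1 * Y r) `|M| => x y w v; lra.
Qed.

(** An unstable linear equation forces a bounded solution to be as small as
    the forcing term. *)
Lemma unstable_bound (z dz : R -> R) (a1 B M : R) k (T : R) : 0 < T -> 0 < a1 -> 0 <= B ->
  (forall r, T <= r -> is_derive r 1 z (dz r)) ->
  (forall r, T <= r -> 0 <= z r -> a1 * z r - B / r ^+ k <= dz r) ->
  (forall r, T <= r -> z r <= 0 -> dz r <= a1 * z r + B / r ^+ k) ->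
  (forall r, T <= r -> `|z r| <= M) -> decays k z.
Proof.
move=> T0 a10 B0 dzr z1 z2 zM; exists (B / a1); first by rewrite divr_ge0// ltW.
apply/near_pinfty; exists T => r Tr; rewrite ler_norml; apply/andP; split; last first.
  apply: (one_sided T0 a10 B0 dzr z1 (M := M)) => // s Ts.
  exact: le_trans (ler_norm _) (zM s Ts).
rewrite lerNl.
apply: (one_sided (z := fun s => - z s) (dz := fun s => - dz s) (M := M) T0 a10 B0) => // s Ts.
- exact: is_deriveN (dzr s Ts).
- rewrite oppr_ge0 => zs; have := z2 s Ts zs.
  by rewrite mulrN; move: (dz s) (a1 * z s) (B / s ^+ k) => x y w; lra.
- by apply: le_trans (zM s Ts); rewrite -normrN ler_norm.
Qed.

(** The derivative of the power is nondecreasing, hence at least its value at d. *)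
Lemma powR_slope (al d x y : R) : 1 <= al -> 0 < d -> d <= x -> x <= y ->
  al * d `^ (al - 1) * (y - x) <= y `^ al - x `^ al.
Proof.
move=> al1 d0 dx xy.
apply: (@increment_ge R (fun t => t `^ al) (fun t => al * t `^ (al - 1)) x y _ xy) => t /andP[xt _].
  by apply: is_derive1_powR; rewrite (lt_le_trans d0)// (le_trans dx).
have al0 : 0 <= al by rewrite (le_trans ler01).
have dt : d <= t by rewrite (le_trans dx).
rewrite ler_wpM2l//; apply: ge0_ler_powR; rewrite ?nnegrE ?subr_ge0 ?(ltW d0)//.
exact: le_trans (ltW d0) dt.
Qed.

End domination.

(** * Powers of polynomials and composition sums *)

Section power_sums.
Context {R : realType}.
Implicit Types (c : nat -> R) (P Q : {poly R}).

Definition positive_part c (k : nat) : {poly R} := \poly_(i < k.+1) (if i == 0%N then 0 else c i).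

(** Multiplication of polynomials is triangular in the degree. *)
Lemma coef_exp_low P Q (i : nat) : (forall j, (j <= i)%N -> P`_j = Q`_j) ->
  forall n j, (j <= i)%N -> (P ^+ n)`_j = (Q ^+ n)`_j.
Proof.
move=> PQ; elim=> [|n IH] j ji; first by rewrite !expr0.
rewrite !exprS !coefM; apply: eq_bigr => l _.
rewrite PQ ?IH//; first by rewrite (leq_trans (leq_subr _ _)).
by rewrite (leq_trans _ ji)// -ltnS ltn_ord.
Qed.

(** Expanding a power of a sum over all choices of one term in each factor;
    the choices that pick a constant term contribute 0. *)
Lemma composition_sumE c k n i : (i <= k)%N -> (positive_part c k ^+ n)`_i = composition_sum c n i.
Proof.
move=> ik; rewrite (@coef_exp_low _ (positive_part c i) i _ n i (leqnn i)); last first.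
  by move=> j ji; rewrite !coef_poly !ltnS ji (leq_trans ji ik).
rewrite /positive_part poly_def.
have powE (Q : {poly R}) : Q ^+ n = \prod_(l < n) Q by rewrite prodr_const card_ord.
rewrite powE.
rewrite (@bigA_distr_bigA _ _ _ _ _ _ _ (fun _ (j : 'I_i.+1) => (if j == 0%N :> nat then 0 else c j) *: 'X^j)).
rewrite coef_sum /composition_sum [RHS]big_mkcond/=; apply: eq_bigr => j _.
have -> : \prod_(l < n) ((if j l == 0%N :> nat then 0 else c (j l)) *: 'X^(j l)) =
    (\prod_(l < n) (if j l == 0%N :> nat then 0 else c (j l))) *: 'X^(\sum_l j l) :> {poly R}.
  rewrite (eq_bigr (fun l => (if j l == 0%N :> nat then 0 else c (j l))%:P * 'X^(j l))); last first.
    by move=> l _; rewrite mul_polyC.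
  by rewrite big_split/= -rmorph_prod/= mul_polyC prodrXr.
rewrite coefZ coefXn eq_sym; case: eqP => [_|_] /=; last by rewrite mulr0.
rewrite mulr1; case: (boolP [forall l, (0 < j l)%N]) => [/forallP h|/forallPn].
  by apply: eq_bigr => l _; rewrite -leqn0 leqNgt h.
case=> l; rewrite -leqNgt leqn0 => jl; by rewrite (bigD1 l)//= jl mul0r.
Qed.

(** With at least two positive parts, each part is smaller than the sum. *)
Lemma composition_sum_low c c' n i : (2 <= n)%N -> (forall j, (0 < j < i)%N -> c j = c' j) ->
  composition_sum c n i = composition_sum c' n i.
Proof.
move=> n2 cc'; apply: eq_bigr => j /andP[/eqP js /forallP jp]; apply: eq_bigr => l _; apply: cc'.
rewrite jp /=; have [l' l'l] : exists l' : 'I_n, l' != l.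
  have n0 : (0 < n)%N by exact: ltnW.
  case: (eqVneq l (Ordinal n0)) => [->|ne]; first by exists (Ordinal n2).
  by exists (Ordinal n0); rewrite eq_sym.
rewrite -[ltnRHS]js (bigD1 l)//= (bigD1 l')//= -[ltnLHS]addn0 ltn_add2l.
by rewrite (leq_trans (jp l'))// leq_addr.
Qed.

Lemma composition_sum_gt c n i : (i < n)%N -> composition_sum c n i = 0.
Proof.
move=> ni; rewrite /composition_sum big_pred0// => j; apply/negP => /andP[/eqP js /forallP jp].
have : (n <= \sum_l j l)%N.
  rewrite -[leqLHS]card_ord -sum1_card; apply: leq_sum => l _; exact: jp.
by rewrite js leqNgt ni.
Qed.

(** The values already computed are carried in a sequence. *)
Lemma strong_recursion (T : Type) (x0 : T) (next : (nat -> T) -> nat -> T) :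
  (forall (c c' : nat -> T) i, (forall j, (j < i)%N -> c j = c' j) -> next c i = next c' i) ->
  exists c : nat -> T, forall i, c i = next c i.
Proof.
move=> next_low.
pose st (s : seq T) := rcons s (next (nth x0 s) (size s)).
pose cs n := iter n st [::].
have size_cs n : size (cs n) = n by elim: n => //= n IH; rewrite size_rcons IH.
have nth_cs n j i : (j < i)%N -> nth x0 (cs (n + i)%N) j = nth x0 (cs i) j.
  move=> ji; elim: n => // n IH.
  by rewrite /= nth_rcons size_cs (leq_trans ji (leq_addl _ _)).
pose c i := nth x0 (cs i.+1) i.
exists c => i; rewrite {1}/c /= nth_rcons size_cs ltnn eqxx.
apply: next_low => j ji; rewrite /c -(nth_cs (i - j.+1)%N j j.+1 (ltnSn j)) subnK//.
Qed.

(** Each remaining monomial in 1/r has degree at least k+1. *)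
Lemma decays_horner P k : (forall i, (i <= k)%N -> P`_i = 0) -> decays k.+1 (fun r : R => P.[r^-1]).
Proof.
move=> P0.
apply: (@decays_eq _ _ (fun r => \sum_(i <- iota 0 (size P)) P`_i * r^-1 ^+ i)).
  by apply: nearW => r; rewrite horner_coef -{1}(subn0 (size P)) -/(index_iota 0 (size P)) big_mkord.
apply: decays_sum => i _; have [ik|ki] := leqP i k.
  rewrite P0//; apply: (decays_eq (g := fun=> 0)); first by apply: nearW => r; rewrite mul0r.
  by exists 0 => //; apply: nearW => r; rewrite normr0 mul0r.
by apply: decaysZ; apply: decaysW ki _; exact: decays_inv.
Qed.

End power_sums.

(** * Taylor expansion of real powers *)

Section taylor.
Context {R : realType}.
Variables (c0 : R).
Hypothesis c00 : 0 < c0.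

Definition falling (al : R) (n : nat) : R := \prod_(j < n) (al - j%:R).

Definition binomial_coef (al : R) (n : nat) : R := falling al n / n`!%:R * c0 `^ (al - n%:R).

Lemma binomial_coefS al n : binomial_coef al n.+1 = al / n.+1%:R * binomial_coef (al - 1) n.
Proof.
have fE : falling al n.+1 = al * falling (al - 1) n.
  rewrite /falling big_ord_recl subr0; congr (_ * _); apply: eq_bigr => j _.
  by rewrite /= /bump /= add1n -natr1; ring.
rewrite /binomial_coef fE factS natrM -natr1; have -> : al - (n%:R + 1) = al - 1 - n%:R by ring.
by field; rewrite natr1 !pnatr_eq0 -lt0n fact_gt0.
Qed.

Let powt (al t : R) := (c0 + t) `^ al.

Let is_derive_powt al (t : R) : 0 < c0 + t -> is_derive t 1 (powt al) (al * powt (al - 1) t).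
Proof.
move=> h; have dA : is_derive t 1 (fun t : R => c0 + t) 1.
  have D := is_deriveD (is_derive_cst c0 t 1) (is_derive_id t (1 : R)).
  by apply: (is_derive_eq D); rewrite add0r.
have D := @is_derive1_comp _ (fun z => z `^ al) (fun t => c0 + t) t _ _ (is_derive1_powR al h) dA.
by apply: (is_derive_eq D); rewrite mulr1.
Qed.

Let near_gt (t : R) : 0 < c0 + t -> \forall s \near t, 0 < c0 + s.
Proof.
move=> h; have : \forall s \near t, - c0 < s by apply: cvgr_gt (@cvg_id _ _) _ _; lra.
by apply: filterS => s; lra.
Qed.

Lemma derive1n_powt n (al b t : R) : 0 < c0 + t ->
  derive1n n (fun t => b * (c0 + t) `^ al) t = b * falling al n * (c0 + t) `^ (al - n%:R).
Proof.
elim: n t => [|n IH] t h.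
  by rewrite /falling big_ord0 mulr1 subr0.
have D := is_deriveZ (b * falling al n) (is_derive_powt (al - n%:R) h).
have E : is_derive t 1 (derive1n n (fun t => b * (c0 + t) `^ al))
    (b * falling al n * ((al - n%:R) * (c0 + t) `^ (al - n%:R - 1))).
  apply: (near_eq_is_derive (f := (b * falling al n) \*: (fun t => (c0 + t) `^ (al - n%:R)))).
  by have := near_gt h; apply: filterS => s hs; rewrite IH.
rewrite -[LHS]/(derive1 (derive1n n (fun t => b * (c0 + t) `^ al)) t) (is_derive1_eq E).2.
rewrite /falling big_ord_recr/= -natr1; have -> : al - (n%:R + 1) = al - n%:R - 1 by ring.
by ring.
Qed.

(** Induction on the order: the derivative of the remainder for the exponent
    al is al times the remainder for al - 1 at the previous order. *)
Lemma taylor_powR k : forall al, exists2 K : R, 0 <= K & forall t, `|t| <= c0 / 2 ->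
  `|(c0 + t) `^ al - \sum_(0 <= n < k) binomial_coef al n * t ^+ n| <= K * `|t| ^+ k.
Proof.
have c2 : 0 < c0 / 2 by rewrite divr_gt0.
elim: k => [|k IH] al.
  exists ((c0 / 2) `^ al + (c0 * 2) `^ al); first by rewrite addr_ge0// powR_ge0.
  move=> t; rewrite ler_norml => /andP[t1 t2]; rewrite big_geq// subr0 expr0 mulr1.
  rewrite ger0_norm ?powR_ge0//.
  have h0 : 0 < c0 + t by lra.
  have [al0|al0] := leP 0 al.
    rewrite (le_trans _ (_ : (c0 * 2) `^ al <= _)) ?lerDr ?powR_ge0//.
    by apply: ge0_ler_powR; rewrite ?nnegrE; lra.
  rewrite (le_trans _ (_ : (c0 / 2) `^ al <= _)) ?lerDl ?powR_ge0//.
  rewrite -[al]opprK !(powRN _ (- al)) lef_pV2 ?posrE ?powR_gt0//.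
  by apply: ge0_ler_powR; rewrite ?nnegrE; lra.
have [K K0 hK] := IH (al - 1).
exists (`|al| * K); first by rewrite mulr_ge0.
move=> t ht.
pose h s := (c0 + s) `^ al - \sum_(0 <= n < k.+1) binomial_coef al n * s ^+ n.
pose dh s := al * ((c0 + s) `^ (al - 1) - \sum_(0 <= n < k) binomial_coef (al - 1) n * s ^+ n).
have dhs (s : R) : `|s| <= c0 / 2 -> is_derive s 1 h (dh s).
  rewrite ler_norml => /andP[s1 s2].
  have h0 : 0 < c0 + s by lra.
  have dS (j : nat) : is_derive s 1 (fun s => \sum_(0 <= n < j.+1) binomial_coef al n * s ^+ n)
      (al * \sum_(0 <= n < j) binomial_coef (al - 1) n * s ^+ n).
    elim: j => [|j IHj].
      rewrite big_geq// mulr0; apply: (near_eq_is_derive (f := cst (binomial_coef al 0))).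
      by near=> y; rewrite /= big_nat1 expr0 mulr1.
    have D := is_deriveD IHj (is_deriveZ (binomial_coef al j.+1) (is_derive_pow j.+1 s)).
    apply: (near_eq_is_derive (f := (fun s => \sum_(0 <= n < j.+1) binomial_coef al n * s ^+ n) +
      (binomial_coef al j.+1 \*: (fun s => s ^+ j.+1)))).
      by near=> y; rewrite big_nat_recr.
    apply: (is_derive_eq D); rewrite [in RHS]big_nat_recr//= mulrDr; congr (_ + _).
    have M0 : j.+1%:R != 0 :> R by rewrite pnatr_eq0.
    rewrite binomial_coefS /GRing.scale/=; move: M0; move: (j.+1%:R) => M M0.
    by field.
  have D := is_deriveB (is_derive_powt al h0) (dS k).
  by apply: (is_derive_eq D); rewrite /dh mulrBr.
have h00 : h 0 = 0.
  rewrite /h addr0 big_nat_recl//= expr0 mulr1 big1 ?addr0; last by move=> i _; rewrite exprS mul0r mulr0.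
  by rewrite /binomial_coef /falling big_ord0 fact0 divr1 mul1r subr0 subrr.

have bd (s : R) : `|s| <= `|t| -> `|dh s| <= `|al| * K * `|t| ^+ k.
  move=> st; rewrite normrM -mulrA ler_wpM2l//; apply: (le_trans (hK s (le_trans st ht))).
  by rewrite ler_wpM2l// lerXn2r ?nnegrE.
suff : `|h t - h 0| <= `|al| * K * `|t| ^+ k * `|t|.
  by rewrite h00 subr0 /h -mulrA -exprSr.
have ch (s : R) : `|s| <= c0 / 2 -> {for s, continuous h} by move=> /dhs /is_derive_continuous.
have [t0|t0|<-] := ltgtP 0 t; last by rewrite subrr normr0 mulr0.
  have [||c + ->] := @MVT R h dh 0 t t0.
  - move=> x; rewrite in_itv/= => /andP[x0 xt]; apply: dhs.
    by rewrite (le_trans _ ht)// !gtr0_norm// ltW.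
  - apply: continuous_in_subspaceT => x; rewrite inE/= in_itv/= => /andP[x0 xt]; apply: ch.
    by rewrite (le_trans _ ht)// !ger0_norm// ltW.
  rewrite in_itv/= subr0 => /andP[x0 xt]; rewrite normrM ler_wpM2r// bd//.
  by rewrite !gtr0_norm// ltW.
have [||c + E] := @MVT R h dh t 0 t0.
- move=> x; rewrite in_itv/= => /andP[x0 xt]; apply: dhs.
  by rewrite (le_trans _ ht)// !ltr0_norm// lerN2 ltW.
- apply: continuous_in_subspaceT => x; rewrite inE/= in_itv/= => /andP[x0 xt]; apply: ch.
  by rewrite (le_trans _ ht)// !ler0_norm ?lerN2// ltW.
rewrite -normrN opprB E in_itv/= sub0r => /andP[x0 xt]; rewrite normrM normrN ler_wpM2r// bd//.
by rewrite !ltr0_norm// lerN2 ltW.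
Unshelve. all: by end_near. Qed.
End taylor.

(** * The formal solution *)

Section formal_solution.
Context {R : realType}.
Variables (N k : nat) (p m mu : R) (c : nat -> R).
Hypotheses (p1 : 1 < p) (m0 : 0 < m) (kp : k%:R <= p < k.+1%:R).
Hypothesis hc : is_coeffs N p m k c.

Let p0 : 0 < p. Proof. exact: lt_trans p1. Qed.
Let p10 : 0 < p - 1. Proof. by rewrite subr_gt0. Qed.
Let p_neq0 : p != 0. Proof. by rewrite gt_eqF. Qed.
Let p1_neq0 : p - 1 != 0. Proof. by rewrite gt_eqF. Qed.
Let k_gt0 : (0 < k)%N.
Proof. by case/andP: kp => _; case: k => // /lt_trans/(_ p1); rewrite ltxx. Qed.

Notation pp := (p / (p - 1)).
Notation ka := ((m / (p - 1)) `^ p^-1).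
Notation D := (((p - 1) / m) `^ p^-1 * mu / p).

Let mp0 : 0 < m / (p - 1). Proof. by rewrite divr_gt0. Qed.
Let ka0 : 0 < ka. Proof. exact: powR_gt0. Qed.

Let c0E : c 0%N = riccati_limit p m.
Proof. by case: hc. Qed.

Let c00 : 0 < c 0%N.
Proof. by rewrite c0E riccati_limit_gt0. Qed.

Let kaD : p * ka * D = mu.
Proof.
have kk : ka * ((p - 1) / m) `^ p^-1 = 1.
  rewrite -powRM ?divr_ge0 ?ltW//.
  have -> : m / (p - 1) * ((p - 1) / m) = 1 by field; rewrite p1_neq0 gt_eqF.
  by rewrite powR1.
rewrite !mulrA -[p * ka * _]mulrA kk; by field.
Qed.

Let bE n := (p - 1) * binomial_coef (c 0%N) pp n.

(** These are the Taylor coefficients of F at 0. *)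
Lemma taylor_coefE n : derive1n n (Ffun p (c 0%N)) 0 / n`!%:R = bE n.
Proof.
rewrite derive1n_powt ?addr0// /bE /binomial_coef; ring.
Qed.

Let b0 : bE 0 = m.
Proof.
rewrite /bE /binomial_coef /falling big_ord0 fact0 divr1 mul1r subr0 c0E.
exact: riccati_limitE.
Qed.

Let b1 : bE 1 = p * ka.
Proof.
rewrite /bE /binomial_coef /falling big_ord1 subr0 divr1 c0E /riccati_limit -powRrM.
have -> : (p - 1) / p * (pp - 1%:R) = p^-1 by field; rewrite p_neq0 p1_neq0.
by rewrite mulrA; congr (_ * _); field.
Qed.

Notation S := (fun r : R => \sum_(i < k.+1) c i / r ^+ i
              - ((p - 1) / m) `^ p^-1 * mu / (p * r `^ p)).

Let P : {poly R} := \poly_(i < k.+1) c i.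
Let Q : {poly R} := positive_part c k.

Let PE : P = (c 0%N)%:P + Q.
Proof.
apply/polyP => i; rewrite coefD coefC !coef_poly; case: i => [|i] /=; first by rewrite addr0.
by rewrite add0r.
Qed.

Let SE (r : R) : 0 < r -> S r = P.[r^-1] - D * (r `^ p)^-1.
Proof.
move=> r0; have rp : r `^ p != 0 by rewrite gt_eqF// powR_gt0.
rewrite horner_poly; congr (_ - _); last by field; rewrite rp p_neq0.
by apply: eq_bigr => i _; rewrite exprVn.
Qed.

(** The derivative of the truncated expansion. *)
Definition formal_slope (r : R) := - (r^-1 ^+ 2 * P^`().[r^-1]) + D * p * r `^ (- p - 1).

Lemma is_derive_formal (r : R) : 0 < r -> is_derive r 1 S (formal_slope r).
Proof.
move=> r0; have rn0 : r != 0 by rewrite gt_eqF.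
have dV : is_derive r 1 (@GRing.inv R) (- r ^- 2).
  apply: is_derive_eq; first exact: (is_deriveV rn0 (is_derive_id r 1)).
  by rewrite /GRing.scale/= mulr1.
have dP : is_derive (r^-1) 1 (horner P) (P^`()).[r^-1].
  by apply: DeriveDef; [exact: derivable_horner|rewrite -derive1E derivE].
have d1 := @is_derive1_comp _ (horner P) (@GRing.inv R) r _ _ dP dV.
have d2 := is_deriveZ D (is_derive1_powR (- p) r0).
have dd := is_deriveB d1 d2.
apply: (near_eq_is_derive (f := (horner P \o @GRing.inv R) - (D \*: (fun z => z `^ (- p))))).
  have : \forall t \near r, 0 < t by apply: cvgr_gt (@cvg_id _ _) _ _.
  by apply: filterS => t t0; rewrite SE// -powRN.
apply: (is_derive_eq dd); rewrite /formal_slope /GRing.scale/= exprVn; ring.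
Qed.

Let d r := D * (r `^ p)^-1.
Let T r := Q.[r^-1] - d r.

Let d_decays : decays k d.
Proof. by apply/decaysZ/decays_powR; case/andP: kp. Qed.

Let Q_decays : decays 1 (fun r : R => Q.[r^-1]).
Proof. by apply: decays_horner => i; rewrite leqn0 => /eqP ->; rewrite coef_poly. Qed.

Let T_decays : decays 1 T.
Proof. by apply: decaysD => //; apply: decaysN; exact: decaysW d_decays. Qed.

Let near_pos : \forall r \near +oo, 0 < r :> R.
Proof. by have := near_ge (1 : R); apply: filterS => r; exact: lt_le_trans. Qed.

Let ST (r : R) : 0 < r -> S r = c 0%N + T r.
Proof. by move=> r0 /=; rewrite SE// PE hornerD hornerC addrA. Qed.

Lemma formal_limit (ep : R) : 0 < ep -> \forall r \near +oo, `|S r - c 0%N| <= ep.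
Proof.
move=> ep0; have h := decays_vanish T_decays ep0; near=> r.
have r0 : 0 < r by near: r; exact: near_pos.
by rewrite ST// addrC addKr; near: r.
Unshelve. all: by end_near. Qed.

Let taylor_error r := (c 0%N + T r) `^ pp - \sum_(0 <= n < k.+1) binomial_coef (c 0%N) pp n * T r ^+ n.

Let taylor_error_decays : decays k.+1 taylor_error.
Proof.
have [K K0 hK] := taylor_powR c00 k.+1 pp.
have c2 : 0 < c 0%N / 2 by rewrite divr_gt0.
have hT := decays_vanish T_decays c2.
have := decaysZ K (decaysX k.+1 T_decays); rewrite muln1; apply: decays_norm_le.
by apply: filterS hT => r /hK; rewrite normrM normrX (ger0_norm K0).
Qed.

Let power_error_decays n : (2 <= n)%N -> decays k.+1 (fun r => T r ^+ n - Q.[r^-1] ^+ n).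
Proof.
move=> n2.
have sd : decays 1 (fun r => \sum_(i <- index_enum 'I_n) T r ^+ (n.-1 - i) * Q.[r^-1] ^+ i).
  apply: decays_sum => i _.
  have := decaysM (decaysX (n.-1 - i) T_decays) (decaysX i Q_decays); rewrite !muln1.
  by apply: decaysW; rewrite subnK; [rewrite -subn1 subn_gt0|rewrite -ltnS prednK ?ltn_ord// ltnW].
have := decaysN (decaysM d_decays sd); rewrite addn1; apply: decays_eq; apply: nearW => r.
rewrite subrXX -mulNr; congr (_ * _).
by rewrite /T addrAC subrr add0r.
Qed.

Let L : {poly R} := - ('X^2 * P^`()) - (p * ka) *: Q - \sum_(2 <= n < k.+1) bE n *: Q ^+ n
  + (N%:R - 1) *: ('X * P).

Let L_low i : (i <= k)%N -> L`_i = 0.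
Proof.
move=> ik; rewrite !(coefD, coefN, coefZ) coefXnM coefXM coef_sum.
have -> : \sum_(2 <= n < k.+1) (bE n *: Q ^+ n)`_i = \sum_(2 <= n < k.+1) bE n * composition_sum c n i.
  by apply: eq_bigr => n _; rewrite coefZ composition_sumE.
case: i ik => [|[|i]] ik /=.
- rewrite /Q /positive_part coef_poly /= !mulr0 !subr0 addr0 oppr0 big_nat big1 ?subr0// => n /andP[n2 _].
  by rewrite composition_sum_gt ?mulr0// ltnW.
- rewrite /P /Q /positive_part !coef_poly /= !ltnS k_gt0 oppr0 add0r.
  rewrite big_nat big1 ?subr0; last by move=> n /andP[n2 _]; rewrite composition_sum_gt ?mulr0.
  have [_ -> _] := hc; rewrite c0E /riccati_limit.
  have -> : (m / (p - 1)) `^ ((p - 1) / p) = ka * (m / (p - 1)) `^ ((p - 2) / p).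
    rewrite -powRD ?(gt_eqF mp0) ?implybT//; congr (_ `^ _); by field.
  by field.
- have [_ _ /(_ i.+2)] := hc; rewrite /= ik => /(_ isT) E.
  rewrite subn2 /= coef_deriv /P /Q /positive_part !coef_poly /= !ltnS ik (ltnW ik).
  have -> : \sum_(2 <= n < k.+1) bE n * composition_sum c n i.+2 =
      (N%:R - i.+2%:R) * c i.+1 - p * ka * c i.+2.
    rewrite E (@big_cat_nat _ _ _ i.+3)//= [X in _ + X]big_nat [X in _ + X]big1 ?addr0.
      by apply: eq_bigr => n _; rewrite taylor_coefE.
    by move=> n /andP[ni _]; rewrite composition_sum_gt ?mulr0.
  by rewrite -mulr_natr -[i.+2%:R]natr1; ring.
Qed.

(** The residual is a polynomial in 1/r up to O(r^-(k+1)), and the recursion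
    for the coefficients says that its coefficients of degree at most k vanish. The
    term in r^-p is chosen to cancel mu / r^p at first order; since p >= k, all its
    other contributions have order at least k+1. *)
Lemma formal_residual : decays k.+1 (fun r =>
  formal_slope r - ((p - 1) * S r `^ pp - (N%:R - 1) * S r / r - m + mu / r `^ p)).
Proof.
have inv1 : decays 1 (fun r : R => r^-1).
  by apply: decays_eq (decays_inv 1); apply: nearW => r; rewrite expr1.
have hL := decays_horner L_low.
have e1 : decays k.+1 (fun r => D * p * r `^ (- p - 1)).
  apply: decaysZ; have := decays_powR (a := p + 1) (k := k.+1).
  rewrite -natr1 lerD2r; case/andP: kp => -> _ /(_ isT); apply: decays_eq; apply: nearW => r.
  by rewrite -powRN opprD.
have e2 := decaysN (decaysZ (p - 1) taylor_error_decays).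
have e3 : decays k.+1 (fun r => \sum_(n <- index_iota 2 k.+1) - (bE n * (T r ^+ n - Q.[r^-1] ^+ n))).
  apply: decays_sum => n; rewrite mem_index_iota => /andP[n2 _].
  by apply/decaysN/decaysZ/power_error_decays.
have e4 : decays k.+1 (fun r => - ((N%:R - 1) * (d r * r^-1))).
  by apply/decaysN/decaysZ; rewrite -addn1; exact: decaysM.
apply: decays_eq (decaysD hL (decaysD e1 (decaysD e2 (decaysD e3 e4)))).
apply: filterS near_pos => r r0.
have rn0 : r != 0 by rewrite gt_eqF.
have rp : r `^ p != 0 by rewrite gt_eqF// powR_gt0.
have pE : (p - 1) * S r `^ pp = (p - 1) * taylor_error r + (m + p * ka * T r +
    \sum_(2 <= n < k.+1) bE n * Q.[r^-1] ^+ n +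
    \sum_(2 <= n < k.+1) bE n * (T r ^+ n - Q.[r^-1] ^+ n)).
  rewrite ST// -addrA -big_split/=.
  have -> : \sum_(2 <= n < k.+1) (bE n * Q.[r^-1] ^+ n + bE n * (T r ^+ n - Q.[r^-1] ^+ n)) =
      \sum_(2 <= n < k.+1) bE n * T r ^+ n.
    by apply: eq_bigr => n _; rewrite -mulrDr addrC subrK.
  have -> : m + p * ka * T r + \sum_(2 <= n < k.+1) bE n * T r ^+ n =
      \sum_(0 <= n < k.+1) bE n * T r ^+ n.
    by rewrite [in RHS]big_ltn// [in RHS]big_ltn ?ltnS// b0 b1 expr0 expr1 mulr1 addrA.
  rewrite /taylor_error mulrBr mulr_sumr.
  have -> : \sum_(0 <= n < k.+1) (p - 1) * (binomial_coef (c 0%N) pp n * T r ^+ n) =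
     \sum_(0 <= n < k.+1) bE n * T r ^+ n by apply: eq_bigr => n _; rewrite mulrA.
  by rewrite subrK.
have hLE : L.[r^-1] = - (r^-1 ^+ 2 * P^`().[r^-1]) - p * ka * Q.[r^-1]
    - \sum_(2 <= n < k.+1) bE n * Q.[r^-1] ^+ n + (N%:R - 1) * (r^-1 * P.[r^-1]).
  rewrite !(hornerD, hornerN, hornerZ, hornerM, hornerX, hornerXn) horner_sum.
  congr (_ - _ + _); apply: eq_bigr => n _; by rewrite hornerZ horner_exp.
rewrite pE hLE sumrN /formal_slope (SE r0) -/(d r).
have -> : mu / r `^ p = p * ka * d r by rewrite /d mulrA kaD.
rewrite /T; set s1 := \sum_(2 <= n < _) _; set s2 := \sum_(2 <= n < _) _.
move: (p * ka) => x1; move: (taylor_error r) => x2; move: (P^`().[_]) => x3.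
by move: s1 s2 => s1 s2; ring.
Qed.

End formal_solution.

(** * The expansion *)

Section instability.
Context {R : realType}.

Lemma unstable_up (a n z g b t : R) : 2 * a * z <= g -> n * z <= a * z -> - t <= b ->
  a * z - t <= g - n * z + b.
Proof. by rewrite -mulrA; move: (a * z) (n * z) => x y; lra. Qed.

Lemma unstable_down (a n z e x y b t : R) : 2 * a * (- z) <= e * (y - x) -> n * (- z) <= a * (- z) ->
  b <= t -> e * (x - y) - n * z + b <= a * z + t.
Proof.
rewrite -mulrA !mulrN !mulrBr.
by move: (a * z) (n * z) (e * x) (e * y) => a' n' x' y'; lra.
Qed.

End instability.

Section expansion.
Context {R : realType}.
Variables (N k : nat) (p m mu q B dl : R) (f U U1 : R -> R) (c : nat -> R).
Hypotheses (N0 : (0 < N)%N) (p1 : 1 < p) (m0 : 0 < m) (pq : p < q) (B0 : 0 <= B) (dl0 : 0 < dl).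
Hypothesis U_gt0 : forall r, 0 < r -> 0 < U r.
Hypothesis dU : forall r : R, 0 < r -> is_derive r 1 U (U1 r).
Hypothesis dP : forall r : R, 0 < r ->
  is_derive r 1 (fun t => t ^+ N.-1 * angular p (U1 t))
    (r ^+ N.-1 * ((m - mu / r `^ p) * U r `^ (p - 1) - f (U r))).
Hypothesis U_vanish : forall ep, 0 < ep -> exists T, forall r, T <= r -> U r <= ep.
Hypothesis f_small : forall t, 0 < t -> t <= dl -> `|f t| <= B * t `^ (q - 1).
Hypotheses (kp : k%:R <= p < k.+1%:R) (hc : is_coeffs N p m k c).

Let p0 : 0 < p. Proof. exact: lt_trans p1. Qed.
Let p10 : 0 < p - 1. Proof. by rewrite subr_gt0. Qed.

Notation rest := (fun r => f (U r) / U r `^ (p - 1)).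
Notation w := (riccati p U U1).
Notation c0 := (riccati_limit p m).
Notation pp := (p / (p - 1)).
Notation S := (fun r : R => \sum_(i < k.+1) c i / r ^+ i
              - ((p - 1) / m) `^ p^-1 * mu / (p * r `^ p)).

Let c00 : 0 < c0. Proof. exact: riccati_limit_gt0. Qed.
Let c02 : 0 < c0 / 2. Proof. by rewrite divr_gt0. Qed.

Let lower (ep : R) : 0 < ep -> ep < c0 -> \forall r \near +oo, c0 - ep <= w r.
Proof. exact: riccati_lower p1 m0 pq B0 dl0 U_gt0 dU dP U_vanish f_small ep. Qed.

Let upper (ep : R) : 0 < ep -> \forall r \near +oo, w r <= c0 + ep.
Proof. exact: riccati_upper p1 m0 pq B0 dl0 U_gt0 dU dP U_vanish f_small ep. Qed.

(** The logarithmic derivative is bounded away from zero, so the solution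
    decays faster than every power. *)
Lemma profile_decays_fast j : exists2 K : R, 0 <= K & \forall r \near +oo, U r <= K / r ^+ j.
Proof.
have [T [T0 hT]] := riccati_eventually p1 m0 pq B0 dl0 U_gt0 dU dP U_vanish f_small.
have c2lt : c0 / 2 < c0 by rewrite ltr_pdivrMr// mulr_natr mulr2n ltrDl.
have [T1 hT1] := (near_pinfty _).2 (lower c02 c2lt).
pose eta := (c0 / 2) `^ (p - 1)^-1.
have eta0 : 0 < eta by exact: powR_gt0.
(* From M on, U r^j is nonincreasing. *)
pose M := Num.max (Num.max T T1) (j%:R / eta).
have MT : T <= M by rewrite !le_max lexx.
have MT1 : T1 <= M by rewrite !le_max lexx orbT.
have Mj : j%:R / eta <= M by rewrite le_max lexx orbT.
have M0 : 0 < M by exact: lt_le_trans MT.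
have neg r : M <= r -> U1 r + j%:R * U r / r <= 0.
  move=> Mr; have r0 : 0 < r by exact: lt_le_trans Mr.
  have [w0 Ur _] := hT r (le_trans MT Mr).
  have h1 : eta <= - U1 r / U r.
    rewrite -(riccati_root p1 U_gt0 r0 Ur); apply: ge0_ler_powR.
    - by rewrite invr_ge0 ltW.
    - by rewrite nnegrE ltW.
    - by rewrite nnegrE ltW.
    - have := hT1 r (le_trans MT1 Mr); apply: le_trans.
      by rewrite lerBrDr -splitr.
  have h2 : eta * U r <= - U1 r by rewrite -ler_pdivlMr// U_gt0.
  have h3 : j%:R / r <= eta.
    by rewrite ler_pdivrMr// mulrC -ler_pdivrMr// (le_trans Mj).
  have h4 : j%:R / r * U r <= eta * U r by rewrite ler_wpM2r// ltW// U_gt0.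
  have -> : j%:R * U r / r = j%:R / r * U r by ring.
  by move: h2 h4; move: (eta * U r) (U1 r) (j%:R / r * U r) => x y z; lra.
exists (U M * M ^+ j); first by rewrite mulr_ge0 ?exprn_ge0 ?ltW// U_gt0.
apply/near_pinfty; exists M => r Mr.
have pos s : M <= s -> 0 < s by exact: lt_le_trans.
rewrite ler_pdivlMr ?exprn_gt0 ?pos//.
pose Y s := - (U s * s ^+ j).
pose dY s := - (U s * (j%:R * s ^+ j.-1) + s ^+ j * U1 s).
have : 0 * (r - M) <= Y r - Y M.
  apply: (@increment_ge R Y dY M r 0 Mr) => s /andP[Ms _]; have s0 := pos s Ms.
    exact: is_deriveN (is_deriveM (dU s0) (is_derive_pow j s)).
  rewrite oppr_ge0; have sn0 : s != 0 by rewrite gt_eqF.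
  have -> : U s * (j%:R * s ^+ j.-1) + s ^+ j * U1 s = s ^+ j * (U1 s + j%:R * U s / s).
    by case: (j) => [|l]; rewrite ?exprS /=; field.
  by rewrite mulr_ge0_le0 ?exprn_ge0 ?(ltW s0)// neg.
by rewrite mul0r subr_ge0 lerN2.
Qed.

(** The quotient is bounded by a power of U with positive exponent q - p. *)
Lemma rest_decays l : decays l rest.
Proof.
have qp : 0 < q - p by rewrite subr_gt0.
pose j := (Num.truncn (l%:R / (q - p))).+1.
have jl : l%:R <= j%:R * (q - p).
  by rewrite -ler_pdivrMr// ltW// truncnS_gt.
have [K K0 hK] := profile_decays_fast j.
have hd : \forall r \near +oo, U r <= dl by apply/near_pinfty; exact: U_vanish.
exists (B * K `^ (q - p)); first by rewrite mulr_ge0// powR_ge0.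
near=> r.
have r1 : 1 <= r by near: r; exact: near_ge.
have r0 : 0 < r by exact: lt_le_trans r1.
have Ud : U r <= dl by near: r.
have UK : U r <= K / r ^+ j by near: r.
apply: (le_trans (rest_le p U_gt0 f_small r0 Ud)); rewrite -mulrA ler_wpM2l//.
have rj : 0 < r ^+ j by rewrite exprn_gt0.
apply: (@le_trans _ _ ((K / r ^+ j) `^ (q - p))).
  by apply: ge0_ler_powR; rewrite ?nnegrE ?(ltW qp) ?(ltW (U_gt0 r0)) ?divr_ge0 ?(ltW rj).
rewrite powRM ?invr_ge0 ?(ltW rj)// ler_wpM2l ?powR_ge0//.
rewrite -powR_inv1 ?(ltW rj)// -powRrM mulN1r powRN lef_pV2 ?posrE ?exprn_gt0 ?powR_gt0//.
by rewrite -!powR_mulrn ?(ltW r0)// -powRrM ler_powR.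
Unshelve. all: by end_near. Qed.

(** The difference of the solution and the truncated expansion is bounded and
    solves a linear equation whose coefficient is positive, as w |-> w^(p/(p-1))
    is increasing, and whose forcing term is O(r^-(k+1)). *)
Theorem riccati_expansion : decays k.+1 (fun r => w r - S r).
Proof.
have [T1 [T10 hT1]] := riccati_eventually p1 m0 pq B0 dl0 U_gt0 dU dP U_vanish f_small.
have [K K0 hK] := rest_decays k.+1.
have [L L0 hL] := formal_residual mu p1 m0 kp hc.
have cE : c 0%N = c0 by case: hc.
have hS : \forall r \near +oo, `|S r - c 0%N| <= c0 / 2 by apply: formal_limit.
rewrite cE in hS.
have c2lt : c0 / 2 < c0 by rewrite ltr_pdivrMr// mulr_natr mulr2n ltrDl.
have hl := lower c02 c2lt; have hu := upper c02.
have pp1 : 1 < pp by rewrite ltr_pdivlMr// mul1r gtrBl.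
pose a1 := (p - 1) * (pp * (c0 / 2) `^ (pp - 1)) / 2.
have a10 : 0 < a1.
  by rewrite divr_gt0// mulr_gt0// mulr_gt0 ?powR_gt0// (lt_trans ltr01).
have a1E : 2 * a1 = (p - 1) * (pp * (c0 / 2) `^ (pp - 1)).
  by rewrite /a1 mulrC divfK.
pose nn : R := N%:R - 1.
have nE : N.-1%:R = nn :> R by rewrite /nn -[in RHS](prednK N0) -natr1 addrK.
have nn0 : 0 <= nn by rewrite -nE.
pose z r := w r - S r.
pose dw r := (p - 1) * w r `^ pp - N.-1%:R * w r / r - (m - mu / r `^ p - f (U r) / U r `^ (p - 1)).
pose dz r := dw r - formal_slope k p m mu c r.
have ev : \forall r \near +oo, [/\ T1 <= r, nn / a1 <= r, `|rest r| <= K / r ^+ k.+1 &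
   [/\ `|formal_slope k p m mu c r - ((p - 1) * S r `^ pp - (N%:R - 1) * S r / r - m + mu / r `^ p)| <= L / r ^+ k.+1,
   `|S r - c0| <= c0 / 2, c0 - c0 / 2 <= w r & w r <= c0 + c0 / 2]].
  near=> r; split; last (split); near: r => //; exact: near_ge.
have [T hT] := (near_pinfty _).2 ev.
have core r : T <= r -> let b := rest r -
    (formal_slope k p m mu c r - ((p - 1) * S r `^ pp - (N%:R - 1) * S r / r - m + mu / r `^ p)) in
    dz r = (p - 1) * (w r `^ pp - S r `^ pp) - nn / r * z r + b /\ `|b| <= (K + L) / r ^+ k.+1.
  move=> Tr; have [_ _ h1 [h2 _ _ _]] := hT r Tr; split.
    by rewrite /dz /dw /z nE /nn; ring.
  by apply: (le_trans (ler_normB _ _)); rewrite [leRHS]mulrDl lerD.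
apply: (@unstable_bound R z dz a1 (K + L) (3 * c0) k.+1 (Num.max T T1)).
- by rewrite lt_max T10 orbT.
- exact: a10.
- by rewrite addr_ge0.
- move=> r; rewrite ge_max => /andP[Tr T1r]; have [_ _ D] := hT1 r T1r.
  by apply: is_deriveB D _; apply: is_derive_formal => //; exact: lt_le_trans T1r.
- move=> r; rewrite ge_max => /andP[Tr T1r] z0; have [-> hb] := core r Tr.
  have r0 : 0 < r by exact: lt_le_trans T1r.
  have [_ h1 _ [_ h2 h3 _]] := hT r Tr.
  have Sc : c0 / 2 <= S r.
    by move: h2; rewrite ler_norml => /andP[+ _]; move: (S r) c0 => x y; lra.
  have SW : S r <= w r by move: z0; rewrite subr_ge0.
  have sl := powR_slope (ltW pp1) c02 Sc SW.
  have sl2 : 2 * a1 * z r <= (p - 1) * (w r `^ pp - S r `^ pp).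
    by rewrite a1E -mulrA ler_wpM2l// ltW.
  have nz : nn / r * z r <= a1 * z r.
    by rewrite ler_wpM2r// ler_pdivrMr// mulrC -ler_pdivrMr.
  by move: hb; rewrite ler_norml => /andP[hb _]; exact: unstable_up sl2 nz hb.
- move=> r; rewrite ge_max => /andP[Tr T1r] z0; have [-> hb] := core r Tr.
  have r0 : 0 < r by exact: lt_le_trans T1r.
  have [_ h1 _ [_ h2 h3 _]] := hT r Tr.
  have Sc : c0 / 2 <= w r by move: h3; move: (w r) c0 => x y; lra.
  have SW : w r <= S r by move: z0; rewrite subr_le0.
  have sl := powR_slope (ltW pp1) c02 Sc SW.
  have sl2 : 2 * a1 * (- z r) <= (p - 1) * (S r `^ pp - w r `^ pp).
    by rewrite a1E -mulrA ler_wpM2l ?(ltW p10)// /z opprB.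
  have nz : nn / r * (- z r) <= a1 * (- z r).
    by rewrite ler_wpM2r ?oppr_ge0// ler_pdivrMr// mulrC -ler_pdivrMr.
  by move: hb; rewrite ler_norml => /andP[_ hb]; exact: unstable_down sl2 nz hb.
- move=> r; rewrite ge_max => /andP[Tr T1r]; have [_ _ _ [_ h2 h3 h4]] := hT r Tr.
  rewrite /z; move: h2 h3 h4 c00; rewrite !ler_norml => /andP[]; move: (w r) (S r) c0 => x y v.
  by move=> *; apply/andP; split; lra.
Unshelve. all: by end_near. Qed.

End expansion.

Section coefficients.
Context {R : realType}.
Variables (N k : nat) (p m : R).
Hypotheses (p1 : 1 < p) (m0 : 0 < m).

Notation c0 := ((m / (p - 1)) `^ ((p - 1) / p)).
Notation ka := (p * (m / (p - 1)) `^ p^-1).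

Let ka0 : ka != 0.
Proof.
have h1 : p != 0 by rewrite gt_eqF// (lt_trans ltr01 p1).
have h2 : 0 < (m / (p - 1)) `^ p^-1 by rewrite powR_gt0// divr_gt0// subr_gt0.
by rewrite mulf_neq0// gt_eqF.
Qed.

(** The sum on the right-hand side of the recursion for c_i only involves
    coefficients of smaller index, and c_i itself is multiplied by a nonzero constant. *)
Lemma coefficients_exist : exists c : nat -> R, is_coeffs N p m k c.
Proof.
pose sums (c : nat -> R) i := \sum_(2 <= n < i.+1)
  derive1n n (Ffun p c0) 0 / n`!%:R * composition_sum c n i.
pose next (c : nat -> R) i := if i == 0%N then c0 else
  if i == 1%N then (N%:R - 1) / p * (m / (p - 1)) `^ ((p - 2) / p) else
  ((N%:R - i%:R) * c i.-1 - sums c i) / ka.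
have next_low (c c' : nat -> R) i : (forall j, (j < i)%N -> c j = c' j) -> next c i = next c' i.
  move=> cc'; rewrite /next; case: i cc' => [//|[//|i]] cc' /=.
  congr ((_ * _ - _) / _); first exact: cc'.
  rewrite /sums big_nat [RHS]big_nat; apply: eq_bigr => n /andP[n2 _]; congr (_ * _).
  by apply: composition_sum_low => // j /andP[_ ji]; exact: cc'.
have [c hc] := strong_recursion 0 next_low.
exists c; have c0E : c 0%N = c0 by rewrite hc.
split; [exact: c0E|by rewrite hc|].
move=> i /andP[i2 _]; rewrite c0E.
have := hc i; rewrite /next; case: i i2 => [//|[//|i]] _ /= ->.
by rewrite [ka * _]mulrC divfK// opprB addrC subrK.
Qed.

Lemma coefficients_unique (c c' : nat -> R) : is_coeffs N p m k c -> is_coeffs N p m k c' ->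
  forall i, (i <= k)%N -> c' i = c i.
Proof.
move=> [h0 h1 h2] [h0' h1' h2']; elim/ltn_ind => -[|[|i]] IH ik.
- by rewrite h0 h0'.
- by rewrite h1 h1'.
have := h2' i.+2; rewrite ik => /(_ isT); have := h2 i.+2; rewrite ik => /(_ isT) /=.
rewrite h0 h0' IH ?(ltnW ik)// => E E'.
have Es : \sum_(2 <= n < i.+3) derive1n n (Ffun p c0) 0 / n`!%:R * composition_sum c' n i.+2 =
    \sum_(2 <= n < i.+3) derive1n n (Ffun p c0) 0 / n`!%:R * composition_sum c n i.+2.
  rewrite big_nat [RHS]big_nat; apply: eq_bigr => n /andP[n2 _]; congr (_ * _).
  apply: composition_sum_low => // j /andP[_ ji]; apply: IH => //.
  exact: leq_trans (ltnW ji) ik.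
move: E'; rewrite Es -E => /addrI /oppr_inj /(mulfI ka0) //.
Qed.

End coefficients.

(** A number above the upper limit is an upper bound near the point. *)
Lemma limf_esup_dnbhs_bound (R : realType) (g : R -> R) (A : R) :
  (limf_esup (fun t : R => (g t)%:E) 0%R^' <= A%:E)%E ->
  exists2 d : R, 0 < d & forall t, 0 < `|t| < d -> g t <= A + 1.
Proof.
move=> h; have : (limf_esup (fun t : R => (g t)%:E) 0%R^' < (A + 1)%:E)%E.
  by apply: le_lt_trans h _; rewrite lte_fin ltrDl.
move=> /ereal_inf_lt [_ [V [e /= e0 he] <-] hV]; exists e => // t /andP[t0 te].
rewrite -lee_fin; apply: (le_trans _ (ltW hV)); apply: ereal_sup_ubound.
exists t => //; apply: he; first by rewrite /= sub0r normrN.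
by rewrite -normr_gt0.
Qed.

Lemma decays_eqO (R : realType) k (g : R -> R) : decays k g ->
  g =O_+oo (fun r : R => (r ^+ k)^-1).
Proof.
move=> [K K0 hK]; apply/eqO_exP; exists (K + 1); first by rewrite ltr_wpDl.
near=> r; have r0 : 0 <= r by near: r; exact: near_ge.
apply: (@le_trans _ _ (K / r ^+ k)); first by near: r.
rewrite ger0_norm ?invr_ge0 ?exprn_ge0// ler_wpM2r ?invr_ge0 ?exprn_ge0//.
by rewrite lerDl.
Unshelve. all: by end_near. Qed.

Theorem theorem2p1 (R : realType) (N k : nat) (p m mu q A : R) (f : R -> R)
    (u : 'rV[R]_N -> R) (U : R -> R)
    (hp : 1 < p < N%:R) (hm : 0 < m)
    (hmu : 0 <= mu < ((N%:R - p) / p) `^ p)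
    (hf : continuous f) (hq : p < q) (hA : 0 < A)
    (hfq : (limf_esup (fun t : R => (`|f t| / `|t| `^ (q - 1))%:E) 0%R^'
              <= A%:E)%E)
    (hu : weak_solution p mu m f u)
    (hrad : radial_profile u U)
    (hpos : forall x, x != 0 -> 0 < u x)
    (hk : k%:R <= p < k.+1%:R) :
  (\forall r \near +oo, derivable U r 1 /\ derive1 U r < 0) /\
  exists c : nat -> R,
    [/\ is_coeffs N p m k c,
        forall c', is_coeffs N p m k c' ->
          forall i, (i <= k)%N -> c' i = c i &
        (fun r : R => (- derive1 U r / U r) `^ (p - 1)
           - (\sum_(i < k.+1) c i / r ^+ i
              - ((p - 1) / m) `^ p^-1 * mu / (p * r `^ p)))
          =O_+oo (fun r : R => (r ^+ k.+1)^-1)].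
Proof.
have /andP[p1 pN] := hp.
have N1 : (1 < N)%N by rewrite -(ltr_nat R) (lt_trans p1).
have [d d0 hd] := limf_esup_dnbhs_bound hfq.
have d20 : 0 < d / 2 by rewrite divr_gt0.
have A1 : 0 <= A + 1 by rewrite addr_ge0// ltW.
have f_small t : 0 < t -> t <= d / 2 -> `|f t| <= (A + 1) * t `^ (q - 1).
  move=> t0 td; have := hd t; rewrite gtr0_norm// t0 => h.
  by rewrite -ler_pdivrMr ?powR_gt0// h//= (le_lt_trans td)// ltr_pdivrMr// mulr_natr mulr2n ltrDl.
have U_gt0 r : 0 < r -> 0 < U r by exact: (radial_gt0 N1 hrad hpos).
have dU := radial_is_derive N1 p1 hf hu hrad hpos.
have dP := radial_flux_is_derive N1 p1 hf hu hrad hpos.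
have U_vanish := radial_vanish N1 p1 hf hu hrad hpos.
split.
  have neg := derivative_lt0 p1 hm hq A1 d20 U_gt0 dU dP U_vanish f_small.
  near=> r; have r0 : 0 < r.
    by rewrite (@lt_le_trans _ _ 1)//; near: r; exact: near_ge.
  by split; [case: (dU r r0)|near: r].
have [c hc] := coefficients_exist N k p1 hm.
exists c; split => //; first by move=> c'; exact: coefficients_unique.
apply: decays_eqO.
exact: (riccati_expansion (ltnW N1) p1 hm hq A1 d20 U_gt0 dU dP U_vanish f_small hk hc).
Unshelve. all: by end_near. Qed.
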